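(* Let $\Omega\subset\mathbb H^n$ be a domain, $1\le m\le n$, and let $u\in C^2(\Omega)$ be a real-valued function. Then $u$ is quaternionic $m$-subharmonic in the sense of currents (definition (W) of the context) if and only if $$\left(\frac{\partial^2u}{\partial\overline{q_l}\partial q_k}\right)(q)\in\overline{\Gamma}_m\qquad\text{for every }q\in\Omega .$$
   Context: Coordinates: $q=(q_0,\dots,q_{n-1})\in\mathbb H^n\cong\mathbb R^{4n}$, $q_l=x_{4l}+x_{4l+1}\mathbf i+x_{4l+2}\mathbf j+x_{4l+3}\mathbf k$; $dV$ is Lebesgue measure. Forms: fix a basis $\omega^0,\dots,\omega^{2n-1}$ of $\mathbb C^{2n}$. For $l=0,\dots,n-1$ let $\nabla_{l0}=\partial_{x_{4l}}+\mathbf i\partial_{x_{4l+1}}$, $\nabla_{l1}=-\partial_{x_{4l+2}}-\mathbf i\partial_{x_{4l+3}}$, $\nabla_{(n+l)0}=\partial_{x_{4l+2}}-\mathbf i\partial_{x_{4l+3}}$, $\nabla_{(n+l)1}=\partial_{x_{4l}}-\mathbf i\partial_{x_{4l+1}}$ (complex $\mathbf i$). For a $\wedge^p\mathbb C^{2n}$-valued $F=\sum_If_I\omega^I$ put $d_\alpha F=\sum_I\sum_{A=0}^{2n-1}\nabla_{A\alpha}f_I\,\omega^A\wedge\omega^I$ ($\alpha=0,1$) and $\Delta=d_0d_1$. Let $\beta_n=\sum_{l=0}^{n-1}\omega^l\wedge\omega^{n+l}$, $\Omega_{2n}=\omega^0\wedge\omega^n\wedge\cdots\wedge\omega^{n-1}\wedge\omega^{2n-1}$,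 and $\int f\,\Omega_{2n}=\int f\,dV$. Hessian: $\frac{\partial}{\partial\overline{q_l}}=\partial_{x_{4l}}+\mathbf i\partial_{x_{4l+1}}+\mathbf j\partial_{x_{4l+2}}+\mathbf k\partial_{x_{4l+3}}$ and $\frac{\partial}{\partial q_l}$ is its conjugate $\partial_{x_{4l}}-\mathbf i\partial_{x_{4l+1}}-\mathbf j\partial_{x_{4l+2}}-\mathbf k\partial_{x_{4l+3}}$; for real $u\in C^2$ the matrix $\left(\frac{\partial^2u}{\partial\overline{q_l}\partial q_k}\right)$ is hyperhermitian. For a hyperhermitian $A=U\operatorname{diag}(\lambda_1,\dots,\lambda_n)U^*$ ($U$ quaternionic unitary, $\lambda_j\in\mathbb R$) put $\mathcal H_m(A)=\sum_{j_1<\dots<j_m}\lambda_{j_1}\cdots\lambda_{j_m}$, and let $\Gamma_m$ be the set of hyperhermitian $A$ with $\mathcal H_m(sI+A)>0$ for all $s\ge0$; $\overline\Gamma_m$ is its closure. Smooth class: a real $C^2$ function $v$ is called a $C^2$ quaternionic $m$-subharmonic function if its quaternionic Hessian lies in $\overline\Gamma_m$ at every point; a $C^4$ one is a $C^4$ function with this property. (W) A $[-\infty,\infty)$-valued upper semicontinuous $u\in L^1_{loc}(\Omega)$ is quaternionic $m$-subharmonic if for all $C^4$ quaternionic $m$-subharmonic functions $v_1,\dots,v_{m-1}$ on $\Omega$ (in the Hessian sense just given) and all nonnegative $\omega\in C_0^\infty(\Omega)$, $$\int_\Omega u\,\Delta v_1\wedge\dots\wedge\Delta v_{m-1}\wedge\beta_n^{n-m}\wedge\Delta\omega\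 \ge0 .$$ *)

(* Defs.v *)
From HB Require Import structures.
From mathcomp Require Import all_boot all_order all_algebra.
From mathcomp Require Import complex.
From mathcomp Require Import all_classical all_reals all_analysis.
From mathcomp Require Import ring.

Set Implicit Arguments.
Unset Strict Implicit.
Unset Printing Implicit Defensive.

Import Order.TTheory GRing.Theory Num.Theory.
Import numFieldNormedType.Exports.

Local Open Scope classical_set_scope.
Local Open Scope ring_scope.

(** R^N is the space of row vectors ['rV[R]_N]; as for tuples in the library, it
    gets the sigma-algebra generated by the coordinates, i.e. the Borel one. *)
Section measurable_row.
Context {d} {T : sigmaRingType d} (N : nat).

Let coors (i : 'I_N) (x : 'rV[T]_N) : T := x ord0 i.

Let row_set0 : g_sigma_preimage coors set0.
Proof. exact: sigma_algebra0. Qed.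

Let row_setC A : g_sigma_preimage coors A -> g_sigma_preimage coors (~` A).
Proof. exact: sigma_algebraC. Qed.

Let row_bigcup (F : (set 'rV[T]_N)^nat) :
  (forall i, g_sigma_preimage coors (F i)) ->
  g_sigma_preimage coors (\bigcup_i (F i)).
Proof. exact: sigma_algebra_bigcup. Qed.

HB.instance Definition _ := @isMeasurable.Build (measure_tuple_display d)
  'rV[T]_N (g_sigma_preimage coors) row_set0 row_setC row_bigcup.

End measurable_row.

Lemma measurable_fun_rowP d1 d2 (T1 : measurableType d1)
    (T2 : measurableType d2) N (f : T1 -> 'rV[T2]_N) :
  (forall i, measurable_fun [set: T1] (fun x => f x ord0 i)) ->
  measurable_fun [set: T1] f.
Proof.
move=> mf.
apply: (@measurability _ _ _ _ _ _ (\big[setU/set0]_(i < N)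
  preimage_set_system setT (fun x : 'rV[T2]_N => x ord0 i) measurable)) => //.
move=> _ [A + <-]; rewrite -bigcup_seq => -[i _ [B mB <-]].
by rewrite !setTI; have := mf i measurableT B mB; rewrite setTI.
Qed.

Lemma measurable_coord d (T : measurableType d) N (i : 'I_N) :
  measurable_fun [set: 'rV[T]_N] (fun x => x ord0 i).
Proof.
move=> _ Y mY; rewrite setTI; apply: sub_sigma_algebra => /=.
rewrite -bigcup_seq/=; exists i => /=; first by rewrite mem_index_enum.
by exists Y => //; rewrite setTI.
Qed.

Section lebesgue_row.
Context {R : realType}.

Definition consr N (p : measurableTypeR R * 'rV[R]_N) : 'rV[R]_N.+1 :=
  row_mx (const_mx p.1 : 'rV_1) p.2.

Definition unconsr N (x : 'rV[R]_N.+1) : measurableTypeR R * 'rV[R]_N :=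
  (x ord0 ord0, \row_i x ord0 (lift ord0 i)).

Lemma consr0 N (p : R * 'rV[R]_N) : consr p ord0 ord0 = p.1 :> R.
Proof.
have -> : ord0 = lshift N ord0 :> 'I_(1 + N) by apply: ord_inj.
by apply: etrans (row_mxEl _ _ _ _) _; rewrite mxE.
Qed.

Lemma consrS N (p : R * 'rV[R]_N) (i : 'I_N) : consr p ord0 (lift ord0 i) = p.2 ord0 i.
Proof.
have -> : lift ord0 i = rshift 1 i :> 'I_(1 + N) by apply: ord_inj.
exact: row_mxEr.
Qed.

Lemma consrK N : cancel (@consr N) (@unconsr N).
Proof.
move=> [a v]; rewrite /unconsr consr0; congr pair.
by apply/rowP => i; rewrite mxE consrS.
Qed.

Lemma measurable_consr N :
  measurable_fun [set: measurableTypeR R * 'rV[R]_N] (@consr N).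
Proof.
apply: measurable_fun_rowP => i; case: (unliftP ord0 i) => [j ->|->].
  under eq_fun do rewrite consrS.
  exact: (measurableT_comp (measurable_coord j) measurable_snd).
by under eq_fun do rewrite consr0; exact: measurable_fst.
Qed.

Lemma measurable_unconsr N : measurable_fun [set: 'rV[R]_N.+1] (@unconsr N).
Proof.
apply/measurable_fun_pairP; split; first exact: measurable_coord.
apply: measurable_fun_rowP => i /=.
by under eq_fun do rewrite mxE; exact: measurable_coord.
Qed.

Section step.
Variables (N : nat) (mu : {sigma_finite_measure set 'rV[R]_N -> \bar R}).

Definition lebesgue_step : set 'rV[R]_N.+1 -> \bar R :=
  pushforward (@lebesgue_measure R \x mu)%E (@consr N).

Let step0 : lebesgue_step set0 = 0%E.
Proof. by rewrite /lebesgue_step /pushforward preimage_set0 measure0. Qed.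

Let step_ge0 A : (0 <= lebesgue_step A)%E.
Proof. exact: (measure_ge0 (lebesgue_measure \x mu)%E). Qed.

Let step_sigma_additive : semi_sigma_additive lebesgue_step.
Proof.
have mc A : measurable A -> measurable (@consr N @^-1` A).
  by move=> mA; rewrite -[X in measurable X]setTI; exact: measurable_consr.
move=> F mF tF mUF; rewrite /lebesgue_step /pushforward preimage_bigcup.
apply: measure_semi_sigma_additive => [k||]; first exact: mc.
- apply/trivIsetP => /= i j _ _ ij; rewrite -preimage_setI.
  by move/trivIsetP : tF => /(_ _ _ _ _ ij) ->//; rewrite preimage_set0.
- by rewrite -preimage_bigcup; exact: mc.
Qed.

HB.instance Definition _ := isMeasure.Build _ _ _ lebesgue_step
  step0 step_ge0 step_sigma_additive.

Lemma lebesgue_step_sigma_finite : sigma_finite [set: 'rV[R]_N.+1] lebesgue_step.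
Proof.
have [H HT mH] : sigma_finite [set: measurableTypeR R * 'rV[R]_N]
    (lebesgue_measure \x mu)%E.
  have /sigma_finiteP[F [TF ndF Foo]] := sigma_finiteT (@lebesgue_measure R).
  have /sigma_finiteP[G [TG ndG Goo]] := sigma_finiteT mu.
  exists (fun k => F k `*` G k).
    rewrite -setXTT TF TG predeqE => -[x y]; split.
      move=> [/= [n _ Fnx] [k _ Gky]]; exists (maxn n k) => //; split.
      - by move: x Fnx; exact/subsetPset/ndF/leq_maxl.
      - by move: y Gky; exact/subsetPset/ndG/leq_maxr.
    by move=> [n _ []/= ? ?]; split; exists n.
  move=> k; have [? ?] := Foo k; have [? ?] := Goo k.
  split; first exact: measurableX.
  by rewrite product_measure1E// lte_mul_pinfty// ge0_fin_numE.
exists (fun k => @unconsr N @^-1` H k).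
  by rewrite -preimage_bigcup -HT preimage_setT.
move=> k; have [mHk Hk] := mH k; split.
  by rewrite -[X in measurable X]setTI; exact: measurable_unconsr.
rewrite /lebesgue_step /pushforward -comp_preimage.
rewrite (_ : _ \o _ = id) ?preimage_id//.
by apply/funext => p /=; rewrite consrK.
Qed.

HB.instance Definition _ :=
  Measure_isSigmaFinite.Build _ _ _ lebesgue_step lebesgue_step_sigma_finite.

End step.

Fixpoint lebesgue_row (N : nat) : {sigma_finite_measure set 'rV[R]_N -> \bar R} :=
  match N with
  | 0 => \d_ (0 : 'rV[R]_0)
  | N'.+1 => lebesgue_step (lebesgue_row N')
  end.

Lemma lebesgue_row_box N (A : 'I_N -> set R) :
  (forall i, measurable (A i)) ->
  lebesgue_row N [set x | forall i, A i (x ord0 i)] =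
  (\prod_(i < N) lebesgue_measure (A i))%E.
Proof.
elim: N A => [|N IHN] A mA.
  by rewrite big_ord0 /= diracE mem_set// => -[].
rewrite big_ord_recl -IHN; last by move=> i; exact: mA.
rewrite /= /lebesgue_step /pushforward.
rewrite -product_measure1E; [|exact: mA|]; last first.
  suff : measurable (\bigcap_(i in [set: 'I_N])
      ((fun x : 'rV[R]_N => x ord0 i) @^-1` A (lift ord0 i))).
    congr measurable.
    by apply/seteqP; split => [x Ax i|x Ax i _]; exact: Ax.
  apply: fin_bigcap_measurable => // i _.
  by rewrite -[X in measurable X]setTI; exact: measurable_coord.
rewrite [LHS](_ : _ = (lebesgue_measure \x lebesgue_row N)%E
    (@consr N @^-1` [set x | forall i, A i (x ord0 i)])) //.
congr (product_measure1 _ _ _); apply/seteqP; split => [p Ap|p [Ap1 Ap2] i].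
- by split => [|i]; [have := Ap ord0|have := Ap (lift ord0 i)];
    rewrite /= ?consr0 ?consrS.
- by case: (unliftP ord0 i) => [j ->|->]; rewrite /= ?consr0 ?consrS.
Qed.

End lebesgue_row.

Section calculus.
Context {R : realType} {N : nat}.
Implicit Types (D : set 'rV[R]_N) (f : 'rV[R]_N -> R).

Definition is_domain D : Prop := [/\ open D, connected D & D !=set0].

Definition evec (i : 'I_N) : 'rV[R]_N := delta_mx ord0 i.

Definition partial (i : 'I_N) f : 'rV[R]_N -> R := 'D_(evec i) f.

(** [C^k] by iterated partial derivatives, all of them continuous on [D].
    [D] is meant to be open; only the values of [f] on [D] matter. *)
Fixpoint Ck (k : nat) D f : Prop :=
  (forall x, D x -> {for x, continuous f}) /\
  if k is k'.+1 then
    forall i, (forall x, D x -> derivable f x (evec i)) /\ Ck k' D (partial i f)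
  else True.

Definition test_function D f : Prop :=
  [/\ forall k, Ck k D f,
      compact (closure [set x | f x != 0]) &
      closure [set x | f x != 0] `<=` D].

Definition usc_on D (u : 'rV[R]_N -> \bar R) : Prop :=
  forall x a, D x -> (u x < a%:E)%E -> \forall y \near x, (u y < a%:E)%E.

Definition L1loc D (u : 'rV[R]_N -> \bar R) : Prop :=
  forall K, compact K -> K `<=` D -> (@lebesgue_row R N).-integrable K u.

End calculus.

(** [(a, b, c, d)] stands for a + b i + c j + d k. *)
Definition quat (R : Type) : Type := (R * R * R * R)%type.

Section quaternion.
Context {R : realType}.

HB.instance Definition _ := NormedModule.copy (quat R) (R * R * R * R)%type.

Definition qmul (x y : quat R) : quat R :=
  let: (a, b, c, d) := x in let: (a', b', c', d') := y in
  (a * a' - b * b' - c * c' - d * d',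
   a * b' + b * a' + c * d' - d * c',
   a * c' - b * d' + c * a' + d * b',
   a * d' + b * c' - c * b' + d * a').

Definition qreal (a : R) : quat R := (a, 0, 0, 0).

Fact qmulA : associative qmul.
Proof.
move=> [[[? ?] ?] ?] [[[? ?] ?] ?] [[[? ?] ?] ?].
by rewrite /qmul; congr (_, _, _, _); ring.
Qed.

Fact qmul1l : left_id (qreal 1) qmul.
Proof.
by move=> [[[? ?] ?] ?]; rewrite /qmul; congr (_, _, _, _); ring.
Qed.

Fact qmul1r : right_id (qreal 1) qmul.
Proof.
by move=> [[[? ?] ?] ?]; rewrite /qmul; congr (_, _, _, _); ring.
Qed.

Fact qmulDl : left_distributive qmul +%R.
Proof.
move=> [[[? ?] ?] ?] [[[? ?] ?] ?] [[[? ?] ?] ?].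
by rewrite /qmul; congr (_, _, _, _); rewrite /=; ring.
Qed.

Fact qmulDr : right_distributive qmul +%R.
Proof.
move=> [[[? ?] ?] ?] [[[? ?] ?] ?] [[[? ?] ?] ?].
by rewrite /qmul; congr (_, _, _, _); rewrite /=; ring.
Qed.

Fact qone_neq0 : qreal 1 != 0.
Proof. by apply/eqP => -[] /eqP; rewrite oner_eq0. Qed.

HB.instance Definition _ := GRing.Zmodule_isNzRing.Build (quat R)
  qmulA qmul1l qmul1r qmulDl qmulDr qone_neq0.

Definition qconj (x : quat R) : quat R :=
  let: (a, b, c, d) := x in (a, - b, - c, - d).

(** The units 1, i, j, k. *)
Definition qunit (a : 'I_4) : quat R :=
  tnth [tuple (1, 0, 0, 0); (0, 1, 0, 0); (0, 0, 1, 0); (0, 0, 0, 1)] a.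

End quaternion.

Section hyperhermitian.
Context {R : realType} {n : nat}.
Implicit Types A U : 'M[quat R]_n.

Definition qadj A : 'M[quat R]_n := \matrix_(i, j) qconj (A j i).

Definition hyperhermitian A : Prop := qadj A = A.

Definition qunitary U : Prop := U *m qadj U = 1%:M /\ qadj U *m U = 1%:M.

Definition qdiag (lam : 'I_n -> R) : 'M[quat R]_n :=
  diag_mx (\row_j qreal (lam j)).

Definition esymm (m : nat) (lam : 'I_n -> R) : R :=
  \sum_(J : {set 'I_n} | #|J| == m) \prod_(j in J) lam j.

(** The value does not depend on the diagonalization of a hyperhermitian [A];
    the default [0] is only used when [A] is not hyperhermitian. *)
Definition Hm (m : nat) A : R :=
  xget 0 [set h | exists U lam,
    [/\ qunitary U, A = U *m qdiag lam *m qadj U & h = esymm m lam]].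

Definition Gamma (m : nat) : set 'M[quat R]_n :=
  [set A | hyperhermitian A /\
           forall s : R, 0 <= s -> 0 < Hm m ((qreal s)%:M + A)].

End hyperhermitian.

(** A form is given by its coefficients in the basis of the [omega^J], the
    increasing products of the [omega^A] for [A \in J]; the index set
    [{0, ..., 2n-1}] is ['I_(n + n)], so that [omega^l] and [omega^(n+l)] have
    indices [lshift n l] and [rshift n l]. *)
Section forms.
Context {R : realType} {n : nat}.

Definition form : Type := {ffun {set 'I_(n + n)} -> R[i]}.

HB.instance Definition _ := GRing.Lmodule.copy form {ffun {set 'I_(n + n)} -> R[i]}.

Definition bform (J : {set 'I_(n + n)}) : form := [ffun K => (K == J)%:R].

(** Number of transpositions needed to sort [I] followed by [J]. *)
Definition inversions (I J : {set 'I_(n + n)}) : nat :=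
  #|[set p : 'I_(n + n) * 'I_(n + n) | [&& p.1 \in I, p.2 \in J & (p.2 < p.1)%N]]%SET|.

Definition wedge (F G : form) : form :=
  [ffun K : {set 'I_(n + n)} => \sum_(J in powerset K)
    (-1) ^+ inversions J (K :\: J) * F J * G (K :\: J)].

Definition form1 : form := bform finset.set0.

Definition wpow (F : form) (k : nat) : form := iter k (wedge F) form1.

Definition omega (A : 'I_(n + n)) : form := bform [set A]%SET.

Definition beta : form :=
  \sum_(l < n) wedge (omega (lshift n l)) (omega (rshift n l)).

Definition Omega2n : form :=
  \big[wedge/form1]_(l < n) wedge (omega (lshift n l)) (omega (rshift n l)).

(** The [c] such that the component of [F] of degree [2n] is [c *: Omega2n];
    here [Omega2n setT] is 1 or -1. *)
Definition top_coef (F : form) : R[i] := F finset.setT / Omega2n finset.setT.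

End forms.

Arguments form R n : clear implicits.

Section operators.
Context {R : realType} {n : nat}.
Local Notation point := 'rV[R]_(4 * n).

Fact xidx_subproof (l : 'I_n) (a : 'I_4) : (4 * l + a < 4 * n)%N.
Proof.
by rewrite (leq_trans (_ : _ < 4 * l.+1)%N) ?leq_mul2l ?ltn_ord// mulnS addnC ltn_add2r.
Qed.

Definition xidx (l : 'I_n) (a : 'I_4) : 'I_(4 * n) :=
  Ordinal (xidx_subproof l a).

(** [R[i]] is not a normed module over [R]: a complex valued function is
    differentiated componentwise. *)
Definition dxc (l : 'I_n) (a : 'I_4) (f : point -> R[i]) : point -> R[i] :=
  fun q => (partial (xidx l a) (fun y => complex.Re (f y)) q
         +i* partial (xidx l a) (fun y => complex.Im (f y)) q)%C.

Definition nabla (A : 'I_(n + n)) (alpha : 'I_2) (f : point -> R[i])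
    : point -> R[i] := fun q =>
  match fintype.split A with
  | inl l => if alpha == 0 then dxc l 0 f q + 'i%C * dxc l 1 f q
             else - dxc l 2 f q - 'i%C * dxc l 3 f q
  | inr l => if alpha == 0 then dxc l 2 f q - 'i%C * dxc l 3 f q
             else dxc l 0 f q - 'i%C * dxc l 1 f q
  end.

Definition dform (alpha : 'I_2) (F : point -> form R n) : point -> form R n :=
  fun q => \sum_(J : {set 'I_(n + n)}) \sum_(A < n + n)
    nabla A alpha (fun y => F y J) q *: wedge (omega A) (bform J).

Definition Delta (v : point -> R) : point -> form R n :=
  dform 0 (dform 1 (fun q => (v q)%:C%C *: form1)).

(** In both operators the quaternionic units multiply on the left. *)
Definition dqbar (l : 'I_n) (f : point -> quat R) : point -> quat R :=
  fun q => \sum_(a < 4) qunit a * 'D_(evec (xidx l a)) f q.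

Definition dq (l : 'I_n) (f : point -> quat R) : point -> quat R :=
  fun q => \sum_(a < 4) qconj (qunit a) * 'D_(evec (xidx l a)) f q.

Definition qhessian (u : point -> R) (q : point) : 'M[quat R]_n :=
  \matrix_(l, k) dqbar l (dq k (fun y => qreal (u y))) q.

Definition Gamma_bar (m : nat) : set 'M[quat R]_n := closure (Gamma m).

Definition Ck_qmsh (k m : nat) (D : set point) (v : point -> R) : Prop :=
  Ck k D v /\ forall q, D q -> Gamma_bar m (qhessian v q).

(** [u] is extended real valued and [F] has complex coefficients, so the real and
    imaginary parts of the integral of [u F] are taken separately through [part]. *)
Definition form_integral (D : set point) (u : point -> \bar R)
    (F : point -> form R n) (part : R[i] -> R) : \bar R :=
  (\int[lebesgue_row (4 * n)]_(q in D) (u q * (part (top_coef (F q)))%:E))%E.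

Definition form_integral_ge0 (D : set point) (u : point -> \bar R)
    (F : point -> form R n) : Prop :=
  form_integral D u F (@complex.Im R) = 0%E /\
  (0 <= form_integral D u F (@complex.Re R))%E.

Definition qm_subharmonic (m : nat) (D : set point) (u : point -> \bar R) : Prop :=
  [/\ forall q, D q -> (u q < +oo)%E,
      usc_on D u,
      L1loc D u &
      forall (v : 'I_m.-1 -> point -> R) (w : point -> R),
        (forall j, Ck_qmsh 4 m D (v j)) ->
        test_function D w -> (forall q, D q -> 0 <= w q) ->
        form_integral_ge0 D u (fun q =>
          wedge (\big[wedge/form1]_(j < m.-1) Delta (v j) q)
            (wedge (wpow beta (n - m)) (Delta w q)))].

End operators.

(* Main.v *)
(** Identify [x = a + j b] with a pair of complex numbers and attach to the l-th
    coordinate the 1-forms [qform0 l x], [qform1 l x]; then [d_b] is the sum over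
    the real coordinates of [qform b l e] wedge the partial derivative, and
    [Delta v] is the 2-form [herm_form] of the quaternionic Hessian of [v].
    Diagonalizing a hyperhermitian [A], the form [herm_form A] becomes
    [sum_j lam_j eta_j] with commuting [eta_j] of square zero and sum [beta], so
    [herm_form A ^ m * beta ^ (n-m)] is a positive multiple of [H_m(A)] times the
    volume form.  The polynomial [H_m] is hyperbolic, and Garding's inequality
    (proved by a root homotopy and Gauss-Lucas) makes mixed products of matrices
    in [Gamma_m] positive.

    Each factor [Delta v_j] is closed for [d_0] and [d_1], so two integrations by
    parts move [Delta] from the test function to [u]; Garding's inequality and
    passage to the closure give one implication.  Conversely, testing
    with bump functions and with quadratic [v_j] of Hessian [I + x A], where [A]
    is the Hessian of [u] at a point, shows that [x |-> H_m(I + x A)] has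
    nonnegative derivative as long as it is positive on [0, x].  It is therefore
    positive on the half line, i.e. [A + e I] is in [Gamma_m] for all [e > 0]. *)

From HB Require Import structures.
From mathcomp Require Import all_boot all_order all_algebra.
From mathcomp Require Import complex.
From mathcomp Require Import all_classical all_reals all_analysis.
From mathcomp Require Import measurable_realfun.
From mathcomp Require Import ring lra zify.
Require Import Defs.

Set Implicit Arguments.
Unset Strict Implicit.
Unset Printing Implicit Defensive.

Import Order.TTheory GRing.Theory Num.Theory.
Import numFieldNormedType.Exports.

Local Open Scope ring_scope.

(** * The algebra of forms *)

(** No determinant of a quaternionic matrix is used. [Hm] is read off from powers of forms through a
    linear functional [tau] (finally [top_coef]). The value of [tau] on
    [herm_form A ^ m * beta ^ (n-m)] does not refer to a diagonalization, so the same identity shows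
    that [Hm] is well defined. Up to Garding's inequality the algebra is abstract: all that enters
    is how the one-forms [f b l x] behave under sums, right multiplication and exchange. Polynomials
    are written [tau (x ^ k * w)] with a weight [w]; differentiating moves a factor into [w], which
    is polarization without multilinear forms.

    The converse does without a dual description of the cone. Its difficulty is circular: a function
    of Hessian I + x A is admissible as [v_j] only if I + x A is already in the cone. By homogeneity
    (1 + s) I + x A is a positive multiple of I + y A with y = x / (1 + s) <= x, so membership at x
    only asks for positivity on [0, x], and positivity propagates along the ray. The density with m
    - 1 factors I + x A and one factor A is, up to a positive constant, the derivative of H_m(I + x
    A). *)

Section form_ring.
Context {R : realType} {n : nat}.
Local Notation C := (R[i]).
Local Notation form := (form R n).
Implicit Types (F G H : form) (I J K : {set 'I_(n + n)}).

Lemma formZE (a : C) F J : (a *: F) J = a * F J.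
Proof. by rewrite ffunE. Qed.

Lemma form_expand F : F = \sum_J F J *: bform J.
Proof.
apply/ffunP => K; rewrite sum_ffunE (bigD1 K)//= big1 => [|J JK]; last first.
  by rewrite !ffunE eq_sym (negbTE JK); exact: mulr0.
by rewrite addr0 !ffunE eqxx; exact/esym/mulr1.
Qed.

Lemma wedgeDl : left_distributive (@wedge R n) +%R.
Proof.
move=> F G H; apply/ffunP => K; rewrite !ffunE -big_split/=.
by apply: eq_bigr => J _; rewrite !ffunE mulrDr mulrDl.
Qed.

Lemma wedgeDr : right_distributive (@wedge R n) +%R.
Proof.
move=> F G H; apply/ffunP => K; rewrite !ffunE -big_split/=.
by apply: eq_bigr => J _; rewrite !ffunE mulrDr.
Qed.

Lemma wedgeZl (a : C) F G : wedge (a *: F) G = a *: wedge F G.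
Proof.
apply/ffunP => K; rewrite formZE !ffunE mulr_sumr.
by apply: eq_bigr => J _; rewrite formZE mulrCA -!mulrA.
Qed.

Lemma wedgeZr (a : C) F G : wedge F (a *: G) = a *: wedge F G.
Proof.
apply/ffunP => K; rewrite formZE !ffunE mulr_sumr.
by apply: eq_bigr => J _; rewrite formZE mulrCA.
Qed.

Lemma wedge_suml (I : finType) (F : I -> form) G :
  wedge (\sum_i F i) G = \sum_i wedge (F i) G.
Proof.
apply: (big_morph (fun F => wedge F G)) => [? ?|]; first exact: wedgeDl.
by rewrite -(scale0r (0 : form)) wedgeZl !scale0r.
Qed.

Lemma wedge_sumr (I : finType) F (G : I -> form) :
  wedge F (\sum_i G i) = \sum_i wedge F (G i).
Proof.
apply: (big_morph (wedge F)) => [? ?|]; first exact: wedgeDr.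
by rewrite -(scale0r (0 : form)) wedgeZr !scale0r.
Qed.

Lemma wedge_bform I J : wedge (bform I) (bform J) =
  if [disjoint I & J] then (-1 : C) ^+ inversions I J *: bform (I :|: J) else 0.
Proof.
apply/ffunP => K; rewrite ffunE.
have -> : \sum_(J0 in powerset K) (-1) ^+ inversions J0 (K :\: J0) *
    bform I J0 * bform J (K :\: J0) =
    \sum_(J0 | J0 == I) ((-1 : C) ^+ inversions I (K :\: I) *
    ((I \subset K) && (K :\: I == J))%:R).
  rewrite big_mkcond [RHS]big_mkcond; apply: eq_bigr => J0 _.
  rewrite !ffunE powersetE; case: (eqVneq J0 I) => [->|_]; last first.
    by rewrite mulr0 mul0r if_same.
  by case: (I \subset K) => /=; rewrite !(mulr1, mulr0).
rewrite big_pred1_eq.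
have -> : (I \subset K) && (K :\: I == J) = [disjoint I & J] && (K == I :|: J).
  apply/andP/andP => [[IK /eqP <-]|[dIJ /eqP ->]].
    have -> : I :|: K :\: I = K.
      by rewrite -{1}(finset.setIidPr IK) finset.setID.
    rewrite eqxx -finset.setI_eq0; split=> //.
    by apply/eqP/finset.setP => x; rewrite !inE; case: (x \in I).
  split; first exact: finset.subsetUl.
  by rewrite finset.setDUl finset.setDv finset.set0U; apply/eqP/finset.setDidPl;
    rewrite disjoint_sym.
case: ifP => dIJ /=; last by rewrite mulr0 !ffunE.
rewrite formZE !ffunE; case: (eqVneq K _) => [->|_]; last by rewrite !mulr0.
rewrite finset.setDUl finset.setDv finset.set0U.
by congr (_ ^+ inversions _ _ * _); apply/finset.setDidPl; rewrite disjoint_sym.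
Qed.

Lemma inversionsUl I J K : [disjoint I & J] ->
  inversions (I :|: J) K = (inversions I K + inversions J K)%N.
Proof.
move=> dIJ; rewrite /inversions -cardsUI.
rewrite [X in (_ = _ + X)%N]eq_card0 ?addn0; last first.
  move=> p; rewrite !inE; apply/negP => /andP[/and3P[pI _ _] /and3P[pJ _ _]].
  by have := disjointFr dIJ pI; rewrite pJ.
by apply: eq_card => p; rewrite !inE andb_orl.
Qed.

Lemma inversionsUr I J K : [disjoint J & K] ->
  inversions I (J :|: K) = (inversions I J + inversions I K)%N.
Proof.
move=> dJK; rewrite /inversions -cardsUI.
rewrite [X in (_ = _ + X)%N]eq_card0 ?addn0; last first.
  move=> p; rewrite !inE; apply/negP => /andP[/and3P[_ pJ _] /and3P[_ pK _]].
  by have := disjointFr dJK pJ; rewrite pK.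
by apply: eq_card => p; rewrite !inE; case: (_ \in I) => //=; rewrite andb_orl.
Qed.

(** Both bracketings carry the inversions of the three pairs (I, J), (I, K), (J, K), because
    [inversions] is additive over disjoint unions; if two of the sets meet, both sides vanish. *)
Lemma wedge_bformA I J K :
  wedge (bform I) (wedge (bform J) (bform K)) =
  wedge (wedge (bform I) (bform J)) (bform K) :> form.
Proof.
have w0 (F : form) : wedge 0 F = 0 by rewrite -(scale0r (0 : form)) wedgeZl !scale0r.
have w0' (F : form) : wedge F 0 = 0 by rewrite -(scale0r (0 : form)) wedgeZr !scale0r.
rewrite !wedge_bform.
have dUr : [disjoint I & J :|: K] = [disjoint I & J] && [disjoint I & K].
  by rewrite ![[disjoint I & _]]disjoint_sym !finset.disjoints_subset finset.subUset.
have dUl : [disjoint I :|: J & K] = [disjoint I & K] && [disjoint J & K].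
  by rewrite !finset.disjoints_subset finset.subUset.
case: (boolP [disjoint J & K]) => dJK; case: (boolP [disjoint I & J]) => dIJ;
  rewrite ?w0 ?w0' ?wedgeZl ?wedgeZr ?wedge_bform ?dUr ?dUl ?dIJ ?dJK ?(negbTE dIJ)
    ?(negbTE dJK) ?andbF /= ?scaler0//.
rewrite andbT finset.setUA (inversionsUl K dIJ) (inversionsUr I dJK).
case: [disjoint I & K]; last by rewrite !scaler0.
rewrite [LHS]scalerA [RHS]scalerA -!exprD.
by rewrite [in LHS]addnC -addnA.
Qed.

Lemma wedgeA : associative (@wedge R n).
Proof.
have A3 I J H : wedge (bform I) (wedge (bform J) H) = wedge (wedge (bform I) (bform J)) H.
  rewrite (form_expand H) !wedge_sumr; apply: eq_bigr => K _.
  by rewrite !wedgeZr wedge_bformA.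
have A2 I G H : wedge (bform I) (wedge G H) = wedge (wedge (bform I) G) H.
  rewrite (form_expand G) wedge_suml !wedge_sumr wedge_suml; apply: eq_bigr => J _.
  by rewrite wedgeZl !wedgeZr wedgeZl A3.
move=> F G H; rewrite (form_expand F) !wedge_suml; apply: eq_bigr => I _.
by rewrite !wedgeZl A2.
Qed.

Lemma wedge1l : left_id (form1 : form) (@wedge R n).
Proof.
move=> F; rewrite [in LHS](form_expand F) [RHS]form_expand wedge_sumr.
apply: eq_bigr => I _; rewrite wedgeZr wedge_bform finset.set0U.
rewrite finset.disjoints_subset finset.sub0set /inversions eq_card0 ?scale1r//.
by move=> p; rewrite !inE.
Qed.

Lemma wedge1r : right_id (form1 : form) (@wedge R n).
Proof.
move=> F; rewrite [in LHS](form_expand F) [RHS]form_expand wedge_suml.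
apply: eq_bigr => I _; rewrite wedgeZl wedge_bform finset.setU0.
rewrite disjoint_sym finset.disjoints_subset finset.sub0set /inversions eq_card0 ?scale1r//.
by move=> p; rewrite !inE andbF.
Qed.

Lemma form1_neq0 : (form1 : form) != 0.
Proof.
by apply/eqP => /ffunP/(_ finset.set0); rewrite !ffunE eqxx => /eqP; rewrite oner_eq0.
Qed.

(** From here on the wedge product is a ring multiplication, so powers, iterated products and
    general ring lemmas apply to forms. *)
HB.instance Definition _ := GRing.Zmodule_isNzRing.Build form
  wedgeA wedge1l wedge1r wedgeDl wedgeDr form1_neq0.

HB.instance Definition _ := GRing.Lmodule_isLalgebra.Build C form
  (fun a F G => esym (wedgeZl a F G)).

HB.instance Definition _ := GRing.Lalgebra_isAlgebra.Build C form
  (fun a F G => esym (wedgeZr a F G)).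

End form_ring.

(** * Forms of degree one, forms commuting with them, and the volume form *)

Section one_forms.
Context {R : realType} {n : nat}.
Local Notation C := (R[i]).
Local Notation form := (form R n).
Implicit Types (F G H : form) (I J K : {set 'I_(n + n)}).

Lemma wedgeE F G : wedge F G = F * G.
Proof. by []. Qed.

Lemma form1E : form1 = 1 :> form.
Proof. by []. Qed.

Lemma wpowE F k : wpow F k = F ^+ k.
Proof. by elim: k => //= k IHk; rewrite exprS -IHk. Qed.

Definition deg1 F := forall J, #|J| != 1%N -> F J = 0.

Lemma deg1D F G : deg1 F -> deg1 G -> deg1 (F + G).
Proof. by move=> dF dG J J1; rewrite ffunE dF// dG// addr0. Qed.

Lemma deg1Z a F : deg1 F -> deg1 (a *: F).
Proof. by move=> dF J J1; rewrite formZE dF// mulr0. Qed.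

Lemma deg1_omega A : deg1 (omega A : form).
Proof.
move=> J J1; rewrite ffunE; case: eqVneq => // JA.
by rewrite JA cards1 eqxx in J1.
Qed.

Lemma deg1E F : deg1 F -> F = \sum_A F [set A]%SET *: omega A.
Proof.
move=> dF; rewrite [LHS]form_expand.
rewrite (bigID (fun J => #|J| == 1%N))/= [X in _ + X]big1 ?addr0; last first.
  by move=> J J1; rewrite dF// scale0r.
rewrite (eq_bigl (mem (finset.set1 @: [set: 'I_(n + n)]%SET))) => [|J]; last first.
  apply/idP/imsetP => [/cards1P[A ->]|[A _ ->]]; last by rewrite cards1.
  by exists A; rewrite ?inE.
rewrite big_imset; last by move=> A B _ _ /set1_inj.
by apply: eq_bigl => A; rewrite inE.
Qed.

(** Swapping two distinct indices toggles the number of inversions between 0 and 1; for equal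
    indices both products vanish. *)
Lemma omega_anti A B : omega A * omega B = - (omega B * omega A) :> form.
Proof.
have E I J : bform I * bform J = if [disjoint I & J]
    then (-1 : C) ^+ inversions I J *: bform (I :|: J) else 0 by exact: wedge_bform.
have dS : [disjoint [set B]%SET & [set A]%SET] = [disjoint [set A]%SET & [set B]%SET].
  by rewrite disjoint_sym.
rewrite (E [set A]%SET [set B]%SET) (E [set B]%SET [set A]%SET) dS.
case dAB : [disjoint [set A]%SET & [set B]%SET]; last exact/esym/oppr0.
rewrite finset.setUC -scaleNr; congr (_ *: _).
have AB : A != B by move: dAB; rewrite finset.disjoints_subset finset.sub1set !inE eq_sym.
have invE (A0 B0 : 'I_(n + n)) : inversions [set A0]%SET [set B0]%SET = (B0 < A0)%N.
  rewrite /inversions; case: ltnP => BA; last first.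
    apply: eq_card0 => -[x y]; rewrite !inE/=; apply/negP => /and3P[/eqP-> /eqP->].
    by rewrite ltnNge BA.
  transitivity #|[set (A0, B0)]%SET|; last by rewrite cards1.
  apply: eq_card => -[x y]; rewrite !inE xpair_eqE/=.
  by case: eqVneq => // ->; case: eqVneq => // ->; rewrite BA.
rewrite !invE; move: AB; rewrite -val_eqE/= neq_ltn.
by case/orP => AB; rewrite AB ltnNge (ltnW AB)/= ?expr0 ?expr1 ?opprK.
Qed.

Lemma deg1_anti F G : deg1 F -> deg1 G -> F * G = - (G * F).
Proof.
move=> /deg1E-> /deg1E->; rewrite mulr_suml mulr_sumr -sumrN.
apply: eq_bigr => A _; rewrite mulr_suml mulr_sumr -sumrN.
apply: eq_bigr => B _; rewrite -!scalerAl -!scalerAr omega_anti !scalerN.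
by rewrite !scalerA mulrC.
Qed.

(** These forms play the role of the even ones. *)
Definition central1 F := forall G, deg1 G -> F * G = G * F.

Lemma central1D F G : central1 F -> central1 G -> central1 (F + G).
Proof. by move=> cF cG H dH; rewrite mulrDl mulrDr cF// cG. Qed.

Lemma central1M F G : central1 F -> central1 G -> central1 (F * G).
Proof. by move=> cF cG H dH; rewrite -mulrA cG// !mulrA cF. Qed.

Lemma central1Z a F : central1 F -> central1 (a *: F).
Proof. by move=> cF H dH; rewrite -scalerAl -scalerAr cF. Qed.

Lemma central1_1 : central1 1.
Proof. by move=> H dH; rewrite mulr1 mul1r. Qed.

Lemma central1_sum (I : Type) (r : seq I) (F : I -> form) :
  (forall i, central1 (F i)) -> central1 (\sum_(i <- r) F i).
Proof.
move=> cF; elim/big_ind: _ => [H dH|F1 F2|//]; last exact: central1D.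
by rewrite mul0r mulr0.
Qed.

Lemma central1X F k : central1 F -> central1 (F ^+ k).
Proof.
move=> cF; elim: k => [|k IHk]; first exact: central1_1.
by rewrite exprS; exact: central1M.
Qed.

(** A form of degree 1 changes sign twice on its way past the two factors. *)
Lemma central1_11 F G : deg1 F -> deg1 G -> central1 (F * G).
Proof.
move=> dF dG H dH; rewrite -mulrA (deg1_anti dG dH) mulrN (mulrA F H G).
by rewrite (deg1_anti dF dH) mulNr opprK mulrA.
Qed.

Lemma betaE : beta = \sum_(l < n) omega (lshift n l) * omega (rshift n l) :> form.
Proof. by []. Qed.

Lemma Omega2nE : Omega2n = \prod_(l < n) (omega (lshift n l) * omega (rshift n l)) :> form.
Proof. by []. Qed.

(** The sign is never computed: each new pair of indices is disjoint from those already multiplied,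
    so only a nonzero scalar accumulates. This justifies the division in [top_coef]. *)
Lemma Omega2n_neq0 : (Omega2n : form) [set: 'I_(n + n)]%SET != 0.
Proof.
suff [a a0 ->] : exists2 a : C, a != 0 & Omega2n = a *: bform [set: 'I_(n + n)]%SET.
  by rewrite formZE ffunE eqxx mulr1.
(* [S s] collects the two indices attached to each entry of [s]; over the whole list it is the full
   index set. *)
pose S (s : seq 'I_n) : {set 'I_(n + n)} :=
  [set A | has (fun l => (A == lshift n l) || (A == rshift n l)) s].
have -> : [set: 'I_(n + n)]%SET = S (index_enum 'I_n).
  apply/finset.setP => A; rewrite !inE; apply/esym/hasP.
  rewrite -(splitK A); case: (fintype.split A) => l; exists l;
    rewrite ?mem_index_enum//= eqxx ?orbT//.
rewrite Omega2nE; move: (index_enum_uniq 'I_n).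
elim: (index_enum _) => [_|l s IHs /= /andP[ls us]].
  by exists 1; rewrite ?oner_eq0// big_nil scale1r -form1E /form1; congr (bform _).
have [a a0 IH] := IHs us; rewrite big_cons IH.
rewrite -!wedgeE [X in wedge X _]wedge_bform.
have -> : [disjoint [set lshift n l] & [set rshift n l]].
  by rewrite finset.disjoints_subset finset.sub1set !inE eq_lrshift.
rewrite wedgeZl wedgeZr wedge_bform.
have -> : [disjoint [set lshift n l] :|: [set rshift n l] & S s].
  rewrite disjoint_sym finset.disjoints_subset; apply/fintype.subsetP => A; rewrite !inE.
  apply: contraTN => Al; apply/hasPn => k ks.
  have kl : l != k by apply: contraNneq ls => ->.
  by case/orP: Al => /eqP->; rewrite ?(eq_lshift, eq_rshift, eq_lrshift, eq_rlshift) ?(negbTE kl).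
have -> : [set lshift n l] :|: [set rshift n l] :|: S s = S (l :: s).
  by apply/finset.setP => A; rewrite !inE.
by rewrite !scalerA; eexists; last by []; rewrite !mulf_neq0 ?signr_eq0.
Qed.

Lemma top_coefD F G : top_coef (F + G) = top_coef F + top_coef G.
Proof. by rewrite /top_coef ffunE mulrDl. Qed.

Lemma top_coefZ a F : top_coef (a *: F) = a * top_coef F.
Proof. by rewrite /top_coef formZE mulrA. Qed.

Lemma top_coef_Omega2n : top_coef (Omega2n : form) = 1.
Proof. by rewrite /top_coef divff// Omega2n_neq0. Qed.

End one_forms.

(** * Quaternions as one-forms *)

Section quaternion_forms.
Context {R : realType} {n : nat}.
Local Notation C := (R[i]).
Local Notation form := (form R n).
Local Notation Q := (quat R).
Implicit Types (x y z : Q) (l k : 'I_n).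

(** [x = qalpha x + j * qbeta x]. *)
Definition qalpha x : C := (x.1.1.1 +i* x.1.1.2)%C.
Definition qbeta x : C := (x.1.2 -i* x.2)%C.

Arguments qalpha : simpl never.
Arguments qbeta : simpl never.

Definition qform0 l x : form :=
  qalpha x *: omega (lshift n l) + qbeta x *: omega (rshift n l).
(** This is [qform0 l] at x times j: right multiplication by j sends the pair (alpha, beta) to (-
    conj beta, conj alpha). *)
Definition qform1 l x : form :=
  - (qbeta x)^*%C *: omega (lshift n l) + (qalpha x)^*%C *: omega (rshift n l).

Lemma eqC (a b a' b' : R) : a = a' -> b = b' -> (a +i* b)%C = (a' +i* b')%C.
Proof. by move=> -> ->. Qed.

Lemma conjcM (a b : C) : (a * b)^*%C = a^*%C * b^*%C.
Proof. exact: rmorphM. Qed.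

Lemma conjcD (a b : C) : (a + b)^*%C = a^*%C + b^*%C.
Proof. exact: rmorphD. Qed.

Lemma conjcN (a : C) : (- a)^*%C = - a^*%C.
Proof. exact: rmorphN. Qed.

Lemma qalphaM x z :
  qalpha (x * z) = qalpha z * qalpha x - qbeta z * (qbeta x)^*%C.
Proof.
case: x z => [[[a b] c] d] [[[a' b'] c'] d']; apply/eqP; rewrite eq_complex.
by apply/andP; split; apply/eqP; rewrite /qalpha /qbeta /=; ring.
Qed.

Lemma qbetaM x z :
  qbeta (x * z) = qalpha z * qbeta x + qbeta z * (qalpha x)^*%C.
Proof.
case: x z => [[[a b] c] d] [[[a' b'] c'] d']; apply/eqP; rewrite eq_complex.
by apply/andP; split; apply/eqP; rewrite /qalpha /qbeta /=; ring.
Qed.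

Lemma qalphaD x y : qalpha (x + y) = qalpha x + qalpha y.
Proof. by case: x y => [[[a b] c] d] [[[a' b'] c'] d']. Qed.

Lemma qbetaD x y : qbeta (x + y) = qbeta x + qbeta y.
Proof.
case: x y => [[[a b] c] d] [[[a' b'] c'] d']; apply/eqP; rewrite eq_complex.
by rewrite /qbeta /= opprD !eqxx.
Qed.

Lemma qalphaJ x : qalpha (qconj x) = (qalpha x)^*%C.
Proof. by case: x => [[[a b] c] d]. Qed.

Lemma qbetaJ x : qbeta (qconj x) = - qbeta x.
Proof. by case: x => [[[a b] c] d]; apply: eqC. Qed.

Lemma eq_lin2 (a b a' b' : C) (F G : form) :
  a = a' -> b = b' -> a *: F + b *: G = a' *: F + b' *: G.
Proof. by move=> -> ->. Qed.

(** Right multiplication by [z] acts on the pair ([qform0], [qform1]) by the 2 by 2 complex matrix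
    of [z]. This law, its companion [qform1M], additivity, anticommutation and the value of the top
    coefficient on one product are what the abstract algebra below takes from [qform]. *)
Lemma qform0M l x z :
  qform0 l (x * z) = qalpha z *: qform0 l x + qbeta z *: qform1 l x.
Proof.
rewrite /qform0 /qform1 !scalerDr !scalerA addrACA -!scalerDl.
by rewrite qalphaM qbetaM mulrN.
Qed.

Lemma qform1M l x z : qform1 l (x * z) =
  - (qbeta z)^*%C *: qform0 l x + (qalpha z)^*%C *: qform1 l x.
Proof.
rewrite /qform0 /qform1 !scalerDr !scalerA addrACA -!scalerDl.
rewrite qalphaM qbetaM !conjcD conjcN !conjcM !conjcK.
by apply: eq_lin2; ring.
Qed.

Lemma qform0D l x y : qform0 l (x + y) = qform0 l x + qform0 l y.
Proof. by rewrite /qform0 addrACA -!scalerDl qalphaD qbetaD. Qed.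

Lemma qform1D l x y : qform1 l (x + y) = qform1 l x + qform1 l y.
Proof.
by rewrite /qform1 addrACA -!scalerDl qalphaD qbetaD !conjcD opprD.
Qed.

Lemma qalpha_real (r : R) : qalpha (qreal r) = r%:C%C.
Proof. by []. Qed.

Lemma qbeta_real (r : R) : qbeta (qreal r) = 0.
Proof. by apply: eqC; rewrite /= ?oppr0. Qed.

Lemma deg1_qform0 l x : deg1 (qform0 l x).
Proof. by apply: deg1D; apply/deg1Z/deg1_omega. Qed.

Lemma deg1_qform1 l x : deg1 (qform1 l x).
Proof. by apply: deg1D; apply/deg1Z/deg1_omega. Qed.

Definition qform (b : bool) := if b then qform1 else qform0.

Lemma qformD b l x y : qform b l (x + y) = qform b l x + qform b l y.
Proof. by case: b; [exact: qform1D|exact: qform0D]. Qed.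

Lemma deg1_qform b l x : deg1 (qform b l x).
Proof. by case: b; [exact: deg1_qform1|exact: deg1_qform0]. Qed.

Lemma qform_anti b l x b' k y :
  qform b l x * qform b' k y = - (qform b' k y * qform b l x).
Proof. by apply: deg1_anti; exact: deg1_qform. Qed.

End quaternion_forms.

(** * Hyperhermitian matrices *)

Section quaternion_spectral.
Context {R : realType}.
Local Notation C := (R[i]).
Local Notation Q := (quat R).
Implicit Types (x y z : Q).

Lemma qmulE x y : x * y = qmul x y.
Proof. by []. Qed.

Lemma qconjM x y : qconj (x * y) = qconj y * qconj x.
Proof.
case: x y => [[[a b] c] d] [[[a' b'] c'] d']; rewrite !qmulE /=.
by congr (_, _, _, _); ring.
Qed.

Lemma qconjD x y : qconj (x + y) = qconj x + qconj y.
Proof.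
case: x y => [[[a b] c] d] [[[a' b'] c'] d'].
rewrite -![_ + _]/(_ + _, _ + _, _ + _, _ + _).
by rewrite /= !opprD.
Qed.

Lemma qconjK : involutive (@qconj R).
Proof. by case=> [[[a b] c] d]; rewrite /= !opprK. Qed.

Lemma qconj_real (r : R) : qconj (qreal r) = qreal r.
Proof. by rewrite /qreal /= oppr0. Qed.

Lemma qconj_sum (I : Type) (r : seq I) (F : I -> Q) :
  qconj (\sum_(i <- r) F i) = \sum_(i <- r) qconj (F i).
Proof. by apply: (big_morph _ qconjD); exact: qconj_real. Qed.

Definition qnorm2 x : R := x.1.1.1 ^+ 2 + x.1.1.2 ^+ 2 + x.1.2 ^+ 2 + x.2 ^+ 2.

Lemma qconj_mul x : qconj x * x = qreal (qnorm2 x).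
Proof.
case: x => [[[a b] c] d]; rewrite qmulE /qreal /qnorm2 /=.
by congr (_, _, _, _); ring.
Qed.

Lemma qmul_conj x : x * qconj x = qreal (qnorm2 x).
Proof.
case: x => [[[a b] c] d]; rewrite qmulE /qreal /qnorm2 /=.
by congr (_, _, _, _); ring.
Qed.

Lemma qnorm2_ge0 x : 0 <= qnorm2 x.
Proof. by rewrite !addr_ge0 ?sqr_ge0. Qed.

Lemma qnorm2_eq0 x : qnorm2 x = 0 -> x = 0.
Proof.
case: x => [[[a b] c] d] /eqP; rewrite /qnorm2 /=.
rewrite !paddr_eq0 ?addr_ge0 ?sqr_ge0// !sqrf_eq0.
by move=> /andP[/andP[/andP[/eqP-> /eqP->] /eqP->] /eqP->].
Qed.

Lemma qnorm2M x y : qnorm2 (x * y) = qnorm2 x * qnorm2 y.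
Proof.
by case: x y => [[[a b] c] d] [[[a' b'] c'] d']; rewrite qmulE /qnorm2 /=; ring.
Qed.

Lemma qnorm2_real (r : R) : qnorm2 (qreal r) = r ^+ 2.
Proof. by rewrite /qnorm2 /= !expr0n /= !addr0. Qed.

Lemma qrealM (r s : R) : qreal (r * s) = qreal r * qreal s.
Proof. by rewrite qmulE /qreal /=; congr (_, _, _, _); ring. Qed.

Lemma qrealD (r s : R) : qreal (r + s) = qreal r + qreal s.
Proof. by rewrite /qreal -[RHS]/(_ + _, _ + _, _ + _, _ + _) !addr0. Qed.

Lemma qrealN (r : R) : qreal (- r) = - qreal r.
Proof. by rewrite /qreal -[RHS]/(- _, - _, - _, - _) !oppr0. Qed.

Lemma qrealB (r s : R) : qreal (r - s) = qreal r - qreal s.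
Proof. by rewrite qrealD qrealN. Qed.

Lemma qconjN x : qconj (- x) = - qconj x.
Proof.
by case: x => [[[a b] c] d]; rewrite -![- (_, _)]/(- _, - _, - _, - _) /=.
Qed.

Lemma qreal_sum (I : Type) (r : seq I) (F : I -> R) :
  qreal (\sum_(i <- r) F i) = \sum_(i <- r) qreal (F i).
Proof. by apply: (big_morph _ qrealD). Qed.

Lemma qrealC (r : R) x : qreal r * x = x * qreal r.
Proof.
by case: x => [[[a b] c] d]; rewrite !qmulE /qreal /=; congr (_, _, _, _); ring.
Qed.

Lemma qreal_inj : injective (@qreal R).
Proof. by move=> a b []. Qed.

Definition qadjm m n (A : 'M[Q]_(m, n)) : 'M[Q]_(n, m) := map_mx (@qconj R) A^T.

Lemma qadjE n (A : 'M[Q]_n) : qadj A = qadjm A.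
Proof. by apply/matrixP => i j; rewrite !mxE. Qed.

Lemma qadjmK m n (A : 'M[Q]_(m, n)) : qadjm (qadjm A) = A.
Proof. by apply/matrixP => i j; rewrite !mxE qconjK. Qed.

Lemma qadjmM m n p (A : 'M[Q]_(m, n)) (B : 'M[Q]_(n, p)) :
  qadjm (A *m B) = qadjm B *m qadjm A.
Proof.
apply/matrixP => i j; rewrite !mxE qconj_sum; apply: eq_bigr => k _.
by rewrite !mxE qconjM.
Qed.

Lemma qadjmD m n (A B : 'M[Q]_(m, n)) : qadjm (A + B) = qadjm A + qadjm B.
Proof. by apply/matrixP => i j; rewrite !mxE qconjD. Qed.

Lemma qadjmB m n (A B : 'M[Q]_(m, n)) : qadjm (A - B) = qadjm A - qadjm B.
Proof. by apply/matrixP => i j; rewrite !mxE qconjD qconjN. Qed.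

Lemma qadjm_block m1 m2 n1 n2 (a : 'M[Q]_(m1, n1)) (b : 'M[Q]_(m1, n2))
    (c : 'M[Q]_(m2, n1)) (d : 'M[Q]_(m2, n2)) :
  qadjm (block_mx a b c d) = block_mx (qadjm a) (qadjm c) (qadjm b) (qadjm d).
Proof. by rewrite /qadjm tr_block_mx map_block_mx. Qed.

Lemma qadjm_scalar n (r : R) : qadjm ((qreal r)%:M : 'M[Q]_n) = (qreal r)%:M.
Proof.
apply/matrixP => i j; rewrite !mxE eq_sym; by case: eqP => _; rewrite ?mulr1n ?mulr0n ?qconj_real//.
Qed.

Lemma scalar_real_mxC m n (r : R) (A : 'M[Q]_(m, n)) :
  (qreal r)%:M *m A = A *m (qreal r)%:M.
Proof.
apply/matrixP => i j; rewrite mul_scalar_mx mxE [RHS]mxE (bigD1 j)//= big1 ?addr0.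
  by rewrite mxE eqxx mulr1n qrealC.
by move=> k kj; rewrite mxE (negbTE kj) mulr0.
Qed.

Definition qnorm2_col n (v : 'cV[Q]_n) : R := \sum_i qnorm2 (v i ord0).

Lemma qadjm_mul_col n (v : 'cV[Q]_n) : qadjm v *m v = (qreal (qnorm2_col v))%:M.
Proof.
apply/matrixP => i j; rewrite !ord1 !mxE eqxx mulr1n qreal_sum.
by apply: eq_bigr => k _; rewrite !mxE qconj_mul.
Qed.

Lemma qnorm2_col_eq0 n (v : 'cV[Q]_n) : qnorm2_col v = 0 -> v = 0.
Proof.
move=> /eqP; rewrite psumr_eq0 => [/allP v0|i _]; last exact: qnorm2_ge0.
apply/colP => i; rewrite mxE; apply: qnorm2_eq0; apply/eqP.
exact: v0 (mem_index_enum i).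
Qed.

Lemma qnorm2_col_ge0 n (v : 'cV[Q]_n) : 0 <= qnorm2_col v.
Proof. by apply: sumr_ge0 => i _; exact: qnorm2_ge0. Qed.

Definition qcomplex (a : C) : Q := (complex.Re a, complex.Im a, 0, 0).

Definition qofC (a b : C) : Q :=
  (complex.Re a, complex.Im a, complex.Re b, - complex.Im b).

Lemma qalphaK a b : qalpha (qofC a b) = a.
Proof. by case: a. Qed.

Lemma qbetaK a b : qbeta (qofC a b) = b.
Proof. by case: b => b1 b2; rewrite /qbeta /= opprK. Qed.

Lemma qalpha_beta_inj x y : qalpha x = qalpha y -> qbeta x = qbeta y -> x = y.
Proof.
case: x y => [[[a b] c] d] [[[a' b'] c'] d'] [-> ->] [-> /eqP].
by rewrite eqr_opp => /eqP ->.
Qed.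

Lemma qalpha_sum (I : Type) (r : seq I) (F : I -> Q) :
  qalpha (\sum_(i <- r) F i) = \sum_(i <- r) qalpha (F i).
Proof. by apply: (big_morph _ qalphaD). Qed.

Lemma qbeta0 : qbeta (0 : Q) = 0.
Proof. by apply/eqP; rewrite eq_complex /= oppr0 !eqxx. Qed.

Lemma qbeta_sum (I : Type) (r : seq I) (F : I -> Q) :
  qbeta (\sum_(i <- r) F i) = \sum_(i <- r) qbeta (F i).
Proof. by apply: (big_morph _ qbetaD); exact: qbeta0. Qed.

(** A right eigenvector is an eigenvector of the complex matrix of the
    right-linear map [v |-> A v], in the coordinates [v = a + j b]. *)
Lemma qeigenvector n (A : 'M[Q]_n.+1) : exists (v : 'cV[Q]_n.+1) (a : C),
  v != 0 /\ A *m v = v *m (qcomplex a)%:M.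
Proof.
pose M : 'M[C]_(n.+1 + n.+1) := block_mx
  (\matrix_(l, k) qalpha (A l k)) (\matrix_(l, k) - (qbeta (A l k))^*%C)
  (\matrix_(l, k) qbeta (A l k)) (\matrix_(l, k) (qalpha (A l k))^*%C).
(* Eigenvectors are row vectors here, so a column eigenvector of [M] comes from the transpose. *)
have [a /eigenvalueP[w wM w0]] := @eigenvalue_closed C (n.+1 + n.+1) M^T isT.
pose v : 'cV[Q]_n.+1 := \col_k qofC (w ord0 (lshift n.+1 k)) (w ord0 (rshift n.+1 k)).
have wE j : \sum_k w ord0 k * M j k = a * w ord0 j.
  have := congr1 (fun N : 'rV__ => N ord0 j) wM; rewrite !mxE => <-.
  by apply: eq_bigr => k _; rewrite !mxE.
exists v, a; split.
  apply: contraNneq w0 => v0; apply/eqP/rowP => j; rewrite mxE -(splitK j).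
  have vk k : v k ord0 = 0 by rewrite v0 mxE.
  case: (fintype.split j) => k /=; have := vk k; rewrite mxE => qk.
    by rewrite -(qalphaK (w ord0 (lshift n.+1 k)) (w ord0 (rshift n.+1 k))) qk.
  by rewrite -(qbetaK (w ord0 (lshift n.+1 k)) (w ord0 (rshift n.+1 k))) qk qbeta0.
apply/colP => l; rewrite [LHS]mxE [RHS]mxE big_ord1 [X in _ * X]mxE eqxx mulr1n.
have qb : qbeta (qcomplex a) = 0 by apply/eqP; rewrite eq_complex /= oppr0 !eqxx.
have qa : qalpha (qcomplex a) = a by case: (a).
apply: qalpha_beta_inj.
- rewrite qalphaM qa qb mul0r subr0 mxE qalphaK -wE big_split_ord /= qalpha_sum.
  rewrite -big_split; apply: eq_bigr => k _ /=.
  rewrite qalphaM [v k _]mxE qalphaK qbetaK /M block_mxEul block_mxEur !mxE.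
  by rewrite mulrN [X in _ - X]mulrC.
- rewrite qbetaM qa qb mul0r addr0 mxE qbetaK -wE big_split_ord /= qbeta_sum.
  rewrite -big_split; apply: eq_bigr => k _ /=.
  rewrite qbetaM [v k _]mxE qalphaK qbetaK /M block_mxEdl block_mxEdr !mxE.
  by rewrite addrC [X in _ + X]mulrC.
Qed.

Lemma mulmx_delta0 n (u : 'rV[Q]_n.+1) :
  u *m (delta_mx ord0 ord0 : 'cV_n.+1) = (u ord0 ord0)%:M.
Proof.
apply/matrixP => i j; rewrite !ord1 [RHS]mxE mulr1n mxE (bigD1 ord0)//= big1 ?addr0.
  by rewrite mxE mulr1.
by move=> k k0; rewrite mxE (negbTE k0) mulr0.
Qed.

Lemma col_mul_scalar n (v : 'cV[Q]_n) x i : (v *m x%:M) i ord0 = v i ord0 * x.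
Proof. by rewrite mxE big_ord1 mxE eqxx mulr1n. Qed.

(** A real eigenvalue commutes with [x]; for a general one, scaling the eigenvector on the right
    would conjugate the eigenvalue. *)
Lemma eigen_scale n (A : 'M[Q]_n) (v : 'cV[Q]_n) (a : R) x :
  A *m v = v *m (qreal a)%:M ->
  A *m (v *m x%:M) = v *m x%:M *m (qreal a)%:M.
Proof. by move=> Av; rewrite mulmxA Av -mulmxA (scalar_real_mxC a x%:M) mulmxA. Qed.

(** The reflection in the hyperplane orthogonal to v - e, with e the first basis vector. It takes e
    to v because the first entry of [v] is real, so that the products v* e and e* v agree. *)
Lemma qhouseholder n (v : 'cV[Q]_n.+1) (r : R) :
  qnorm2_col v = 1 -> v ord0 ord0 = qreal r ->
  exists2 U : 'M[Q]_n.+1, qadjm U = U /\ U *m U = 1%:M &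
    U *m delta_mx ord0 ord0 = v :> 'cV_n.+1.
Proof.
move=> v1 v0; pose e := delta_mx ord0 ord0 : 'cV[Q]_n.+1.
pose w := v - e.
have ve : qadjm v *m e = (qreal r)%:M.
  by rewrite mulmx_delta0 !mxE v0 qconj_real.
have ev : qadjm e *m v = (qreal r)%:M.
  by rewrite -[v]qadjmK -qadjmM ve qadjm_scalar.
have ee : qadjm e *m e = (qreal 1)%:M.
  by rewrite mulmx_delta0 !mxE qconj_real.
have we : qadjm w *m e = (qreal (r - 1))%:M.
  by rewrite /w qadjmB mulmxBl ve ee qrealB raddfB.
have ww : qadjm w *m w = (qreal (2 * (1 - r)))%:M.
  rewrite {2}/w mulmxBr we {1}/w qadjmB mulmxBl qadjm_mul_col v1 ev.
  by rewrite -!raddfB -!qrealB; congr ((qreal _)%:M); ring.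
have [r1|r1] := eqVneq r 1.
  have w0 : w = 0.
    apply: qnorm2_col_eq0; apply: qreal_inj.
    have := congr1 (fun N : 'M[Q]_1 => N ord0 ord0) ww.
    by rewrite qadjm_mul_col r1 subrr mulr0 !mxE eqxx !mulr1n.
  exists 1%:M; first by rewrite (qadjm_scalar _ 1) mulmx1.
  by rewrite mul1mx; apply/esym/eqP; rewrite -subr_eq0; apply/eqP.
have r1' : 1 - r != 0 by rewrite subr_eq0 eq_sym.
(* Twice the inverse of the squared norm 2 (1 - r) of [w]. *)
pose c := (1 - r)^-1.
pose P := w *m qadjm w.
have PH : qadjm P = P by rewrite qadjmM qadjmK.
have PP : P *m P = (qreal (2 * (1 - r)))%:M *m P.
  by rewrite /P mulmxA -(mulmxA w) ww -scalar_real_mxC !mulmxA.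
exists (1%:M - (qreal c)%:M *m P).
  split.
    rewrite qadjmB (qadjm_scalar _ 1); congr (_ - _).
    by rewrite qadjmM PH qadjm_scalar scalar_real_mxC.
  rewrite mulmxBr mulmx1 mulmxBl mul1mx.
  have -> : (qreal c)%:M *m P *m ((qreal c)%:M *m P) = (qreal c)%:M *m P + (qreal c)%:M *m P.
    rewrite -mulmxA (mulmxA P) -(scalar_real_mxC c P) -(mulmxA _ P) PP !mulmxA.
    rewrite -!scalar_mxM -!qrealM -!mulmxDl -raddfD -qrealD.
    suff -> : c * c * (2 * (1 - r)) = c + c by [].
    by rewrite mulrCA -mulrA mulVf// mulr1 mulr_natl mulr2n.
  by rewrite opprB addrK subrK.
rewrite mulmxBl mul1mx -/e -mulmxA -(mulmxA w) we mulmxA -scalar_real_mxC mulmxA.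
rewrite -scalar_mxM -qrealM.
have -> : (r - 1) * c = -1 by rewrite /c -opprB mulNr mulfV.
have -> : (qreal (-1))%:M = - 1%:M :> 'M[Q]_n.+1 by rewrite qrealN raddfN.
by rewrite mulNmx mul1mx opprK addrC subrK.
Qed.

(** The number v* A v = |v|^2 a is self-adjoint, which forces [a] to be real. The eigenvector may
    then be scaled on the right, first to make its first entry real, as the reflection requires, and
    then to length 1. *)
Lemma qeigenvector_unit n (A : 'M[Q]_n.+1) : hyperhermitian A ->
  exists (v : 'cV[Q]_n.+1) (a r : R),
  [/\ qnorm2_col v = 1, v ord0 ord0 = qreal r & A *m v = v *m (qreal a)%:M].
Proof.
rewrite /hyperhermitian qadjE => AH; have [v [a [v0 Av]]] := qeigenvector A.
have N0 : qnorm2_col v != 0 by apply: contraNneq v0 => /qnorm2_col_eq0->.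
have aR : qcomplex a = qreal (complex.Re a).
  have vAv : qadjm v *m A *m v = (qreal (qnorm2_col v))%:M *m (qcomplex a)%:M.
    by rewrite -mulmxA Av mulmxA qadjm_mul_col.
  have : qadjm ((qreal (qnorm2_col v))%:M *m (qcomplex a)%:M : 'M[Q]_1) =
         (qreal (qnorm2_col v))%:M *m (qcomplex a)%:M.
    by rewrite -vAv !qadjmM AH qadjmK mulmxA.
  rewrite -scalar_mxM => /(congr1 (fun N : 'M[Q]_1 => N ord0 ord0)); rewrite !mxE eqxx !mulr1n.
  rewrite qconjM qconj_real; case: (a) => a1 a2.
  rewrite /qcomplex /qreal /= !qmulE /= => -[_ + _ _].
  rewrite !(mul0r, mulr0, subr0, addr0, add0r, oppr0, mulNr) => /eqP.
  rewrite eq_sym -subr_eq0 opprK mulrC -mulr2n mulrn_eq0 mulf_eq0 (negbTE N0) orbF/=.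
  by move=> /eqP ->.
rewrite aR in Av; set l := complex.Re a in Av.
(* A vanishing first entry is already real, and 1 keeps the vector nonzero. *)
pose u : Q := if v ord0 ord0 == 0 then 1 else qconj (v ord0 ord0).
have u0 : qnorm2 u != 0.
  rewrite /u; have [_|/eqP v00] := eqVneq (v ord0 ord0) 0;
    first by rewrite -[1]/(qreal 1) qnorm2_real expr1n oner_eq0.
  apply/eqP => /qnorm2_eq0 /(congr1 (@qconj R)); rewrite qconjK => v00'.
  by apply: v00; rewrite v00'; exact: (qconj_real 0).
pose v1 := v *m u%:M.
have Av1 : A *m v1 = v1 *m (qreal l)%:M.
  exact: (@eigen_scale _ A v l u Av).
have v1N : qnorm2_col v1 = qnorm2_col v * qnorm2 u.
  rewrite /qnorm2_col mulr_suml; apply: eq_bigr => i _.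
  by rewrite col_mul_scalar qnorm2M.
have v1N0 : 0 < qnorm2_col v1.
  by rewrite lt_def qnorm2_col_ge0 v1N mulf_neq0.
have [r0 v100] : exists r, v1 ord0 ord0 = qreal r.
  rewrite mxE big_ord1 mxE eqxx mulr1n /u; have [->|_] := eqVneq (v ord0 ord0) 0.
    by exists 0; rewrite mul0r.
  by exists (qnorm2 (v ord0 ord0)); rewrite qmul_conj.
pose c := (Num.sqrt (qnorm2_col v1))^-1.
exists (v1 *m (qreal c)%:M), l, (r0 * c); split.
- have : c ^+ 2 * qnorm2_col v1 = 1.
    by rewrite exprVn sqr_sqrtr ?mulVf ?gt_eqF// ltW.
  move=> <-; rewrite /qnorm2_col mulr_sumr; apply: eq_bigr => i _.
  by rewrite col_mul_scalar qnorm2M qnorm2_real mulrC.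
- by rewrite col_mul_scalar v100 qrealM.
- exact: (@eigen_scale _ A v1 l (qreal c) Av1).
Qed.

(** Deflation: the reflection [H] moves a unit eigenvector to the first basis vector. The first
    column of [B] is then zero below the corner, self-adjointness clears the first row, and the
    induction applies to the lower right block. *)
Theorem hyperhermitian_spectral n (A : 'M[Q]_n) : hyperhermitian A ->
  exists U lam, qunitary U /\ A = U *m qdiag lam *m qadj U.
Proof.
elim: n A => [A _|n IHn A AH].
  exists 1%:M, (fun=> 0); split; last by apply/matrixP => -[].
  by split; apply/matrixP => -[].
have [v [a [r [v1 v0 Av]]]] := qeigenvector_unit AH.
move: AH; rewrite /hyperhermitian qadjE => AH.
have [H [HH H1] He] := qhouseholder v1 v0.
pose e : 'cV[Q]_n.+1 := delta_mx ord0 ord0.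
pose B : 'M[Q]_(1 + n) := H *m A *m H.
have BH : qadjm B = B by rewrite /B !qadjmM HH AH mulmxA.
have Be : B *m e = e *m (qreal a)%:M.
  have : H *m A *m H *m e = e *m (qreal a)%:M.
    by rewrite -mulmxA -/e in He *; rewrite He -mulmxA Av mulmxA -He mulmxA H1 mul1mx.
  by [].
have BA : A = H *m (B : 'M[Q]_n.+1) *m H.
  by rewrite /B !mulmxA H1 mul1mx -mulmxA H1 mulmx1.
clearbody B.
have B0 i : B i (lshift n ord0) = (qreal a) *+ (i == lshift n ord0).
  have e0 : lshift n ord0 = ord0 :> 'I_(1 + n) by apply: val_inj.
  rewrite e0; transitivity ((B *m e) i ord0).
    rewrite [RHS]mxE (bigD1 ord0)//= big1 ?addr0 => [|k k0]; last first.
      by rewrite [e _ _]mxE (negbTE k0) mulr0.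
    by rewrite [e _ _]mxE mulr1.
  rewrite Be col_mul_scalar [e _ _]mxE eqxx andbT.
  by case: (i == _); rewrite ?mul1r ?mul0r.
have Bul : ulsubmx B = (qreal a)%:M.
  by apply/matrixP => i j; rewrite !ord1 !mxE B0 !eqxx.
have Bdl : dlsubmx B = 0.
  by apply/matrixP => i j; rewrite !ord1 !mxE B0 eq_rlshift.
have BE := submxK B.
have [Bur Bdr] : ursubmx B = 0 /\ qadjm (drsubmx B) = drsubmx B.
  move: BH; rewrite -{1}BE qadjm_block -[in RHS]BE => /eq_block_mx[_ <- _ ->].
  split=> //; rewrite Bdl; apply/matrixP => i j; rewrite !mxE; exact: (qconj_real 0).
have [|V [lam [[VV VV'] DE]]] := IHn (drsubmx B).
  by rewrite /hyperhermitian qadjE.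
rewrite !qadjE in VV VV' DE.
pose W : 'M[Q]_(1 + n) := block_mx 1%:M 0 0 V.
have adj0 p q : qadjm (0 : 'M[Q]_(p, q)) = 0.
  by apply/matrixP => i j; rewrite !mxE; exact: (qconj_real 0).
have WH : qadjm W = block_mx 1%:M 0 0 (qadjm V).
  by rewrite qadjm_block (qadjm_scalar _ 1) !adj0.
pose lam' (i : 'I_n.+1) := if unlift ord0 i is Some j then lam j else a.
have BD : B = W *m (qdiag lam' : 'M[Q]_(1 + n)) *m qadjm W.
  have -> : (qdiag lam' : 'M[Q]_(1 + n)) = block_mx (qreal a)%:M 0 0 (qdiag lam).
    have e0 : lshift n ord0 = ord0 :> 'I_(1 + n) by apply: val_inj.
    have e1 k : rshift 1 k = lift ord0 k :> 'I_(1 + n) by apply: val_inj.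
    apply: (etrans (esym (@submxK _ 1 n 1 n (qdiag lam')))).
    congr (block_mx _ _ _ _); apply/matrixP => i j.
    - by rewrite !ord1 !mxE e0 /lam' unlift_none.
    - by rewrite !mxE -val_eqE /= ord1.
    - by rewrite !mxE -val_eqE /= ord1.
    - by rewrite !mxE e1 /lam' liftK -!val_eqE /= ?eqn_add2l.
  rewrite WH !mulmx_block !(mulmx0, mul0mx, addr0, add0r, mulmx1, mul1mx).
  by rewrite -DE -[LHS]BE Bul Bdl Bur.
have WW : W *m qadjm W = 1%:M.
  rewrite WH mulmx_block !(mulmx0, mul0mx, addr0, add0r, mulmx1).
  by rewrite VV -scalar_mx_block.
have WW' : qadjm W *m W = 1%:M.
  rewrite WH mulmx_block !(mulmx0, mul0mx, addr0, add0r, mulmx1).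
  by rewrite VV' -scalar_mx_block.
clearbody W.
exists (H *m (W : 'M[Q]_n.+1)), lam'; rewrite /qunitary !qadjE; split.
  split; rewrite qadjmM HH.
  - by rewrite mulmxA -(mulmxA H W) WW mulmx1.
  - by rewrite -mulmxA (mulmxA H) H1 mul1mx.
by rewrite qadjmM HH BA [in LHS]BD !mulmxA.
Qed.

End quaternion_spectral.

Section square_zero.
Context {R : pzRingType} (I : Type) (F : I -> R).
Hypothesis Fcomm : forall i j, GRing.comm (F i) (F j).
Hypothesis Fsqr : forall i, F i * F i = 0.

Lemma exprD_sqr0 (x y : R) k : GRing.comm x y -> x * x = 0 ->
  (x + y) ^+ k.+1 = y ^+ k.+1 + x * y ^+ k *+ k.+1.
Proof.
move=> xy xx; elim: k => [|k IHk]; first by rewrite !expr1 expr0 mulr1 addrC.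
rewrite exprS IHk mulrDl !mulrDr -!mulrnAr !mulrA xx mul0r addr0.
rewrite -xy -!mulrA -!exprS addrCA; congr (_ + _).
by rewrite mulrnAr -exprS -mulrDr -mulrS.
Qed.

(** In the multinomial expansion only terms without repetition survive. The vanishing of the next
    power is carried along because it removes the leading term of [exprD_sqr0] in the induction
    step. *)
Lemma sum_sqr0 (s : seq I) :
  (\sum_(i <- s) F i) ^+ size s = (\prod_(i <- s) F i) *+ (size s)`! /\
  (\sum_(i <- s) F i) ^+ (size s).+1 = 0.
Proof.
elim: s => [|i s [IH1 IH2]]; first by rewrite !big_nil expr0 expr1.
have cs : GRing.comm (F i) (\sum_(j <- s) F j).
  by rewrite /GRing.comm mulr_sumr mulr_suml; apply: eq_bigr => j _; exact: Fcomm.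
rewrite !big_cons /= !exprD_sqr0//; split.
  by rewrite IH2 add0r IH1 -mulrnAr -mulrnA factS mulnC mulrnAr.
by rewrite exprS IH2 !mulr0 mul0rn addr0.
Qed.

End square_zero.

Lemma half_double (R : realType) (V : lmodType R[i]) (x : V) : 2^-1 *: (x *+ 2) = x.
Proof. by rewrite -[x *+ 2]scaler_nat scalerA mulVf ?scale1r// pnatr_eq0. Qed.

Lemma anti_eq0 (R : realType) (V : lmodType R[i]) (x : V) : x = - x -> x = 0.
Proof.
move=> xN; rewrite -[LHS]half_double -[RHS](scaler0 _ 2^-1); congr (_ *: _).
by rewrite mulr2n {1}xN addNr.
Qed.

(** * Hermitian forms in an abstract algebra *)

Section hermitian_algebra.
Context {R : realType} {n : nat}.
Local Notation C := (R[i]).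
Local Notation Q := (quat R).
Context {A : algType C} (f : bool -> 'I_n -> Q -> A).
Hypothesis fD : forall b l x y, f b l (x + y) = f b l x + f b l y.
Hypothesis f0M : forall l x z,
  f false l (x * z) = qalpha z *: f false l x + qbeta z *: f true l x.
Hypothesis f1M : forall l x z,
  f true l (x * z) = - (qbeta z)^*%C *: f false l x + (qalpha z)^*%C *: f true l x.
Hypothesis f_anti : forall b l x b' k y, f b l x * f b' k y = - (f b' k y * f b l x).
Implicit Types (x y z : Q) (l k : 'I_n) (M N U : 'M[Q]_n).

Lemma f_real b l x (r : R) : f b l (x * qreal r) = r%:C%C *: f b l x.
Proof.
case: b; last by rewrite f0M qalpha_real qbeta_real scale0r addr0.
by rewrite f1M qalpha_real qbeta_real conjc0 oppr0 scale0r add0r conjc_real.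
Qed.

Definition fpair l x k y := f false l x * f true k y - f true l x * f false k y.

Lemma fpairDl l x y k z : fpair l (x + y) k z = fpair l x k z + fpair l y k z.
Proof. by rewrite /fpair !fD !mulrDl opprD addrACA. Qed.

Lemma fpair_suml (I : Type) (r : seq I) (F : I -> Q) l k z :
  fpair l (\sum_(i <- r) F i) k z = \sum_(i <- r) fpair l (F i) k z.
Proof.
apply: (big_morph (fun x => fpair l x k z)) => [? ?|]; first exact: fpairDl.
by apply: (addrI (fpair l 0 k z)); rewrite -fpairDl !addr0.
Qed.

Lemma fpair_real l x k y (r : R) : fpair l (x * qreal r) k y = r%:C%C *: fpair l x k y.
Proof. by rewrite /fpair !f_real -!scalerAl scalerBr. Qed.

(** [fpair] is a symplectic pairing of the two pairs of one-forms, and the complex matrix of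
    [qconj z] is the adjugate of that of [z]. *)
Lemma fpair_adj l x z k y : fpair l (x * z) k y = fpair l x k (y * qconj z).
Proof.
rewrite /fpair !f0M !f1M !mulrDl !mulrDr -!scalerAl -!scalerAr !opprD.
rewrite -!scaleNr qalphaJ qbetaJ !conjcN !conjcK !opprK.
rewrite -!addrA [RHS]addrCA; congr (_ + _).
by rewrite addrC -addrA.
Qed.

(** Normalized so that [Delta v] is the [herm_form] of the Hessian of [v]. *)
Definition herm_form (M : 'M[Q]_n) : A :=
  2^-1 *: \sum_l \sum_k fpair l (M l k) k 1.

Lemma herm_formD M N : herm_form (M + N) = herm_form M + herm_form N.
Proof.
rewrite /herm_form -scalerDr -big_split; congr (_ *: _); apply: eq_bigr => l _.
by rewrite -big_split; apply: eq_bigr => k _; rewrite mxE fpairDl.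
Qed.

Lemma herm_formZ (r : R) M : herm_form (qreal r *: M) = r%:C%C *: herm_form M.
Proof.
rewrite /herm_form scalerA mulrC -scalerA; congr (_ *: _).
rewrite scaler_sumr; apply: eq_bigr => l _; rewrite scaler_sumr; apply: eq_bigr => k _.
by rewrite mxE qrealC fpair_real.
Qed.

Definition vec_form b (U : 'M[Q]_n) j := \sum_l f b l (U l j).
Definition eig_form U j := vec_form false U j * vec_form true U j.

Lemma vec_form_anti b U j b' U' j' :
  vec_form b U j * vec_form b' U' j' = - (vec_form b' U' j' * vec_form b U j).
Proof.
rewrite /vec_form mulr_suml mulr_sumr -sumrN; apply: eq_bigr => l _.
by rewrite mulr_suml mulr_sumr -sumrN; apply: eq_bigr => k _; exact: f_anti.
Qed.

(** Four sign changes cancel. Two different matrices are allowed because Hermitian matrices with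
    different eigenvectors must have commuting forms. *)
Lemma eig_form_comm U i U' j : GRing.comm (eig_form U i) (eig_form U' j).
Proof.
rewrite /GRing.comm /eig_form -mulrA (mulrA (vec_form true U i)).
rewrite (vec_form_anti true U i false) !mulNr mulrN -!mulrA.
rewrite (vec_form_anti true U i true) !mulrN opprK !mulrA.
rewrite (vec_form_anti false U i false) !mulNr -!mulrA.
rewrite (mulrA (vec_form false U i)) (vec_form_anti false U i true) mulNr !mulrN opprK.
by rewrite !mulrA.
Qed.

Lemma eig_form_sqr U j : eig_form U j * eig_form U j = 0.
Proof.
rewrite /eig_form -mulrA (mulrA (vec_form true U j)) (vec_form_anti true U j false).
rewrite mulNr mulrN !mulrA (anti_eq0 (vec_form_anti false U j false U j)).
by rewrite !mul0r oppr0.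
Qed.

(** By [fpair_adj] the entry of the adjoint moves to the second argument, so the j-th eigenvalue
    multiplies the double sum of [fpair l (U l j) k (U k j)]. Anticommutation makes that sum twice
    [eig_form U j], which the factor 2^-1 absorbs. *)
Lemma herm_form_diag U lam :
  herm_form (U *m qdiag lam *m qadj U) = \sum_j (lam j)%:C%C *: eig_form U j.
Proof.
have -> : \sum_j (lam j)%:C%C *: eig_form U j =
    2^-1 *: \sum_j (lam j)%:C%C *: \sum_l \sum_k fpair l (U l j) k (U k j).
  rewrite scaler_sumr; apply: eq_bigr => j _.
  rewrite scalerA mulrC -scalerA; congr (_ *: _).
  have -> : \sum_l \sum_k fpair l (U l j) k (U k j) = eig_form U j *+ 2.
    rewrite mulr2n -[X in _ + X]opprK -vec_form_anti /eig_form /vec_form.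
    rewrite !mulr_suml -sumrB; apply: eq_bigr => l _.
    by rewrite !mulr_sumr -sumrB.
  by rewrite half_double.
congr (_ *: _).
transitivity (\sum_l \sum_k \sum_j (lam j)%:C%C *: fpair l (U l j) k (U k j)).
  apply: eq_bigr => l _; apply: eq_bigr => k _.
  rewrite mxE fpair_suml; apply: eq_bigr => j _.
  rewrite fpair_adj mul1r mul_mx_diag !mxE -fpair_real; congr (fpair _ _ _ _).
  by case: (U k j) => [[[a b] c] d] /=; rewrite !opprK.
under eq_bigr => l _ do rewrite exchange_big/=.
rewrite exchange_big/=; apply: eq_bigr => j _.
by rewrite scaler_sumr; apply: eq_bigr => l _; rewrite scaler_sumr.
Qed.

Lemma vec_form1 b j : vec_form b 1%:M j = f b j 1.
Proof.
rewrite /vec_form (bigD1 j)//= big1 ?addr0 => [|l lj]; first by rewrite mxE eqxx.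
have f0 : f b l 0 = 0 by apply: (addrI (f b l 0)); rewrite -fD !addr0.
by rewrite mxE (negbTE lj).
Qed.

Lemma qdiag1 : qdiag (fun=> 1 : R) = 1%:M :> 'M[Q]_n.
Proof. by apply/matrixP => i j; rewrite !mxE. Qed.

Definition beta_form := \sum_l f false l 1 * f true l 1.

Lemma herm_form1 : herm_form 1%:M = beta_form.
Proof.
have -> : 1%:M = 1%:M *m qdiag (fun=> 1 : R) *m qadj 1%:M :> 'M[Q]_n.
  by rewrite qdiag1 qadjE (qadjm_scalar _ 1) !mulmx1.
rewrite herm_form_diag; apply: eq_bigr => j _.
by rewrite scale1r /eig_form !vec_form1.
Qed.

(** Both sides are the form of the identity matrix, written as U U*. *)
Lemma sum_eig_form U : qunitary U -> \sum_j eig_form U j = beta_form.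
Proof.
move=> [UU _]; rewrite -herm_form1 -UU -[X in herm_form (X *m _)]mulmx1 -qdiag1.
by rewrite herm_form_diag; apply: eq_bigr => j _; rewrite scale1r.
Qed.

Lemma herm_form_shift (s : R) M :
  herm_form ((qreal s)%:M + M) = herm_form M + s%:C%C *: beta_form.
Proof. by rewrite herm_formD -scalemx1 herm_formZ herm_form1 addrC. Qed.

Lemma herm_form_comm M N : hyperhermitian M -> hyperhermitian N ->
  GRing.comm (herm_form M) (herm_form N).
Proof.
move=> /hyperhermitian_spectral[U [lam [_ ->]]].
move=> /hyperhermitian_spectral[U' [lam' [_ ->]]].
rewrite !herm_form_diag /GRing.comm mulr_suml mulr_sumr; apply: eq_bigr => i _.
rewrite mulr_suml mulr_sumr; apply: eq_bigr => j _.
by rewrite -!scalerAl -!scalerAr eig_form_comm !scalerA mulrC.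
Qed.

Lemma hyperhermitianD M N : hyperhermitian M -> hyperhermitian N ->
  hyperhermitian (M + N).
Proof. by rewrite /hyperhermitian !qadjE qadjmD => -> ->. Qed.

Lemma hyperhermitian_diag U (lam : 'I_n -> R) :
  hyperhermitian (U *m qdiag lam *m qadj U).
Proof.
rewrite /hyperhermitian !qadjE !qadjmM qadjmK !mulmxA; congr (_ *m _ *m _).
apply/matrixP => i j; rewrite !mxE eq_sym; case: eqP => [->|_].
  by rewrite !mulr1n qconj_real.
exact: (qconj_real 0).
Qed.

Lemma hyperhermitian_scalar (r : R) : hyperhermitian ((qreal r)%:M : 'M[Q]_n).
Proof. by rewrite /hyperhermitian qadjE qadjm_scalar. Qed.

Lemma hyperhermitianZ (r : R) M : hyperhermitian M -> hyperhermitian (qreal r *: M).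
Proof.
rewrite /hyperhermitian -!mul_scalar_mx !qadjE => MH.
by rewrite qadjmM MH qadjm_scalar scalar_real_mxC.
Qed.

Variable tau : {scalar A}.
Hypothesis tau1 : tau (\prod_l (f false l 1 * f true l 1)) = 1.

Lemma sum_eig_form_pow (c : 'I_n -> C) U :
  (\sum_j c j *: eig_form U j) ^+ n =
  (n`!%:R * \prod_j c j) *: \prod_j eig_form U j.
Proof.
pose F j := c j *: eig_form U j.
have Fc i j : GRing.comm (F i) (F j).
  by rewrite /GRing.comm /F -!scalerAl -!scalerAr eig_form_comm !scalerA mulrC.
have F2 i : F i * F i = 0.
  by rewrite /F -scalerAl -scalerAr eig_form_sqr !scaler0.
have sz : size (index_enum 'I_n) = n by rewrite [index_enum _]unlock -enumT size_enum_ord.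
have [+ _] := sum_sqr0 Fc F2 (index_enum 'I_n); rewrite sz => ->.
by rewrite /F scaler_prod scalerMnl -mulr_natl.
Qed.

(** The n-th power of [beta_form] is n! times the product of the [eig_form U j] for every unitary
    [U]; comparing [U] with the identity stands in for a unitary matrix having determinant 1. *)
Lemma tau_prod_eig U : qunitary U -> tau (\prod_j eig_form U j) = 1.
Proof.
have powE U0 : qunitary U0 -> beta_form ^+ n = n`!%:R *: \prod_j eig_form U0 j.
  move=> U0u; rewrite -(sum_eig_form U0u).
  rewrite -[in LHS](eq_bigr _ (fun j _ => scale1r (eig_form U0 j))).
  by rewrite sum_eig_form_pow big1_eq mulr1.
have I1 : qunitary (1%:M : 'M[Q]_n).
  by rewrite /qunitary qadjE (qadjm_scalar _ 1) mulmx1.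
move=> Uu; have := powE U Uu; rewrite (powE _ I1) => /(congr1 tau).
rewrite !linearZ /=.
have -> : \prod_j eig_form 1%:M j = \prod_l (f false l 1 * f true l 1).
  by apply: eq_bigr => j _; rewrite /eig_form !vec_form1.
by rewrite tau1 => /mulfI <-.
Qed.

(** For real [t] the right side is n! times the Moore determinant of the matrix shifted by [t]. *)
Lemma tau_pencil U lam (t : C) : qunitary U ->
  tau ((herm_form (U *m qdiag lam *m qadj U) + t *: beta_form) ^+ n) =
  n`!%:R * \prod_j ((lam j)%:C%C + t).
Proof.
move=> Uu; rewrite herm_form_diag -(sum_eig_form Uu) scaler_sumr -big_split /=.
under eq_bigr do rewrite -scalerDl.
by rewrite sum_eig_form_pow linearZ /= tau_prod_eig// mulr1.
Qed.

End hermitian_algebra.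

(** * Hyperbolic polynomials *)

Section half_plane_roots.
Context {R : realType}.
Local Notation C := (R[i]).
Local Notation normc := (@Normc.normc R).
Implicit Types (p q : {poly C}) (z t : C).

Lemma normc_ge0 z : 0 <= normc z.
Proof. by case: z => a b; exact: sqrtr_ge0. Qed.

Lemma normcD z t : normc (z + t) <= normc z + normc t.
Proof. exact: le_normcD. Qed.

Lemma ImB z t : complex.Im (z - t) = complex.Im z - complex.Im t.
Proof. by case: z t => a b [c d]. Qed.

Lemma normc_Im z : `|complex.Im z| <= normc z.
Proof. by case: z => a b /=; rewrite -sqrtr_sqr ler_wsqrtr// lerDr sqr_ge0. Qed.

Lemma normc_real (a : R) : normc a%:C%C = `|a|.
Proof. by rewrite /= expr0n/= addr0 sqrtr_sqr. Qed.

Lemma normcX z k : normc (z ^+ k) = normc z ^+ k.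
Proof.
elim: k => [|k IHk]; first by rewrite !expr0 [LHS]Normc.normc1.
by rewrite !exprS Normc.normcM IHk.
Qed.

Lemma normc_sum (I : Type) (r : seq I) (F : I -> C) :
  normc (\sum_(i <- r) F i) <= \sum_(i <- r) normc (F i).
Proof.
elim/big_rec2: _ => [|i y1 y2 _ IH]; first by rewrite [leLHS]Normc.normc0.
by apply: le_trans (normcD _ _) _; rewrite lerD2l.
Qed.

Lemma horner_factor p (rs : seq C) t :
  p = lead_coef p *: \prod_(r <- rs) ('X - r%:P) ->
  p.[t] = lead_coef p * \prod_(r <- rs) (t - r).
Proof.
move=> {1}->; rewrite hornerZ horner_prod; congr (_ * _).
by apply: eq_bigr => r _; rewrite !hornerE.
Qed.

Lemma factor_root p (rs : seq C) :
  p = lead_coef p *: \prod_(r <- rs) ('X - r%:P) -> forall r, r \in rs -> root p r.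
Proof.
move=> pE r rs_r; rewrite rootE (horner_factor _ pE) (big_rem r)//= subrr.
by rewrite mul0r mulr0.
Qed.

Lemma factor_size p (rs : seq C) k : (size p <= k.+1)%N -> p`_k != 0 ->
  p = lead_coef p *: \prod_(r <- rs) ('X - r%:P) ->
  size rs = k /\ lead_coef p = p`_k.
Proof.
move=> sp pk pE.
have spk : size p = k.+1.
  apply/eqP; rewrite eqn_leq sp ltnNge; apply: contra pk => pk.
  by rewrite nth_default.
have lp : lead_coef p = p`_k by rewrite lead_coefE spk.
split=> //; apply: succn_inj; rewrite -spk {1}pE size_scale ?lp//.
by rewrite size_prod_XsubC.
Qed.

(** Each factor t - r has modulus at least Im t. The bound involves no coefficient but the leading
    one, so it is stable when the others vary. *)
Lemma poly_lower_Im p k t : (size p <= k.+1)%N -> p`_k != 0 ->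
  (forall r, root p r -> complex.Im r <= 0) -> 0 <= complex.Im t ->
  normc p`_k * complex.Im t ^+ k <= normc p.[t].
Proof.
move=> sp pk rp t0; have [rs pE] := closed_field_poly_normal p.
have [srs lp] := factor_size sp pk pE.
rewrite (horner_factor _ pE) lp Normc.normcM ler_wpM2l ?normc_ge0// -srs.
have : forall r, r \in rs -> complex.Im r <= 0.
  by move=> r /(factor_root pE)/rp.
elim: rs {pE srs} => [_|r rs IHrs rsI]; first by rewrite big_nil [leRHS]Normc.normc1.
rewrite big_cons Normc.normcM exprS ler_pM ?exprn_ge0//; last first.
  by apply: IHrs => r' rr'; apply: rsI; rewrite inE rr' orbT.
apply: le_trans (normc_Im _); apply: le_trans (ler_norm _).
by rewrite ImB lerDl oppr_ge0 rsI ?mem_head.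
Qed.

(** The finitely many roots keep a distance from the closed upper half plane, so each |t - r| is at
    least a multiple of 1 + |t|. The growth in [t] is what beats a perturbation of all coefficients
    uniformly in [t]. *)
Lemma poly_lower_norm p k : (size p <= k.+1)%N -> p`_k != 0 ->
  (forall r, root p r -> complex.Im r < 0) ->
  exists2 e : R, 0 < e & forall t, 0 <= complex.Im t ->
    e * (1 + normc t) ^+ k <= normc p.[t].
Proof.
move=> sp pk rp; have [rs pE] := closed_field_poly_normal p.
have [srs lp] := factor_size sp pk pE.
have : forall r, r \in rs -> complex.Im r < 0.
  by move=> r /(factor_root pE)/rp.
have cp : 0 < normc (lead_coef p).
  rewrite lt_def normc_ge0 andbT; apply: contra pk => /eqP/Normc.eq0_normc.
  by rewrite lp => ->.
move=> rsI; suff [e e0 H] : exists2 e : R, 0 < e & forall t, 0 <= complex.Im t ->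
    e * (1 + normc t) ^+ size rs <= normc (\prod_(r <- rs) (t - r)).
  exists (normc (lead_coef p) * e); first exact: mulr_gt0.
  move=> t t0; rewrite (horner_factor _ pE) Normc.normcM -mulrA ler_pM2l// -srs.
  exact: H.
elim: rs rsI {pE srs} => [_|r rs IHrs rsI].
  exists 1 => // t _; rewrite big_nil expr0 mulr1.
  by rewrite [leRHS]Normc.normc1.
have [|e e0 He] := IHrs; first by move=> r' rr'; apply: rsI; rewrite inE rr' orbT.
have r0 := rsI r (mem_head _ _); pose d := - complex.Im r.
have d0 : 0 < d by rewrite oppr_gt0.
(* Since [d] bounds |t - r| from below, 1 + |t| <= |t - r| + (1 + |r|) <= [K] |t - r|. *)
pose K := 1 + (1 + normc r) / d.
have K0 : 0 < K by rewrite ltr_pwDl// divr_ge0 ?addr_ge0 ?normc_ge0// ltW.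
exists (K^-1 * e); first by rewrite mulr_gt0// invr_gt0.
move=> t t0; rewrite big_cons Normc.normcM/= exprS mulrACA.
apply: ler_pM; last exact: He.
- by rewrite mulr_ge0 ?invr_ge0 ?(ltW K0)// addr_ge0 ?normc_ge0.
- by rewrite mulr_ge0 ?(ltW e0)// exprn_ge0// addr_ge0 ?normc_ge0.
rewrite mulrC ler_pdivrMr// /K mulrDr mulr1.
have dtr : d <= normc (t - r).
  apply: le_trans (normc_Im _); apply: le_trans (ler_norm _).
  by rewrite ImB lerDr.
have tr : normc t <= normc (t - r) + normc r by rewrite -{1}(subrK r t) normcD.
have : 1 + normc r <= normc (t - r) * ((1 + normc r) / d).
  rewrite mulrCA ler_peMr ?addr_ge0 ?normc_ge0//.
  by rewrite ler_pdivlMr// mul1r.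
by move: tr; lra.
Qed.

Lemma horner_bound p k t (M : R) : (size p <= k.+1)%N ->
  (forall i, normc p`_i <= M) -> normc p.[t] <= k.+1%:R * M * (1 + normc t) ^+ k.
Proof.
move=> sp pM; rewrite (horner_coef_wide _ sp).
apply: le_trans (normc_sum _ _) _.
have -> : k.+1%:R * M * (1 + normc t) ^+ k = \sum_(i < k.+1) M * (1 + normc t) ^+ k.
  by rewrite sumr_const card_ord -mulrA mulr_natl.
apply: ler_sum => i _; rewrite Normc.normcM normcX ler_pM ?exprn_ge0 ?normc_ge0//.
apply: (@le_trans _ _ ((1 + normc t) ^+ i)).
  by rewrite lerXn2r ?nnegrE ?addr_ge0 ?normc_ge0// lerDr.
by rewrite ler_weXn2l ?lerDl ?normc_ge0// -ltnS.
Qed.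

Lemma poly_lipschitz p z : exists2 K : R, 0 <= K &
  forall t, normc (t - z) <= 1 -> normc (p.[t] - p.[z]) <= K * normc (t - z).
Proof.
have /factor_theorem[q pq] : root (p - p.[z]%:P) z.
  by rewrite rootE !hornerE subrr.
pose M := \sum_(i < size q) normc q`_i.
have M0 : 0 <= M by apply: sumr_ge0 => i _; exact: normc_ge0.
exists ((size q).+1%:R * M * (2 + normc z) ^+ size q).
  by rewrite !mulr_ge0 ?exprn_ge0 ?addr_ge0 ?normc_ge0.
move=> t tz; have -> : p.[t] - p.[z] = q.[t] * (t - z).
  by have := congr1 (fun f => f.[t]) pq; rewrite !hornerE.
rewrite Normc.normcM ler_wpM2r ?normc_ge0//.
apply: le_trans (@horner_bound q (size q) t M _ _) _ => //.
  move=> i; case: (ltnP i (size q)) => iq; last by rewrite nth_default// [leLHS]Normc.normc0.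
  rewrite /M (bigD1 (Ordinal iq))//= lerDl.
  by apply: sumr_ge0 => j _; exact: normc_ge0.
rewrite ler_wpM2l ?mulr_ge0// lerXn2r ?nnegrE ?addr_ge0 ?normc_ge0//.
have : normc t <= normc (t - z) + normc z by rewrite -{1}(subrK z t) normcD.
by move: tz; lra.
Qed.

(** By continuity of the roots, those in the upper half plane could only come in
    through the real axis. *)
Lemma root_homotopy (k : nat) (c : C) (G : nat -> {poly C})
    (F := fun s : R => \poly_(i < k.+1) (G i).[s%:C%C]) :
  c != 0 -> (forall s : R, (G k).[s%:C%C] = c) ->
  (forall (s x : R), 0 <= s <= 1 -> ~~ root (F s) x%:C%C) ->
  (forall t, 0 < complex.Im t -> ~~ root (F 0) t) ->
  forall t, 0 < complex.Im t -> ~~ root (F 1) t.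
Proof.
move=> c0 Gk real0 F0 t1 t1I; apply/negP => F1t1.
have sF s : (size (F s) <= k.+1)%N by exact: size_poly.
have cF s : (F s)`_k = c by rewrite coef_poly ltnSn Gk.
have cF0 s : (F s)`_k != 0 by rewrite cF.
have contF s : exists2 K : R, 0 < K & forall s', `|s' - s| <= 1 -> forall t,
    normc ((F s').[t] - (F s).[t]) <= K * `|s' - s| * (1 + normc t) ^+ k.
  have /choice[K HK] : forall i, exists K : R, 0 <= K /\
      forall t, normc (t - s%:C%C) <= 1 ->
      normc ((G i).[t] - (G i).[s%:C%C]) <= K * normc (t - s%:C%C).
    by move=> i; have [K K0 HK] := poly_lipschitz (G i) s%:C%C; exists K.
  pose K' := \sum_(i < k.+1) K i.
  have K'0 : 0 <= K' by apply: sumr_ge0 => i _; have [] := HK i.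
  exists (k.+1%:R * (K' + 1)); first by rewrite mulr_gt0// ltr_wpDl.
  move=> s' ss' t; rewrite -hornerN -hornerD -(mulrA k.+1%:R (K' + 1)).
  apply: horner_bound => [|i].
    by rewrite (leq_trans (size_polyD _ _))// geq_max size_polyN !sF.
  rewrite coefB !coef_poly; case: ltnP => ik; last first.
    rewrite subrr [leLHS]Normc.normc0.
    by rewrite mulr_ge0// addr_ge0.
  have [Ki0 /(_ s'%:C%C)] := HK i; rewrite -rmorphB normc_real => /(_ ss') H.
  apply: le_trans H _; rewrite ler_wpM2r// /K' (bigD1 (Ordinal ik))//= -addrA lerDl.
  by rewrite addr_ge0// sumr_ge0// => j _; have [] := HK j.
(* The bad parameters; the contradiction comes from their infimum [s0], whether it is attained or
   not. *)
pose S : set R := fun s => 0 <= s <= 1 /\ exists2 t, 0 < complex.Im t & root (F s) t.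
have S1 : S 1 by split; [rewrite ler01 lexx|exists t1].
have lbS : has_inf S.
  by split; [exists 1|exists 0 => s [/andP[]]].
pose s0 := inf S.
have s0_ge0 : 0 <= s0.
  by apply: lb_le_inf; [exists 1|move=> s [/andP[]]].
have s0_le1 : s0 <= 1 by apply: ge_inf => //; case: lbS.
have s01 : 0 <= s0 <= 1 by rewrite s0_ge0.
have [K K0 HK] := contF s0.
(* If attained, [s0] is positive, and just before it no root lies above the axis: there the value at
   [t] is at least [B], yet it must be close to the value 0 at [s0]. *)
have [[_ [t t0 rt]]|nSs0] := pselect (S s0).
  have s0_gt0 : 0 < s0.
    rewrite lt_neqAle s0_ge0 andbT; apply/eqP => s00.
    by have := F0 _ t0; rewrite s00 rt.
  pose A := K * (1 + normc t) ^+ k.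
  have A0 : 0 < A by rewrite mulr_gt0// exprn_gt0// ltr_pwDl// normc_ge0.
  pose B := normc c * complex.Im t ^+ k.
  have B0 : 0 < B.
    rewrite mulr_gt0 ?exprn_gt0// lt_def normc_ge0 andbT.
    by apply: contra c0 => /eqP/Normc.eq0_normc->.
  pose d := Num.min s0 (B / A / 2).
  have d0 : 0 < d by rewrite lt_min s0_gt0 !divr_gt0.
  have ds : d <= s0 by rewrite ge_min lexx.
  have dB : A * d < B.
    have : d <= B / A / 2 by rewrite ge_min lexx orbT.
    rewrite -mulrA [A^-1 / 2]mulrC mulrA ler_pdivlMr// mulrC => /le_lt_trans; apply.
    by rewrite gtr_pMr// invf_lt1// ltr1n.
  have [H|] := pselect (forall r, root (F (s0 - d)) r -> complex.Im r <= 0).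
    have := poly_lower_Im (sF (s0 - d)) (cF0 _) H (ltW t0); rewrite cF -/B.
    have /(_ _ t) := HK (s0 - d); rewrite addrAC subrr sub0r normrN gtr0_norm// => /(_ _)/wrap[].
      by rewrite (le_trans ds).
    move: rt; rewrite rootE => /eqP->; rewrite subr0 => H1 H2.
    have : B < B by apply: le_lt_trans dB; rewrite /A mulrAC; exact: le_trans H2 H1.
    by rewrite ltxx.
  move=> /existsNP[r /not_implyP[rr /negP]]; rewrite -ltNge => r0.
  have : S (s0 - d).
    split; last by exists r.
    by rewrite subr_ge0 ds/= lerBlDr (le_trans s0_le1)// lerDl ltW.
  move=> /(ge_inf lbS.2); rewrite -/s0 lerBrDr gerDl leNgt d0//.
(* If not attained, no root at [s0] lies above the axis, and none lies on it by [real0]. The lower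
   bound then excludes roots in the upper half plane for all later parameters close to [s0]. *)
have rneg r : root (F s0) r -> complex.Im r < 0.
  move=> rr; rewrite ltNge; apply/negP; rewrite le_eqVlt => /orP[/eqP r0|r0].
    have := real0 s0 (complex.Re r) s01.
    have -> : (complex.Re r)%:C%C = r by move: r0; case: (r) => a b /= <-.
    by rewrite rr.
  by apply: nSs0; split=> //; exists r.
have [e e0 He] := poly_lower_norm (sF s0) (cF0 _) rneg.
pose d := Num.min 1 (e / K / 2).
have d0 : 0 < d by rewrite lt_min ltr01 !divr_gt0.
have [s [s0s1 [t tI rt]] sd] := inf_adherent d0 lbS.
have ss0 : s0 <= s by apply: (ge_inf lbS.2); split=> //; exists t.
have ssd : `|s - s0| < d by rewrite ger0_norm ?subr_ge0// ltrBlDl.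
have := He t (ltW tI); have /(_ _ t) := HK s.
rewrite (le_trans (ltW ssd)) ?ge_min ?lexx// => /(_ isT).
move: rt; rewrite rootE => /eqP->; rewrite sub0r -[normc (- _)]/(normc (- _)) normcN.
move=> /(le_trans _) H /H; rewrite ler_pM2r ?exprn_gt0 ?ltr_pwDl ?normc_ge0//.
apply/negP; rewrite -ltNge -ltr_pdivlMl//.
apply: lt_le_trans ssd _; rewrite ge_min; apply/orP; right.
by rewrite [K^-1 * e]mulrC ler_pdivrMr// ler_peMr ?ler1n// ltW// divr_gt0.
Qed.

(** The logarithmic derivative at [z] is the sum of the [(z - r)^-1], which all lie
    in one open half plane. *)
Lemma gauss_lucas_half_plane p (u z : C) : (1 < size p)%N ->
  (forall r, root p r -> 0 < complex.Re (u * (z - r))) -> ~~ root p^`() z.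
Proof.
move=> sp rp; have [rs pE] := closed_field_poly_normal p.
have rsP r : r \in rs -> 0 < complex.Re (u * (z - r)).
  by move=> /(factor_root pE)/rp.
have lp : lead_coef p != 0 by rewrite lead_coef_eq0 -size_poly_gt0 (ltn_trans _ sp).
have nz r : r \in rs -> z - r != 0.
  by move=> /rsP; apply: contraTneq => ->; rewrite mulr0 ltxx.
have rs0 : rs != [::].
  by apply: contraTneq sp => rs0; rewrite pE rs0 big_nil alg_polyC size_polyC lp.
have u0 : u != 0.
  by case: rs rs0 rsP {pE nz} => // r rs _ /(_ r (mem_head _ _)); apply: contraTneq => ->;
    rewrite mul0r ltxx.
have dE : forall rs : seq C, (forall r, r \in rs -> z - r != 0) ->
    (\prod_(r <- rs) ('X - r%:P))^`().[z] =
    (\prod_(r <- rs) (z - r)) * \sum_(r <- rs) (z - r)^-1.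
  elim=> [_|r s IHs sP]; first by rewrite !big_nil poly.derivE !hornerE.
  rewrite !big_cons derivM derivXsubC mul1r hornerD hornerM IHs; last first.
    by move=> r' r's; apply: sP; rewrite inE r's orbT.
  rewrite horner_prod hornerXsubC mulrDr mulrAC divff ?sP ?mem_head// mul1r -mulrA.
  by congr (_ + _); apply: eq_bigr => r' _; rewrite hornerXsubC.
rewrite rootE pE derivZ hornerZ dE// !mulf_neq0//.
  by rewrite prodf_seq_neq0; apply/allP => r rr; rewrite implyTb nz.
suff : 0 < complex.Re (u^-1 * \sum_(r <- rs) (z - r)^-1).
  by apply: contraTneq => ->; rewrite mulr0 ltxx.
rewrite mulr_sumr raddf_sum /=.
have Re_inv w : 0 < complex.Re w -> 0 < complex.Re w^-1.
  case: w => a b /= a0; rewrite divr_gt0// ltr_pwDl ?exprn_gt0 ?sqr_ge0//.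
have H r : r \in rs -> 0 < complex.Re (u^-1 * (z - r)^-1).
  by move=> rr; rewrite -invfM; apply: Re_inv; exact: rsP.
case: rs rs0 H {pE rsP nz} => // r rs _ H; rewrite big_cons ltr_pwDl ?H ?mem_head//.
by rewrite big_seq sumr_ge0// => r' rr'; rewrite ltW// H// inE rr' orbT.
Qed.

End half_plane_roots.

(** * Garding's theory for polynomials [tau (x ^ k * w)] *)

Section garding.
Context {R : realType}.
Local Notation C := (R[i]).
Context {A : algType C}.
Variables (V : A -> Prop) (tau : {scalar A}).
Hypothesis VD : forall x y, V x -> V y -> V (x + y).
Hypothesis VZ : forall (a : R) x, V x -> V (a%:C%C *: x).
Hypothesis Vcomm : forall x y, V x -> V y -> GRing.comm x y.
Implicit Types (x y w e a : A) (t : C).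

Definition pencil_poly k w x e : {poly C} :=
  \poly_(i < k.+1) (tau (x ^+ (k - i) * e ^+ i * w) *+ 'C(k, i)).

Lemma horner_pencil k w x e t : GRing.comm x e ->
  (pencil_poly k w x e).[t] = tau ((x + t *: e) ^+ k * w).
Proof.
move=> xe; rewrite exprDn_comm; last first.
  by rewrite /GRing.comm -scalerAr -scalerAl xe.
rewrite horner_poly mulr_suml linear_sum; apply: eq_bigr => i _ /=.
rewrite mulrnAl linearMn /= exprZn -scalerAr -scalerAl linearZ/=.
by rewrite mulrnAl mulrC.
Qed.

Lemma size_pencil k w x e : (size (pencil_poly k w x e) <= k.+1)%N.
Proof. exact: size_poly. Qed.

Lemma lead_pencil k w x e : (pencil_poly k w x e)`_k = tau (e ^+ k * w).
Proof. by rewrite coef_poly ltnSn subnn mul1r binn. Qed.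

(** Polarization in one step: differentiating along [e] lowers the degree and freezes one factor [e]
    in the weight. *)
Lemma deriv_pencil k w x e :
  (pencil_poly k.+1 w x e)^`() = k.+1%:R *: pencil_poly k (e * w) x e.
Proof.
apply/polyP => i; rewrite coef_deriv coefZ !coef_poly ltnS.
case: ltnP => ik; last by rewrite mul0rn mulr0.
rewrite subSS exprSr -!mulrnA mulr_natl -mulrnA; congr (_ *+ _).
  by rewrite -!mulrA.
by rewrite mulnC -mul_bin_diag mulnC.
Qed.

Lemma tau_scale k w t x : tau ((t *: x) ^+ k * w) = t ^+ k * tau (x ^+ k * w).
Proof. by rewrite exprZn -scalerAl linearZ. Qed.

(** Garding's hyperbolicity in the direction [e], on the real space [V] of commuting elements. In
    the order of [R[i]], positivity includes being real. *)
Definition hyperbolic k w e := [/\ V e, 0 < tau (e ^+ k * w) &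
  forall x t, V x -> tau ((x + t *: e) ^+ k * w) = 0 -> complex.Im t = 0].

(** Here t < 0 in [R[i]] means real and negative. Describing the cone by roots, rather than as a
    connected component, is what the homotopy arguments use. *)
Definition garding_cone k w e a :=
  V a /\ forall t, tau ((a + t *: e) ^+ k * w) = 0 -> t < 0.

Lemma comm_pencil x y e (s t : C) : GRing.comm x e -> GRing.comm y e ->
  GRing.comm (s *: x + t *: y) e.
Proof.
by move=> xe ye; rewrite /GRing.comm mulrDl mulrDr -!scalerAl -!scalerAr xe ye.
Qed.

Lemma garding_cone_neq0 k w e a : garding_cone k w e a -> tau (a ^+ k * w) != 0.
Proof.
by move=> [_ H]; apply/eqP => a0; have := H 0; rewrite scale0r addr0 a0 ltxx => /(_ erefl).
Qed.

(** The value at [a] is the value at [e] times the product of the -r over the roots r of the pencil,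
    all negative. *)
Lemma garding_cone_gt0 k w e a : hyperbolic k w e -> garding_cone k w e a ->
  0 < tau (a ^+ k * w).
Proof.
move=> [Ve e0 _] [Va aP]; have ae := Vcomm Va Ve.
have [rs pE] := closed_field_poly_normal (pencil_poly k w a e).
have [_ lp] : size rs = k /\ lead_coef (pencil_poly k w a e) = tau (e ^+ k * w).
  rewrite -(lead_pencil k w a e); apply: (factor_size _ _ pE); first exact: size_pencil.
  by rewrite lead_pencil gt_eqF.
have rsP r : r \in rs -> r < 0.
  move=> /(factor_root pE); rewrite rootE horner_pencil// => /eqP; exact: aP.
have := horner_pencil k w 0 ae; rewrite scale0r addr0 => <-.
rewrite (horner_factor _ pE) lp mulr_gt0// big_seq prodr_gt0// => r rr.
by rewrite sub0r oppr_gt0 rsP.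
Qed.

(** [root_homotopy] along the segment from [x0] to [x0 + x1], with roots in the direction [y]; the
    leading coefficient [tau (y ^+ k * w)] is the same for all parameters. *)
Lemma root_homotopy_pencil k w x0 x1 y :
  GRing.comm x0 x1 -> GRing.comm x0 y -> GRing.comm x1 y ->
  tau (y ^+ k * w) != 0 ->
  (forall s t : R, 0 <= s <= 1 ->
    tau ((x0 + s%:C%C *: x1 + t%:C%C *: y) ^+ k * w) != 0) ->
  (forall t, 0 < complex.Im t -> tau ((x0 + t *: y) ^+ k * w) != 0) ->
  forall t, 0 < complex.Im t -> tau ((x0 + x1 + t *: y) ^+ k * w) != 0.
Proof.
move=> c01 c0y c1y y0 real0 start t t0.
(* The coefficient of t^i, as a polynomial in the homotopy parameter. *)
pose G i := pencil_poly (k - i) (y ^+ i * w) x0 x1 *+ 'C(k, i).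
pose F (s : R) := \poly_(i < k.+1) (G i).[s%:C%C].
have csy (s : R) : GRing.comm (x0 + s%:C%C *: x1) y.
  by rewrite -[x0]scale1r; exact: comm_pencil.
have FE s z : (F s).[z] = tau ((x0 + s%:C%C *: x1 + z *: y) ^+ k * w).
  rewrite -horner_pencil//; congr (_.[z]); apply/polyP => i; rewrite !coef_poly.
  case: ltnP => // ik; rewrite /G hornerMn horner_pencil// mulrA.
  by [].
have := @root_homotopy R k (tau (y ^+ k * w)) G y0 _ _ _ t t0.
rewrite -/F rootE FE scale1r; apply.
- move=> s; rewrite /G subnn binn mulr1n horner_pencil// expr0 mul1r.
  by [].
- by move=> s x s01; rewrite rootE FE; exact: real0.
- by move=> z z0; rewrite rootE FE scale0r addr0; exact: start.
Qed.

(** The homotopy joins i mu e to x + i mu e. A real root in direction [a] would give an element of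
    [V] the nonreal root i mu in direction [e]. At the start, homogeneity turns a root t into the
    root i mu / t of the pencil of [a], which is negative, so t lies below the axis. *)
Lemma hyperbolic_upper k w e a x (mu : R) t : hyperbolic k w e ->
  garding_cone k w e a -> V x -> 0 < mu -> 0 < complex.Im t ->
  tau ((x + (0 +i* mu)%C *: e + t *: a) ^+ k * w) != 0.
Proof.
move=> He Ga Vx mu0; have [Ve e0 eP] := He; have [Va aP] := Ga.
rewrite [x + _]addrC; apply: root_homotopy_pencil => [||||s z s01|{}t t0].
- by rewrite /GRing.comm -scalerAl -scalerAr (Vcomm Ve Vx).
- by rewrite /GRing.comm -scalerAl -scalerAr (Vcomm Ve Va).
- exact: Vcomm.
- exact: garding_cone_neq0 Ga.
- rewrite -addrA addrC; apply: contraTneq mu0 => /eP /=.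
  by move=> /(_ (VD (VZ _ Vx) (VZ _ Va))) ->; rewrite ltxx.
- have tn0 : t != 0 by apply: contraTneq t0 => ->; rewrite ltxx.
  have -> : (0 +i* mu)%C *: e + t *: a = t *: (a + ((0 +i* mu)%C / t) *: e).
    by rewrite scalerDr scalerA mulrCA divff// mulr1 addrC.
  rewrite tau_scale mulf_neq0 ?expf_neq0//; apply/eqP => /aP.
  set r := _ / t => r0; have : r * t = (0 +i* mu)%C by rewrite divfK.
  move: r0; rewrite ltcE; case: r => r1 r2 /= /andP[/eqP <- r1n].
  case: t t0 {tn0} => [a1 b1] /= b10 [_]; rewrite mul0r addr0 => mE.
  have : r1 * b1 < 0 by rewrite nmulr_rlt0.
  by rewrite mE ltNge (ltW mu0).
Qed.

(** Let mu tend to 0 in [hyperbolic_upper]: the lower bound [B] of [poly_lower_Im] does not depend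
    on mu, so a root above the axis is excluded in the limit. The lower half plane follows by
    passing to - x. *)
Lemma hyperbolic_cone k w e a : hyperbolic k w e -> garding_cone k w e a ->
  hyperbolic k w a.
Proof.
move=> He Ga; have [Ve e0 eP] := He; have [Va aP] := Ga.
have a0 := garding_cone_gt0 He Ga; split=> //.
have upper x t : V x -> 0 < complex.Im t -> tau ((x + t *: a) ^+ k * w) != 0.
  move=> Vx t0; apply/eqP => xta0.
  have cxe : GRing.comm (x + t *: a) e.
    by rewrite -[x]scale1r; apply: comm_pencil; apply: Vcomm.
  pose B := Normc.normc (tau (a ^+ k * w)) * complex.Im t ^+ k.
  have B0 : 0 < B.
    rewrite mulr_gt0 ?exprn_gt0// lt_def normc_ge0 andbT.
    by apply: contraTneq a0 => /Normc.eq0_normc->; rewrite ltxx.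
  have [K K0 HK] := poly_lipschitz (pencil_poly k w (x + t *: a) e) 0.
  (* So small that moving by i d e changes the value by less than [B]. *)
  pose d := Num.min 1 (B / (K + 1) / 2).
  have K10 : 0 < K + 1 by rewrite ltr_wpDl.
  have d0 : 0 < d by rewrite lt_min ltr01 !divr_gt0.
  pose y := x + (0 +i* d)%C *: e.
  have cya : GRing.comm y a by rewrite /y -[x]scale1r; apply: comm_pencil; apply: Vcomm.
  have rootsI r : root (pencil_poly k w y a) r -> complex.Im r <= 0.
    rewrite rootE horner_pencil// leNgt => rr; apply/negP => r0.
    by move: rr; apply/negP; apply: hyperbolic_upper He Ga Vx d0 r0.
  have := poly_lower_Im (size_pencil k w y a) _ rootsI (ltW t0).
  rewrite lead_pencil gt_eqF// => /(_ isT).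
  have nd : Normc.normc ((0 +i* d)%C - 0) = d.
    by rewrite subr0 /= expr0n/= add0r sqrtr_sqr gtr0_norm.
  have := HK (0 +i* d)%C; rewrite nd ge_min lexx => /(_ isT).
  rewrite !horner_pencil// scale0r addr0 xta0 subr0 /y addrAC => H1 H2.
  have : B <= K * d by exact: le_trans H2 H1.
  apply/negP; rewrite -ltNge; apply: (@le_lt_trans _ _ ((K + 1) * d)).
    by rewrite ler_wpM2r ?lerDl// ltW.
  rewrite -ltr_pdivlMl// mulrC (@le_lt_trans _ _ (B / (K + 1) / 2))//.
    by rewrite ge_min lexx orbT.
  by rewrite ltr_pdivrMr// ltr_pMr ?divr_gt0// ltr1n.
move=> x t Vx xta0; apply/eqP; rewrite eq_le; apply/andP; split; rewrite leNgt.
  by apply/negP => t0; have := upper x t Vx t0; rewrite xta0 eqxx.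
apply/negP => t0; have VNx : V (- x).
  by rewrite -scaleN1r -[-1]/(- (1%:C%C)) -rmorphN; exact: VZ.
have := upper _ (- t) VNx; rewrite -[complex.Im _]/(complex.Im (- t)).
have -> : complex.Im (- t) = - complex.Im t by case: (t).
rewrite oppr_gt0 => /(_ t0); rewrite scaleNr -opprD -scaleN1r tau_scale xta0 mulr0.
by rewrite eqxx.
Qed.

(** With the direction multiplied by -i, a positive root becomes a root in the upper half plane, and
    the homotopy follows the segment from [e] to [x]. On the real axis, hyperbolicity in direction
    [a] leaves only the root 0, which would be a zero of the polynomial on the segment; there is
    none because [x] is in the cone of [e]. *)
Lemma garding_cone_indep k w e a x : hyperbolic k w e -> garding_cone k w e a ->
  garding_cone k w e x -> garding_cone k w a x.
Proof.
move=> He Ga Gx; have Ha := hyperbolic_cone He Ga.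
have [Ve e0 eP] := He; have [Va aP] := Ga; have [Vx xP] := Gx; have [_ a0 aR] := Ha.
have cex := Vcomm Ve Vx; have cea := Vcomm Ve Va; have cxa := Vcomm Vx Va.
split=> // t xta0; have tR := aR x t Vx xta0.
rewrite ltcE tR eqxx/= ltNge; apply/negP => t_ge0.
have t_gt0 : 0 < complex.Re t.
  rewrite lt_neqAle t_ge0 andbT; apply/eqP => t0.
  have t00 : t = 0 by move: t0 tR; case: (t) => ? ? /= <- ->.
  move/eqP: xta0; rewrite t00 scale0r addr0; apply/negP.
  exact: garding_cone_neq0 Gx.
have iC : 'i%C * 'i%C = -1 :> C by rewrite -expr2 sqr_i.
have := @root_homotopy_pencil k w e (x - e) (- 'i%C *: a) _ _ _ _ _ _ ('i%C * t).
rewrite subrKC scalerA mulrN mulrAC iC mulN1r opprK xta0 eqxx => H.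
have yE (s : R) : e + s%:C%C *: (x - e) = (1 - s)%:C%C *: e + s%:C%C *: x.
  by rewrite rmorphB scalerBl scale1r scalerBr [in RHS]addrAC addrA.
suff : false by []; apply: H.
- by rewrite /GRing.comm mulrBl mulrBr cex.
- by rewrite /GRing.comm -scalerAl -scalerAr cea.
- by rewrite /GRing.comm -scalerAl -scalerAr mulrBl mulrBr cea cxa.
- by rewrite tau_scale mulf_neq0 ?(gt_eqF a0)// expf_neq0// oppr_eq0 eq_complex/= oner_eq0 andbF.
- move=> s r /andP[s0 s1]; rewrite scalerA; apply/eqP => sr0.
  have := aR _ _ _ sr0; rewrite yE => /(_ (VD (VZ _ Ve) (VZ _ Vx))).
  rewrite /= !(mulr0, mul0r, add0r, addr0, mulrN, oppr0, mulr1, sub0r) => /eqP;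
    rewrite oppr_eq0 => /eqP r0.
  move: sr0; rewrite r0 mul0r scale0r addr0 yE.
  have [->|sn0] := eqVneq s 0.
    by rewrite subr0 !scale1r scale0r addr0 => /eqP; rewrite gt_eqF.
  have sC : s%:C%C != 0 :> C by rewrite eq_complex/= negb_and sn0.
  have -> : (1 - s)%:C%C *: e + s%:C%C *: x = s%:C%C *: (x + ((1 - s) / s)%:C%C *: e).
    by rewrite scalerDr scalerA -rmorphM mulrC divfK// addrC.
  rewrite tau_scale => /eqP; rewrite mulf_eq0 expf_eq0 (negbTE sC) andbF/= => /eqP/xP.
  by rewrite ltcR ltNge divr_ge0// subr_ge0.
(* At the start [e] the root [rho] is real, hence equal to Im z > 0, whereas [a] being in the cone
   of [e] makes its inverse negative. *)
- move=> z z0; rewrite scalerA; apply/eqP => sr0.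
  have := aR _ _ Ve sr0; set rho := z * _ => rho0.
  have rhoE : rho = (complex.Im z)%:C%C.
    move: rho0; rewrite /rho; case: (z) => z1 z2 /=.
    rewrite !(mulr0, mul0r, add0r, addr0, mulrN, oppr0, mulr1, sub0r) => /eqP.
    by rewrite oppr_eq0 => /eqP ->; apply/eqP; rewrite eq_complex/=; apply/andP; split;
      apply/eqP; ring.
  have rhon0 : rho != 0 by rewrite rhoE eq_complex/= negb_and gt_eqF.
  move: sr0; have -> : e + rho *: a = rho *: (a + rho^-1 *: e).
    by rewrite scalerDr scalerA divff// scale1r addrC.
  rewrite tau_scale => /eqP; rewrite mulf_eq0 expf_eq0 (negbTE rhon0) andbF/= => /eqP/aP.
  by rewrite invr_lt0 rhoE ltcR ltNge (ltW z0).
- by move: t_gt0; case: (t) => a1 b1 /=; rewrite mul0r mul1r add0r.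
Qed.

(** Gauss-Lucas on each side of the axis: if the pencil has only real roots, so has its derivative,
    which is the pencil with [a] in the weight. *)
Lemma hyperbolic_derive k w a : hyperbolic k.+1 w a -> hyperbolic k (a * w) a.
Proof.
move=> [Va a0 aR]; split=> //; first by rewrite mulrA -exprSr.
move=> x t Vx xt0; have cxa := Vcomm Vx Va.
have sp : (1 < size (pencil_poly k.+1 w x a))%N.
  rewrite ltnNge; apply/negP => sp; have := lead_pencil k.+1 w x a.
  rewrite nth_default; last by rewrite (leq_trans sp).
  by move/eqP; rewrite eq_sym gt_eqF.
have dt : root (pencil_poly k.+1 w x a)^`() t.
  by rewrite deriv_pencil rootE hornerZ horner_pencil// xt0 mulr0.
have rr r : root (pencil_poly k.+1 w x a) r -> complex.Im r = 0.
  by rewrite rootE horner_pencil// => /eqP; exact: aR.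
apply/eqP; rewrite eq_le; apply/andP; split; rewrite leNgt; apply/negP => t0.
  suff : ~~ root (pencil_poly k.+1 w x a)^`() t by rewrite dt.
  (* As r is real, the real part of -i (t - r) is Im t. *)
  apply: (@gauss_lucas_half_plane _ _ (- 'i%C)) => // r /rr.
  by move: t0; case: (t) (r) => ? ? [? ?] /=; lra.
suff : ~~ root (pencil_poly k.+1 w x a)^`() t by rewrite dt.
apply: (@gauss_lucas_half_plane _ _ 'i%C) => // r /rr.
by move: t0; case: (t) (r) => ? ? [? ?] /=; lra.
Qed.

(** Gauss-Lucas with multiplier 1: when all roots are negative, no nonnegative number is a root of
    the derivative. *)
Lemma garding_cone_derive k w a x : hyperbolic k.+1 w a ->
  garding_cone k.+1 w a x -> garding_cone k (a * w) a x.
Proof.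
move=> Ha [Vx xP]; split=> // t xt0.
have tR : complex.Im t = 0 by case: (hyperbolic_derive Ha) => _ _; apply; last exact: xt0.
have [Va a0 _] := Ha; have cxa := Vcomm Vx Va.
have sp : (1 < size (pencil_poly k.+1 w x a))%N.
  rewrite ltnNge; apply/negP => sp; have := lead_pencil k.+1 w x a.
  rewrite nth_default; last by rewrite (leq_trans sp).
  by move/eqP; rewrite eq_sym gt_eqF.
have dt : root (pencil_poly k.+1 w x a)^`() t.
  by rewrite deriv_pencil rootE hornerZ horner_pencil// xt0 mulr0.
rewrite ltcE tR eqxx/= ltNge; apply/negP => t0.
suff : ~~ root (pencil_poly k.+1 w x a)^`() t by rewrite dt.
apply: (@gauss_lucas_half_plane _ _ 1) => // r.
rewrite rootE horner_pencil// mul1r => /eqP/xP; rewrite ltcE => /andP[_].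
by move: t0; case: (t) (r) => ? ? [? ?] /=; lra.
Qed.

(** The direction changes at every step: a factor [a] enters the weight and becomes the new
    direction. The remaining factors are in the cone of [a] by [garding_cone_indep], and stay there
    after one derivative along [a]. *)
Theorem garding_positive (s : seq A) w e : hyperbolic (size s) w e ->
  (forall a, a \in s -> garding_cone (size s) w e a) ->
  0 < tau ((\prod_(a <- s) a) * w).
Proof.
elim: s w e => [w e [_ e0 _] _|a s IHs w e He sG].
  by move: e0; rewrite big_nil expr0.
have Ga := sG a (mem_head _ _); have [Va _] := Ga.
have cas : GRing.comm a (\prod_(b <- s) b).
  have sV b : b \in s -> V b by move=> bs; case: (sG b) => //; rewrite inE bs orbT.
  elim: s sV {IHs He sG Ga} => [_|b s IHs sV]; first by rewrite big_nil; exact: commr1.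
  rewrite big_cons; apply: commrM; first by apply: Vcomm => //; apply: sV; exact: mem_head.
  by apply: IHs => b' b's; apply: sV; rewrite inE b's orbT.
rewrite big_cons cas -mulrA; apply: (IHs _ a).
  by apply: hyperbolic_derive; exact: hyperbolic_cone He Ga.
move=> b bs; apply: garding_cone_derive; first exact: hyperbolic_cone He Ga.
by apply: garding_cone_indep He Ga _; apply: sG; rewrite inE bs orbT.
Qed.

End garding.

Lemma poly_ext (F : numFieldType) (p q : {poly F}) :
  (forall t, p.[t] = q.[t]) -> p = q.
Proof.
move=> pq; apply/eqP; rewrite -subr_eq0; set d := p - q; apply/negP => /negP d0.
pose rs : seq F := [seq i%:R | i <- iota 0 (size d)].
have : (size rs < size d)%N.
  apply: max_poly_roots => //.
    by apply/allP => r _; rewrite rootE /d !hornerE pq subrr.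
  by rewrite map_inj_uniq ?iota_uniq// => i j /eqP; rewrite eqr_nat => /eqP.
by rewrite size_map size_iota ltnn.
Qed.

(** In the expanded product, [J] is the set of factors that contribute their constant. *)
Lemma coef_prod_XaddC (F : comNzRingType) n (c : 'I_n -> F) m : (m <= n)%N ->
  (\prod_j ((c j)%:P + 'X))`_(n - m) =
  \sum_(J : {set 'I_n} | #|J| == m) \prod_(j in J) c j.
Proof.
move=> mn; rewrite bigA_distr coef_sum [RHS]big_mkcond; apply: eq_bigr => J _.
have -> : \prod_i (if i \in J then (c i)%:P else 'X) =
    (\prod_(i in J) c i)%:P * 'X^(n - #|J|).
  rewrite (bigID (mem J))/= (eq_bigr (fun i => (c i)%:P)) => [|i ->//].
  rewrite rmorph_prod [X in _ * X](eq_bigr (fun=> 'X)) => [|i /negbTE ->//].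
  rewrite prodr_const; congr (_ * 'X^_).
  have /(congr1 (fun k => k - #|J|)%N) := cardC (mem J); rewrite card_ord addKn => <-.
  by apply: eq_card => i; rewrite !inE.
have Jn : (#|J| <= n)%N by rewrite -[X in (_ <= X)%N](card_ord n) max_card.
rewrite coefCM coefXn; have -> : (n - m == n - #|J|)%N = (#|J| == m) by lia.
by case: eqP; rewrite ?mulr1 ?mulr0.
Qed.

(** * Garding's inequality for the cones [Gamma m] *)

Section hermitian_garding.
Context {R : realType} {n : nat}.
Local Notation C := (R[i]).
Local Notation Q := (quat R).
Context {A : algType C} (f : bool -> 'I_n -> Q -> A).
Hypothesis fD : forall b l x y, f b l (x + y) = f b l x + f b l y.
Hypothesis f0M : forall l x z,
  f false l (x * z) = qalpha z *: f false l x + qbeta z *: f true l x.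
Hypothesis f1M : forall l x z,
  f true l (x * z) = - (qbeta z)^*%C *: f false l x + (qalpha z)^*%C *: f true l x.
Hypothesis f_anti : forall b l x b' k y, f b l x * f b' k y = - (f b' k y * f b l x).
Variable tau : {scalar A}.
Hypothesis tau1 : tau (\prod_l (f false l 1 * f true l 1)) = 1.
Implicit Types (M N U : 'M[Q]_n).
Local Notation herm_form := (herm_form f).
Local Notation beta_form := (beta_form f).

(** The coefficient of t^(n-m) in [tau_pencil]: binomial expansion on one side, product over the
    eigenvalues on the other. *)
Lemma tau_esymm m U lam : (m <= n)%N -> qunitary U ->
  tau (herm_form (U *m qdiag lam *m qadj U) ^+ m * beta_form ^+ (n - m)) *+ 'C(n, m) =
  (n`!%:R * esymm m lam)%:C%C.
Proof.
move=> mn Uu; set M := U *m _ *m _.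
have MH : hyperhermitian M by apply: hyperhermitian_diag.
have bE : beta_form = herm_form 1%:M by rewrite (herm_form1 fD f0M f1M f_anti).
have cM : GRing.comm (herm_form M) beta_form.
  rewrite bE; apply: (herm_form_comm fD f0M f1M f_anti) => //.
  exact: (hyperhermitian_scalar 1).
have : pencil_poly tau n 1 (herm_form M) beta_form =
    n`!%:R *: \prod_j ((lam j)%:C%C%:P + 'X).
  apply: poly_ext => t; rewrite horner_pencil// mulr1.
  rewrite (tau_pencil fD f0M f1M f_anti tau1)// hornerZ horner_prod.
  by congr (_ * _); apply: eq_bigr => j _; rewrite !hornerE.
move=> /(congr1 (fun p : {poly C} => p`_(n - m))).
rewrite coef_poly ltnS leq_subr subKn// mulr1 bin_sub// => ->.
rewrite coefZ coef_prod_XaddC// rmorphM rmorph_nat; congr (_ * _).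
by rewrite rmorph_sum; apply: eq_bigr => J _; rewrite rmorph_prod.
Qed.

(** The left side of [tau_esymm] is the same for any two diagonalizations of a matrix, so the choice
    made by [xget] does not matter. *)
Lemma HmE m U lam : (m <= n)%N -> qunitary U ->
  Hm m (U *m qdiag lam *m qadj U) = esymm m lam.
Proof.
move=> mn Uu; rewrite /Hm; case: xgetP => [h _ [U' [lam' [U'u E ->]]]|]; last first.
  by move=> /(_ (esymm m lam)) []; exists U, lam.
have := tau_esymm lam mn Uu; rewrite E (tau_esymm lam' mn U'u) => -[].
by apply: mulfI; rewrite pnatr_eq0 -lt0n fact_gt0.
Qed.

Lemma tau_Hm m M : (m <= n)%N -> hyperhermitian M ->
  tau (herm_form M ^+ m * beta_form ^+ (n - m)) *+ 'C(n, m) =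
  (n`!%:R * Hm m M)%:C%C.
Proof.
move=> mn /hyperhermitian_spectral[U [lam [Uu ->]]].
by rewrite tau_esymm// HmE.
Qed.

Definition herm_space (F : A) := exists2 M, hyperhermitian M & F = herm_form M.

Lemma herm_spaceD F G : herm_space F -> herm_space G -> herm_space (F + G).
Proof.
move=> [M MH ->] [N NH ->]; exists (M + N); first exact: hyperhermitianD.
by rewrite (herm_formD fD).
Qed.

Lemma herm_spaceZ (r : R) F : herm_space F -> herm_space (r%:C%C *: F).
Proof.
move=> [M MH ->]; exists (qreal r *: M); first exact: hyperhermitianZ.
by rewrite (herm_formZ f0M f1M).
Qed.

Lemma herm_space_comm F G : herm_space F -> herm_space G -> GRing.comm F G.
Proof. by move=> [M MH ->] [N NH ->]; exact: (herm_form_comm fD f0M f1M f_anti). Qed.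

Lemma herm_space_beta : herm_space beta_form.
Proof.
exists 1%:M; first exact: (hyperhermitian_scalar 1).
by rewrite (herm_form1 fD f0M f1M f_anti).
Qed.

Local Notation hyperb := (hyperbolic herm_space tau).
Local Notation cone := (garding_cone herm_space tau).

(** The roots are minus the eigenvalues, real by the spectral theorem. *)
Lemma hyperbolic_det : hyperb n 1 beta_form.
Proof.
have bE : beta_form = herm_form 1%:M by rewrite (herm_form1 fD f0M f1M f_anti).
split; first exact: herm_space_beta.
  have I1 : qunitary (1%:M : 'M[Q]_n).
    by rewrite /qunitary qadjE (qadjm_scalar _ 1) mulmx1.
  have := tau_pencil fD f0M f1M f_anti tau1 (fun=> 0) 1 I1.
  have -> : herm_form (1%:M *m qdiag (fun=> 0 : R) *m qadj 1%:M) = 0.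
    rewrite (herm_form_diag fD f0M f1M f_anti) big1// => j _.
    by rewrite scale0r.
  rewrite add0r scale1r mulr1 => ->; rewrite big1 => [|j _]; last by rewrite add0r.
  by rewrite mulr1 ltr0n fact_gt0.
move=> F t [M /hyperhermitian_spectral[U [lam [Uu ->]]] ->] /eqP.
rewrite mulr1 (tau_pencil fD f0M f1M f_anti tau1)//.
rewrite mulf_eq0 pnatr_eq0 -[_ == 0%N]negbK -lt0n fact_gt0 /= prodf_seq_eq0.
move=> /hasP[j _ /=]; rewrite addr_eq0 => /eqP.
by case: t => a b; rewrite -[- _]/((- a +i* - b)%C) => -[_ /eqP]; rewrite eq_sym oppr_eq0 => /eqP.
Qed.

(** Differentiate [hyperbolic_det] n - m times along [beta_form]; each derivative puts one more
    factor into the weight. *)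
Lemma hyperbolic_Hm m : (m <= n)%N -> hyperb m (beta_form ^+ (n - m)) beta_form.
Proof.
move=> mn; rewrite -{1}(subKn mn); move: (n - m)%N (leq_subr m n) => j.
elim: j => [_|j IHj jn]; first by rewrite subn0 expr0; exact: hyperbolic_det.
rewrite exprS; apply: (hyperbolic_derive herm_space_comm).
by rewrite subnSK//; exact/IHj/ltnW.
Qed.

(** A root is real by hyperbolicity, and at a root t >= 0 the value of [Hm m] at t I + M would
    vanish, against the definition of [Gamma]. *)
Lemma Gamma_cone m M : (m <= n)%N -> Gamma m M ->
  cone m (beta_form ^+ (n - m)) beta_form (herm_form M).
Proof.
move=> mn [MH Mpos]; split; first by exists M.
move=> t t0; have [_ _ hR] := hyperbolic_Hm mn.
have tR := hR _ t (ex_intro2 _ _ M MH erefl) t0.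
rewrite ltcE tR eqxx/= ltNge; apply/negP => tpos.
have tE : t = (complex.Re t)%:C%C by move: tR; case: (t) => a b /= ->.
have := @tau_Hm m ((qreal (complex.Re t))%:M + M) mn.
rewrite (herm_form_shift fD f0M f1M f_anti) -tE t0 mul0rn => /(_ _)/wrap[|[]].
  by apply: hyperhermitianD => //; exact: hyperhermitian_scalar.
move=> /eqP; rewrite eq_sym mulf_eq0 pnatr_eq0 -[_ == 0%N]negbK -lt0n fact_gt0 /=.
by rewrite gt_eqF// Mpos.
Qed.

Theorem garding_Gamma (s : seq 'M[Q]_n) : (size s <= n)%N ->
  (forall M, M \in s -> Gamma (size s) M) ->
  0 < tau ((\prod_(M <- s) herm_form M) * beta_form ^+ (n - size s)).
Proof.
move=> sn sG; rewrite -(big_map herm_form predT id).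
have := @garding_positive _ _ herm_space tau herm_spaceD herm_spaceZ herm_space_comm
  (map herm_form s) (beta_form ^+ (n - size s)) beta_form.
rewrite size_map; apply; first exact: hyperbolic_Hm.
by move=> _ /mapP[M Ms ->]; apply: Gamma_cone => //; exact: sG.
Qed.

End hermitian_garding.

Local Open Scope classical_set_scope.
Local Open Scope ring_scope.

(** * Calculus and integration on row vectors *)

Section Ck_theory.
Context {R : realType} {N : nat}.
Implicit Types (D : set 'rV[R]_N) (f g : 'rV[R]_N -> R).

Lemma Ck_continuous k D f x : Ck k D f -> D x -> {for x, continuous f}.
Proof. by case: k => [|k] [cf _]; exact: cf. Qed.

Lemma Ck_derivable k D f i x : Ck k.+1 D f -> D x -> derivable f x (evec i).
Proof. by move=> [_ /(_ i)[df _]]; exact: df. Qed.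

Lemma Ck_partial k D f i : Ck k.+1 D f -> Ck k D (partial i f).
Proof. by move=> [_ /(_ i)[]]. Qed.

Lemma Ck_is_derive k D f i x : Ck k.+1 D f -> D x ->
  is_derive x (evec i) f (partial i f x).
Proof. by move=> fC Dx; apply: DeriveDef => //; exact: Ck_derivable fC Dx. Qed.

Lemma Ck_pred k D f : Ck k.+1 D f -> Ck k D f.
Proof.
elim: k f => [|k IHk] f [cf fC]; split => // i.
by have [df pf] := fC i; split=> //; exact: IHk.
Qed.

Lemma CkW k l D f : (l <= k)%N -> Ck k D f -> Ck l D f.
Proof.
move=> /subnK <-; elim: (k - l)%N => [//|d IHd] fC.
by apply: IHd; exact: Ck_pred.
Qed.

Lemma partial_ext D f g i : open D -> (forall x, D x -> f x = g x) ->
  forall x, D x -> partial i f x = partial i g x.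
Proof.
move=> oD fg x Dx; apply: near_eq_derive.
by apply: filterS (open_nbhs_nbhs (conj oD Dx)) => y; exact: fg.
Qed.

Lemma near_eq_continuous f g x : {near x, f =1 g} ->
  {for x, continuous f} -> {for x, continuous g}.
Proof.
move=> fg; rewrite /prop_for /continuous_at -(nbhs_singleton fg).
by move=> cf; apply: cvg_trans cf; exact: near_eq_cvg fg.
Qed.

Lemma Ck_ext k D f g : open D -> (forall x, D x -> f x = g x) -> Ck k D f -> Ck k D g.
Proof.
move=> oD fg; have nfg f' g' : (forall x, D x -> f' x = g' x) ->
    forall x, D x -> {near x, f' =1 g'}.
  by move=> fg' x Dx; apply: filterS (open_nbhs_nbhs (conj oD Dx)) => y; exact: fg'.
elim: k f g fg => [|k IHk] f g fg [cf fC].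
  by split=> // x Dx; apply: near_eq_continuous (nfg _ _ fg _ Dx) (cf _ Dx).
split=> [x Dx|i].
  by apply: near_eq_continuous (nfg _ _ fg _ Dx) (cf _ Dx).
have [df pf] := fC i; split=> [x Dx|].
  exact: near_eq_derivable (nfg _ _ fg _ Dx) (df _ Dx).
by apply: IHk pf; exact: partial_ext.
Qed.

Lemma Ck_cst k D (c : R) : open D -> Ck k D (cst c).
Proof.
move=> oD; elim: k c => [|k IHk] c; first by split=> // x _; exact: cst_continuous.
split=> [x _|i]; first exact: cst_continuous.
split=> [x _|]; first exact: derivable_cst.
by apply: Ck_ext (IHk 0) => // x _; rewrite /partial derive_cst.
Qed.

Lemma CkD k D f g : open D -> Ck k D f -> Ck k D g -> Ck k D (fun x => f x + g x).
Proof.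
move=> oD; elim: k f g => [|k IHk] f g [cf fC] [cg gC].
  by split=> // x Dx; apply: continuousD; [exact: cf|exact: cg].
split=> [x Dx|i]; first by apply: continuousD; [exact: cf|exact: cg].
have [df pf] := fC i; have [dg pg] := gC i; split=> [x Dx|].
  exact: derivableD (df _ Dx) (dg _ Dx).
apply: Ck_ext (IHk _ _ pf pg) => // x Dx.
by rewrite /partial deriveD; [|exact: df|exact: dg].
Qed.

Lemma CkM k D f g : open D -> Ck k D f -> Ck k D g -> Ck k D (fun x => f x * g x).
Proof.
move=> oD; elim: k f g => [|k IHk] f g fC' gC'; have [cf fC] := fC'; have [cg gC] := gC'.
  by split=> // x Dx; apply: continuousM; [exact: cf|exact: cg].
split=> [x Dx|i]; first by apply: continuousM; [exact: cf|exact: cg].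
have [df pf] := fC i; have [dg pg] := gC i; split=> [x Dx|].
  exact: derivableM (df _ Dx) (dg _ Dx).
have := CkD oD (IHk _ _ (Ck_pred fC') pg) (IHk _ _ pf (Ck_pred gC')).
apply: Ck_ext => // x Dx.
by rewrite /partial deriveM; [rewrite [g x *: _]mulrC|exact: df|exact: dg].
Qed.

Lemma Ck_sum k D (I : Type) (r : seq I) (F : I -> 'rV[R]_N -> R) : open D ->
  (forall i, Ck k D (F i)) -> Ck k D (fun x => \sum_(i <- r) F i x).
Proof.
move=> oD FC; elim: r => [|i r IHr].
  by apply: Ck_ext (Ck_cst k 0 oD) => // x _; rewrite big_nil.
by apply: Ck_ext (CkD oD (FC i) IHr) => // x _; rewrite big_cons.
Qed.

Lemma Ck_prod k D (I : Type) (r : seq I) (F : I -> 'rV[R]_N -> R) : open D ->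
  (forall i, Ck k D (F i)) -> Ck k D (fun x => \prod_(i <- r) F i x).
Proof.
move=> oD FC; elim: r => [|i r IHr].
  by apply: Ck_ext (Ck_cst k 1 oD) => // x _; rewrite big_nil.
by apply: Ck_ext (CkM oD (FC i) IHr) => // x _; rewrite big_cons.
Qed.

Lemma is_derive_coord (phi : R -> R) (dphi : R) (i j : 'I_N) (x : 'rV[R]_N) :
  is_derive (x ord0 i) 1 phi dphi ->
  is_derive x (evec j) (fun y => phi (y ord0 i)) (dphi *+ (i == j)).
Proof.
move=> [dp vp]; have [ij|ij] := eqVneq i j.
  rewrite {}ij in dp vp *.
  have E : (fun h : R => h^-1 *: (((fun y : 'rV[R]_N => phi (y ord0 j)) \o shift x)
      (h *: evec j) - phi (x ord0 j))) =
      (fun h : R => h^-1 *: ((phi \o shift (x ord0 j)) (h *: 1) - phi (x ord0 j))).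
    by apply/funext => h; rewrite /= !mxE !eqxx.
  rewrite mulr1n; split; first by rewrite /derivable E.
  by rewrite /derive E.
rewrite mulr0n; have E y h : phi ((h *: evec j + y) ord0 i) = phi (y ord0 i).
  by rewrite !mxE eqxx (negbTE ij) mulr0 add0r.
have Q : (fun h : R => h^-1 *: (((fun y : 'rV[R]_N => phi (y ord0 i)) \o shift x)
    (h *: evec j) - phi (x ord0 i))) = cst 0.
  by apply/funext => h; rewrite /= E subrr scaler0.
split; first by rewrite /derivable Q; exact: is_cvg_cst.
by rewrite /derive Q; exact: lim_cst.
Qed.

(** [phi] lists a function of one variable with its successive derivatives, so the induction on [k]
    just shifts the index. *)
Lemma Ck_coord k D (phi : nat -> R -> R) l (i : 'I_N) : open D ->
  (forall j (t : R), is_derive t 1 (phi j) (phi j.+1 t)) ->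
  Ck k D (fun x => phi l (x ord0 i)).
Proof.
move=> oD dphi; elim: k l => [|k IHk] l.
  split=> // x _; apply: (@continuous_comp _ _ _ (fun y : 'rV[R]_N => y ord0 i) (phi l)).
    exact: coord_continuous.
  by apply: differentiable_continuous; apply/derivable1_diffP; case: (dphi l (x ord0 i)).
split=> [x _|j].
  apply: (@continuous_comp _ _ _ (fun y : 'rV[R]_N => y ord0 i) (phi l)).
    exact: coord_continuous.
  by apply: differentiable_continuous; apply/derivable1_diffP; case: (dphi l (x ord0 i)).
split=> [x _|]; first by case: (is_derive_coord j (dphi l (x ord0 i))).
have [ij|ij] := eqVneq i j.
  apply: Ck_ext (IHk l.+1) => // x _.
  by rewrite /partial; have [_ ->] := is_derive_coord j (dphi l (x ord0 i)); rewrite ij eqxx.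
apply: Ck_ext (Ck_cst k 0 oD) => // x _.
by rewrite /partial; have [_ ->] := is_derive_coord j (dphi l (x ord0 i)); rewrite (negbTE ij).
Qed.

Lemma is_derive_line f (x v : 'rV[R]_N) (t df : R) :
  is_derive (x + t *: v) v f df -> is_derive t 1 (fun s => f (x + s *: v)) df.
Proof.
have E : (fun h : R => h^-1 *: (((fun s => f (x + s *: v)) \o shift t) (h *: 1) - f (x + t *: v))) =
    (fun h : R => h^-1 *: ((f \o shift (x + t *: v)) (h *: v) - f (x + t *: v))).
  apply/funext => h /=; congr (_ *: (f _ - _)).
  by rewrite [h *: 1]mulr1 scalerDl addrCA.
by move=> [dp vp]; split; rewrite /derivable /derive E.
Qed.

(** The mean value theorem twice: in direction [i] for the increment along [j], then in direction
    [j] for the derivative along [i]. *)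
Lemma double_difference D f i j x (h : R) : open D -> Ck 2 D f -> 0 < h ->
  (forall s t, 0 <= s <= h -> 0 <= t <= h -> D (x + s *: evec i + t *: evec j)) ->
  exists s t, [/\ 0 <= s <= h, 0 <= t <= h &
    f (x + h *: evec i + h *: evec j) - f (x + h *: evec i)
      - (f (x + h *: evec j) - f x) =
    partial j (partial i f) (x + s *: evec i + t *: evec j) * h * h].
Proof.
move=> oD fC h0 box; have h1 : (0 : R) <= 0 <= h by apply/andP; split; [|exact: ltW].
have h2 : 0 <= h <= h by apply/andP; split; [exact: ltW|].
have boxi s : 0 <= s <= h -> D (x + s *: evec i).
  by move=> sh; have := box s 0 sh h1; rewrite scale0r addr0.
pose g s := f (x + h *: evec j + s *: evec i) - f (x + s *: evec i).
pose dg s := partial i f (x + h *: evec j + s *: evec i) - partial i f (x + s *: evec i).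
have dgP s : 0 <= s <= h -> is_derive s 1 g (dg s).
  move=> sh; apply: is_deriveB; apply: is_derive_line; apply: (Ck_is_derive i fC).
    by rewrite addrAC; exact: box.
  exact: boxi.
have [s sh gE] : exists2 s, s \in `]0, h[ & g h - g 0 = dg s * (h - 0).
  apply: (@MVT R g dg 0 h h0) => [s|]; first by rewrite in_itv/= => /andP[? ?]; apply: dgP;
    rewrite !ltW.
  apply: derivable_within_continuous => s; rewrite in_itv/= => sh.
  by case: (dgP s sh).
have {}sh : 0 <= s <= h by move: sh; rewrite in_itv/= => /andP[? ?]; rewrite !ltW.
pose k t := partial i f (x + s *: evec i + t *: evec j).
pose dk t := partial j (partial i f) (x + s *: evec i + t *: evec j).
have dkP t : 0 <= t <= h -> is_derive t 1 k (dk t).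
  move=> th; apply: is_derive_line; apply: (Ck_is_derive j (Ck_partial i fC)).
  exact: box.
have [t th kE] : exists2 t, t \in `]0, h[ & k h - k 0 = dk t * (h - 0).
  apply: (@MVT R k dk 0 h h0) => [t|]; first by rewrite in_itv/= => /andP[? ?]; apply: dkP;
    rewrite !ltW.
  apply: derivable_within_continuous => t; rewrite in_itv/= => th.
  by case: (dkP t th).
have {}th : 0 <= t <= h by move: th; rewrite in_itv/= => /andP[? ?]; rewrite !ltW.
exists s, t; split=> //; move: gE kE; rewrite /g /dg /k /dk !subr0 !scale0r !addr0.
by rewrite [x + h *: evec j + h *: evec i]addrAC [x + h *: evec j + s *: evec i]addrAC => -> ->.
Qed.

Lemma third_lt (r : R) : 0 < r -> r / 3 + r / 3 < r.
Proof. by move=> ?; lra. Qed.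

Lemma dist_lt_double (a a' b b' e : R) : a' = b' ->
  `|a - a'| < e -> `|b - b'| < e -> `|a - b| < e + e.
Proof.
move=> <- ae be; rewrite -(subrKA a') -(opprB b).
by apply: le_lt_trans (ler_normD _ _) _; rewrite normrN ltrD.
Qed.

Lemma eq_second_difference (p q r s a b h : R) : h != 0 ->
  p - q - (r - s) = a * h * h -> p - r - (q - s) = b * h * h -> a = b.
Proof.
move=> h0 E1 E2; apply: (mulIf h0); apply: (mulIf h0); rewrite -E1 -E2.
by rewrite !opprB !addrA addrAC [p - r + s]addrAC; ring.
Qed.

(** Schwarz's theorem. The second difference is symmetric in [i] and [j], so the two mixed
    derivatives agree at two points close to [x], and continuity brings both values to [x]. *)
Theorem partial_comm D f i j : open D -> Ck 2 D f ->
  forall x, D x -> partial i (partial j f) x = partial j (partial i f) x.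
Proof.
move=> oD fC x Dx; apply/eqP/negPn/negP => ne.
pose e := `|partial i (partial j f) x - partial j (partial i f) x| / 2.
have e0 : 0 < e by rewrite divr_gt0// normr_gt0 subr_eq0.
have cij a b : {for x, continuous (partial a (partial b f))}.
  by apply: (@Ck_continuous 0 D) => //; exact/Ck_partial/Ck_partial.
have near_ij a b : \forall y \near x, `|partial a (partial b f) x - partial a (partial b f) y| < e.
  by have /cvgrPdist_lt := cij a b; exact.
have /nbhs_ballP[r /= r0 rP] : nbhs x (D `&`
    ([set y | `|partial i (partial j f) x - partial i (partial j f) y| < e] `&`
     [set y | `|partial j (partial i f) x - partial j (partial i f) y| < e])).
  apply: filterI; first exact: open_nbhs_nbhs.
  by apply: filterI; exact: near_ij.
(* Two increments of length [h] must stay inside the ball of radius [r]. *)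
pose h := r / 3.
have h0 : 0 < h by rewrite divr_gt0.
have box a b (s t : R) : 0 <= s <= h -> 0 <= t <= h -> ball x r (x + s *: evec a + t *: evec b).
  move=> /andP[s0 sh] /andP[t0 th]; split=> // k l; rewrite ord1 /ball/= !mxE eqxx /=.
  rewrite -addrA opprD addrA subrr sub0r normrN.
  apply: (@le_lt_trans _ _ (h + h)); last exact: third_lt.
  apply: le_trans (ler_normD _ _) _; rewrite !normrM !ger0_norm//.
  by apply: lerD; [case: (l == a)|case: (l == b)]; rewrite ?mulr1 ?mulr0// ltW.
have [s [t [sh th E1]]] := double_difference (i := i) (j := j) oD fC h0
  (fun s t sh th => (rP _ (box i j s t sh th)).1).
have [s' [t' [sh' th' E2]]] := double_difference (i := j) (j := i) oD fC h0
  (fun s t sh th => (rP _ (box j i s t sh th)).1).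
have [_ [_ /= b1]] := rP _ (box i j s t sh th).
have [_ [/= b2 _]] := rP _ (box j i s' t' sh' th').
have hn0 : h != 0 by rewrite gt_eqF.
rewrite [x + h *: evec j + _]addrAC in E2.
have AB := eq_second_difference hn0 E2 E1.
by have := dist_lt_double AB b2 b1; rewrite /e -splitr ltxx.
Qed.

End Ck_theory.

(** * Open and compact sets, continuous functions of compact support *)

Section row_measurability.
Context {R : realType} {N : nat}.
Implicit Types (D K U : set 'rV[R]_N) (f g : 'rV[R]_N -> R).
Local Notation mu := (@lebesgue_row R N).

Lemma measurable_box (A : 'I_N -> set R) : (forall i, measurable (A i)) ->
  measurable [set x : 'rV[R]_N | forall i, A i (x ord0 i)].
Proof.
move=> mA; suff : measurable (\bigcap_(i in [set: 'I_N])
    ((fun x : 'rV[R]_N => x ord0 i) @^-1` A i)).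
  congr measurable.
  by apply/seteqP; split => [x Ax i|x Ax i _]; exact: Ax.
apply: fin_bigcap_measurable => // i _.
by rewrite -[X in measurable X]setTI; exact: measurable_coord.
Qed.

(** An open set is a countable union of open boxes with rational corners, since balls are cubes in
    the sup norm. *)
Lemma open_measurable_row U : open U -> measurable U.
Proof.
move=> oU.
pose box (ab : 'rV[rat]_N * 'rV[rat]_N) : set 'rV[R]_N :=
  [set x | forall i, `]ratr (ab.1 ord0 i), ratr (ab.2 ord0 i)[%classic (x ord0 i)].
pose F ab := if pselect (box ab `<=` U) then box ab else set0.
have -> : U = \bigcup_ab F ab.
  apply/seteqP; split=> [x Ux|x [ab _]]; last first.
    by rewrite /F; case: pselect => // abU; exact: abU.
  have /nbhs_ballP[r /= r0 rU] : nbhs x U by exact: open_nbhs_nbhs.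
  have /choice[a aP] i : exists q : rat, x ord0 i - r < ratr q < x ord0 i.
    have /rat_in_itvoo[q] : x ord0 i - r < x ord0 i by rewrite gtrDl oppr_lt0.
    by rewrite in_itv/= => q0; exists q.
  have /choice[b bP] i : exists q : rat, x ord0 i < ratr q < x ord0 i + r.
    have /rat_in_itvoo[q] : x ord0 i < x ord0 i + r by rewrite ltrDl.
    by rewrite in_itv/= => q0; exists q.
  exists (\row_i a i, \row_i b i) => //; rewrite /F; case: pselect => /= [_|[]].
    move=> i; rewrite !mxE /= in_itv/=.
    by have /andP[_ ->] := aP i; have /andP[-> _] := bP i.
  move=> y yab; apply: rU; split=> // i j; rewrite ord1 /ball/=.
  have := yab j; rewrite !mxE/= in_itv/=; have := aP j; have := bP j.
  move=> /andP[? ?] /andP[? ?] /andP[? ?].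
  by rewrite ltr_norml; apply/andP; split; lra.
apply: countable_bigcupT_measurable; first exact: countableP.
move=> ab; rewrite /F; case: (pselect _) => /= ?; last exact: measurable0.
apply: (@measurable_box (fun i => `]ratr (ab.1 ord0 i), ratr (ab.2 ord0 i)[%classic)).
by move=> i; exact: measurable_itv.
Qed.

Lemma closed_measurable_row K : closed K -> measurable K.
Proof.
move=> cK; rewrite -[K]setCK; apply: measurableC; apply: open_measurable_row.
exact: closed_openC.
Qed.

Lemma compact_closed_row K : compact K -> closed K.
Proof. by apply: compact_closed; exact: norm_hausdorff. Qed.

Lemma compact_measurable_row K : compact K -> measurable K.
Proof. by move=> /compact_closed_row; exact: closed_measurable_row. Qed.

Lemma continuous_measurable_row D f : open D ->
  (forall x, D x -> {for x, continuous f}) -> measurable_fun D f.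
Proof.
move=> oD cf mD; apply: (measurability _ (RGenOInfty.measurableE R)) => //.
move=> /= _ [_ [a ->] <-]; apply: open_measurable_row.
rewrite openE => x [Dx /=]; rewrite in_itv/= andbT => ax.
have : \forall y \near x, a < f y by exact: (cvgr_gt (f x) (cf _ Dx)).
have : \forall y \near x, D y by exact: open_nbhs_nbhs.
apply: filterS2 => y Dy ay; split=> //=.
by rewrite in_itv/= andbT.
Qed.

Lemma compact_box K : compact K -> exists2 M : R, 0 < M &
  forall x, K x -> forall i, `|x ord0 i| <= M.
Proof.
move=> /compact_bounded[M [_ KM]]; exists (`|M| + 1); first by rewrite ltr_wpDl.
have M1 : M < `|M| + 1 by apply: le_lt_trans (ler_norm M) _; rewrite ltrDl.
move=> x Kx i; have := KM _ M1 x Kx.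
apply: le_trans; suff : `|x ord0 i| <= mx_norm x by [].
by rewrite mx_normrE; exact: (le_bigmax _ _ (ord0, i)).
Qed.

Lemma box_finite (M : R) :
  (mu [set x | forall i, `[(- M)%R, M]%classic (x ord0 i)] < +oo)%E.
Proof.
rewrite (@lebesgue_row_box R N (fun=> `[- M, M]%classic)) => [|i]; last exact: measurable_itv.
suff : (\prod_(i < N) lebesgue_measure (`[(- M)%R, M]%classic : set R))%E \is a fin_num.
  by rewrite fin_numElt => /andP[].
apply: (big_ind (fun x : \bar R => x \is a fin_num)) => // [x y|i _]; first exact: fin_numM.
by rewrite lebesgue_measure_itv/=; case: ifP.
Qed.

Lemma compact_finite_row K : compact K -> (mu K < +oo)%E.
Proof.
move=> cK; have [M M0 KM] := compact_box cK.
apply: le_lt_trans (box_finite M); apply: le_measure.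
- by rewrite inE; exact: compact_measurable_row.
- rewrite inE; apply: (@measurable_box (fun=> `[- M, M]%classic)) => i.
  exact: measurable_itv.
- by move=> x Kx i; rewrite /= in_itv/= -ler_norml; exact: KM.
Qed.

Lemma compact_norm_bounded K f : compact K -> (forall x, K x -> {for x, continuous f}) ->
  [bounded f x | x in K].
Proof.
move=> cK cf; have cfK : {within K, continuous f}.
  by apply: continuous_in_subspaceT => x /[!inE]; exact: cf.
have /compact_bounded[M [_ mrt]] := continuous_compact cfK cK.
by exists M; split; rewrite ?num_real // => ? ? ? ?; exact: mrt.
Qed.

Lemma integrable_compact_row K D f : open D -> compact K -> K `<=` D ->
  (forall x, D x -> {for x, continuous f}) -> mu.-integrable K (EFin \o f).
Proof.
move=> oD cK KD cf; apply: measurable_bounded_integrable.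
- exact: compact_measurable_row.
- exact: compact_finite_row.
- apply: measurable_funS (continuous_measurable_row oD cf) => //.
  exact: open_measurable_row.
- by apply: compact_norm_bounded => // x Kx; exact/cf/KD.
Qed.

Lemma supported_continuous K D f : open D -> compact K -> K `<=` D ->
  (forall x, D x -> {for x, continuous f}) -> (forall x, ~ K x -> f x = 0) ->
  continuous f.
Proof.
move=> oD cK KD cf f0 x; have [Dx|nDx] := pselect (D x); first exact: cf.
have nK : {near x, cst 0 =1 f}.
  have oK : open (~` K) by apply: closed_openC; exact: compact_closed_row.
  have Kx : (~` K) x by move=> /KD.
  by apply: filterS (open_nbhs_nbhs (conj oK Kx)) => y Ky; rewrite f0.
by apply: near_eq_continuous nK _; exact: cst_continuous.
Qed.

Lemma integral_supported K D f : compact K -> K `<=` D -> (forall x, ~ K x -> f x = 0) ->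
  (\int[mu]_(x in D) (f x)%:E = \int[mu]_x (f x)%:E)%E.
Proof.
move=> cK KD f0; rewrite integral_mkcond; apply: eq_integral => x _.
rewrite patchE; case: ifPn => //; rewrite notin_setE => nDx.
by rewrite f0// => /KD.
Qed.

Lemma integrable_supported K D f : open D -> compact K -> K `<=` D ->
  (forall x, D x -> {for x, continuous f}) -> (forall x, ~ K x -> f x = 0) ->
  mu.-integrable [set: 'rV[R]_N] (EFin \o f).
Proof.
move=> oD cK KD cf f0.
have -> : EFin \o f = (EFin \o f) \_ K.
  apply/funext => x; rewrite patchE; case: ifPn => //; rewrite notin_setE => nK.
  by rewrite /= f0.
apply/integrable_restrict => //; first exact: compact_measurable_row.
by rewrite setTI; exact: integrable_compact_row cf.
Qed.

End row_measurability.

(** * Integrals of derivatives of compactly supported functions *)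

Section divergence.
Context {R : realType}.

Lemma integral_derive0 (H G : R -> R) (M : R) :
  (forall x : R, is_derive x 1 H (G x)) -> continuous G ->
  (forall x, M < `|x| -> H x = 0) -> (forall x, M < `|x| -> G x = 0) ->
  (\int[@lebesgue_measure R]_x (G x)%:E = 0)%E.
Proof.
(* Strictly beyond [M], so that [H] vanishes at both end points, and positive. *)
move=> dH cG H0 G0; pose L := `|M| + 1.
have ML : M < L by apply: le_lt_trans (ler_norm M) _; rewrite ltrDl.
have L0 : 0 < L by rewrite ltr_wpDl.
have LL : - L < L by rewrite (@lt_trans _ _ 0)// oppr_lt0.
have -> : (\int[@lebesgue_measure R]_x (G x)%:E =
    \int[@lebesgue_measure R]_(x in `[(- L)%R, L]) (G x)%:E)%E.
  rewrite [RHS]integral_mkcond; apply: eq_integral => x _.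
  rewrite patchE; case: ifPn => //; rewrite notin_setE /= in_itv/= => /negP.
  rewrite -ler_norml -ltNge => /(lt_trans ML) Mx.
  by rewrite G0.
have cH : continuous H.
  by move=> x; apply: differentiable_continuous; apply/derivable1_diffP; case: (dH x).
rewrite (@continuous_FTC2 R G H)//.
- by rewrite !H0 ?subee// ?normrN gtr0_norm.
- exact: continuous_subspaceT.
- split=> [x _||]; first by case: (dH x).
  + exact/cvg_at_right_filter/cH.
  + exact/cvg_at_left_filter/cH.
- by move=> x _; rewrite derive1E; case: (dH x).
Qed.

Lemma continuous_consr1 N (y : 'rV[R]_N) : continuous (fun a : R => consr (a, y)).
Proof.
move=> a B /nbhs_ballP[r /= r0 rB]; apply/nbhs_ballP; exists r => // b ab /=.
apply: rB; split=> // i j; rewrite !ord1.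
case: (unliftP ord0 j) => [k ->|->]; rewrite ?consrS ?consr0//.
exact: ballxx.
Qed.

Lemma continuous_consr2 N (a : R) : continuous (fun y : 'rV[R]_N => consr (a, y)).
Proof.
move=> y B /nbhs_ballP[r /= r0 rB]; apply/nbhs_ballP; exists r => // z [_ yz] /=.
apply: rB; split=> // i j; rewrite !ord1.
case: (unliftP ord0 j) => [k ->|->]; rewrite ?consrS ?consr0//.
exact: ballxx.
Qed.

Lemma addZ_rowE N (t : R) (u v : 'rV[R]_N) j :
  (t *: u + v) ord0 j = t * u ord0 j + v ord0 j.
Proof. by rewrite !mxE. Qed.

Lemma evecE N (i j : 'I_N) : evec i ord0 j = (j == i)%:R :> R.
Proof. by rewrite mxE eqxx. Qed.

Lemma consr_shift0 N (a t : R) (y : 'rV[R]_N) :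
  consr (t + a, y) = t *: evec ord0 + consr (a, y).
Proof.
apply/rowP => j; case: (unliftP ord0 j) => [k ->|->].
  by rewrite addZ_rowE evecE !consrS eq_sym (negbTE (neq_lift _ _)) mulr0 add0r.
by rewrite addZ_rowE evecE !consr0 eqxx mulr1.
Qed.

Lemma consr_shiftS N (a t : R) (y : 'rV[R]_N) (i : 'I_N) :
  consr (a, t *: evec i + y) = t *: evec (lift ord0 i) + consr (a, y).
Proof.
apply/rowP => j; case: (unliftP ord0 j) => [k ->|->].
  by rewrite addZ_rowE evecE !consrS addZ_rowE evecE (inj_eq lift_inj).
by rewrite addZ_rowE evecE !consr0 (negbTE (neq_lift _ _)) mulr0 add0r.
Qed.

Definition off_box N (M : R) (f : 'rV[R]_N -> R) :=
  forall (x : 'rV[R]_N) i, M < `|x ord0 i| -> f x = 0.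

Lemma off_box_integrable N M (f : 'rV[R]_N -> R) : continuous f -> off_box M f ->
  (lebesgue_row N).-integrable setT (EFin \o f).
Proof.
move=> cf f0; pose K := [set x : 'rV[R]_N | forall i, `[- M, M]%classic (x ord0 i)].
have cK : compact K.
  by apply: (@rV_compact R N (fun=> `[- M, M]%classic)) => i; exact: segment_compact.
apply: (@integrable_supported R N K setT _ openT cK) => [x _|x _|x nKx] //; first exact: cf.
have [i /negP] : exists i, ~ `[- M, M]%classic (x ord0 i) by apply/existsNP.
by rewrite /= in_itv/= -ler_norml -ltNge => /f0.
Qed.

Lemma integral_consr N (f : 'rV[R]_N.+1 -> R) : continuous f ->
  (lebesgue_row N.+1).-integrable setT (EFin \o f) ->
  (lebesgue_measure \x lebesgue_row N)%E.-integrable setT (EFin \o f \o @consr R N) /\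
  (\int[lebesgue_row N.+1]_x (f x)%:E =
   \int[lebesgue_measure \x lebesgue_row N]_p (f (consr p))%:E)%E.
Proof.
move=> cf /integrableP[_ intf].
have mf : measurable_fun [set: 'rV[R]_N.+1] (EFin \o f).
  by apply/measurable_EFinP; apply: (continuous_measurable_row openT) => x _; exact: cf.
have mfc : measurable_fun [set: R * 'rV[R]_N] (EFin \o f \o @consr R N).
  exact: (measurableT_comp mf (@measurable_consr R N)).
have ifc : (lebesgue_measure \x lebesgue_row N)%E.-integrable setT
    (EFin \o f \o @consr R N).
  apply/integrableP; split=> //; move: intf.
  rewrite [X in (X < _)%E](_ : _ = \int[pushforward (lebesgue_measure \x lebesgue_row N)
    (@consr R N)]_x `|(EFin \o f) x|)%E//.
  rewrite ge0_integral_pushforward//; first exact: measurable_consr.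
  by apply: measurableT_comp.
split=> //.
rewrite [LHS](_ : _ = \int[pushforward (lebesgue_measure \x lebesgue_row N)
    (@consr R N)]_x (EFin \o f) x)%E//.
by rewrite integral_pushforward//; exact: measurable_consr.
Qed.

(** Induction on the dimension, splitting off the first coordinate by Fubini. The inner integral
    vanishes by the one-dimensional case if the derivative is along that coordinate, by induction
    otherwise. *)
Lemma integral_partial0 N (h g : 'rV[R]_N -> R) (i : 'I_N) (M : R) :
  (forall x, is_derive x (evec i) h (g x)) -> continuous g ->
  off_box M h -> off_box M g ->
  (\int[lebesgue_row N]_x (g x)%:E = 0)%E.
Proof.
elim: N h g i => [h g [//]|N IHN] h g i dh cg h0 g0.
have [ig ->] := integral_consr cg (off_box_integrable cg g0).
case: (unliftP ord0 i) => [j iE|iE].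
  rewrite -(integral12_prod_meas1 ig) /fubini_F.
  rewrite (eq_integral (cst 0%E)) ?integral0// => a _ /=.
  apply: (IHN (fun y => h (consr (a, y))) (fun y => g (consr (a, y))) j).
  - move=> y; have [dp vp] := dh (consr (a, y)); rewrite iE in dp vp.
    have E : (fun t : R => t^-1 *: (((fun y => h (consr (a, y))) \o shift y) (t *: evec j)
        - h (consr (a, y)))) =
      (fun t : R => t^-1 *: ((h \o shift (consr (a, y))) (t *: evec (lift ord0 j))
        - h (consr (a, y)))).
      by apply/funext => t /=; rewrite consr_shiftS.
    by split; rewrite /derivable /derive E.
  - by move=> y; apply: continuous_comp; [exact: continuous_consr2|exact: cg].
  - by move=> y k yk; apply: (h0 _ (lift ord0 k)); rewrite consrS.
  - by move=> y k yk; apply: (g0 _ (lift ord0 k)); rewrite consrS.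
rewrite -(integral21_prod_meas1 ig) /fubini_G.
rewrite (eq_integral (cst 0%E)) ?integral0// => y _ /=.
apply: (@integral_derive0 (fun a => h (consr (a, y))) (fun a => g (consr (a, y))) M).
- move=> a; have [dp vp] := dh (consr (a, y)); rewrite iE in dp vp.
  have E : (fun t : R => t^-1 *: (((fun a => h (consr (a, y))) \o shift a) (t *: 1)
      - h (consr (a, y)))) =
    (fun t : R => t^-1 *: ((h \o shift (consr (a, y))) (t *: evec ord0)
      - h (consr (a, y)))).
    by apply/funext => t /=; rewrite [t *: 1]mulr1 consr_shift0.
  by split; rewrite /derivable /derive E.
- by move=> a; apply: continuous_comp; [exact: continuous_consr1|exact: cg].
- by move=> a aM; apply: (h0 _ ord0); rewrite consr0.
- by move=> a aM; apply: (g0 _ ord0); rewrite consr0.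
Qed.

(** As both functions vanish off the compact [K], the relation between them holds on the whole
    space, and no boundary term arises. *)
Lemma integral_divergence N (D K : set 'rV[R]_N) (h g : 'rV[R]_N -> R) (i : 'I_N) :
  open D -> compact K -> K `<=` D ->
  (forall x, D x -> is_derive x (evec i) h (g x)) ->
  (forall x, D x -> {for x, continuous g}) ->
  (forall x, ~ K x -> h x = 0) -> (forall x, ~ K x -> g x = 0) ->
  (\int[lebesgue_row N]_(x in D) (g x)%:E = 0)%E.
Proof.
move=> oD cK KD dh cg h0 g0; rewrite (integral_supported cK KD g0).
have [M M0 KM] := compact_box cK.
have offK f : (forall x, ~ K x -> f x = 0) -> off_box M f.
  move=> f0 x j xj; apply: f0 => /KM /(_ j); by rewrite leNgt xj.
apply: (@integral_partial0 N h g i M); [|exact: supported_continuous cg g0|exact: offK|exact: offK].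
move=> x; have [Dx|nDx] := pselect (D x); first exact: dh.
have Kx : (~` K) x by move=> /KD.
rewrite g0//; apply: near_eq_is_derive (is_derive_cst 0 x (evec i)).
have oK : open (~` K) by apply: closed_openC; exact: compact_closed_row.
by apply: filterS (open_nbhs_nbhs (conj oK Kx)) => y Ky; rewrite h0.
Qed.

End divergence.

Lemma green_identity (R : comNzRingType) (u w ui wj c ci cj wij uij : R) :
  (ui * c + u * ci) * wj + u * c * wij - ((wj * c + w * cj) * ui + w * c * uij) =
  (u * (c * wij) - w * (c * uij)) + (u * ci * wj - w * cj * ui).
Proof. by ring. Qed.

(** * Green's identity with divergence-free coefficients *)

Section integration_by_parts.
Context {R : realType} {N : nat}.
Local Notation mu := (@lebesgue_row R N).
Implicit Types (D K : set 'rV[R]_N) (f g u w : 'rV[R]_N -> R).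

Lemma partial_off K f i : closed K -> (forall x, ~ K x -> f x = 0) ->
  forall x, ~ K x -> partial i f x = 0.
Proof.
move=> cK f0 x Kx; have oK : open (~` K) by exact: closed_openC.
rewrite (partial_ext i oK (g := cst 0)) => [||//]; first by rewrite /partial derive_cst.
exact: f0.
Qed.

Variables (I : finType) (d : I -> 'I_N) (D : set 'rV[R]_N).
Variables (c : I -> I -> 'rV[R]_N -> R) (dc : I -> I -> I -> 'rV[R]_N -> R).
Hypothesis oD : open D.
Hypothesis cC : forall i j x, D x -> {for x, continuous (c i j)}.
Hypothesis cD : forall i j k x, D x -> is_derive x (evec (d k)) (c i j) (dc i j k x).
Hypothesis dcC : forall i j k x, D x -> {for x, continuous (dc i j k)}.
Hypothesis div1 : forall j x, D x -> \sum_i dc i j i x = 0.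
Hypothesis div2 : forall i x, D x -> \sum_j dc i j j x = 0.
Variables (u w : 'rV[R]_N -> R).
Hypothesis uC : Ck 2 D u.
Hypothesis w_test : test_function D w.

Let K := closure [set x | w x != 0].
Let wC k : Ck k D w. Proof. by case: w_test. Qed.
Let cK : compact K. Proof. by case: w_test. Qed.
Let KD : K `<=` D. Proof. by case: w_test. Qed.
Let clK : closed K. Proof. exact: closed_closure. Qed.
Let w0 x : ~ K x -> w x = 0.
Proof.
by move=> Kx; apply/eqP/negPn/negP => wx; apply: Kx; exact: subset_closure.
Qed.
Let pw0 i x : ~ K x -> partial i w x = 0. Proof. exact: partial_off. Qed.
Let ppw0 i j x : ~ K x -> partial i (partial j w) x = 0.
Proof. by apply: partial_off => // y; exact: pw0. Qed.

Let cu : forall x, D x -> {for x, continuous u}.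
Proof. by move=> x; exact: Ck_continuous uC. Qed.
Let cpu i : forall x, D x -> {for x, continuous (partial i u)}.
Proof. by move=> x; exact: (Ck_continuous (Ck_partial i uC)). Qed.
Let cppu i j : forall x, D x -> {for x, continuous (partial i (partial j u))}.
Proof. by move=> x; exact: (Ck_continuous (Ck_partial i (Ck_partial j uC))). Qed.
Let cw : forall x, D x -> {for x, continuous w}.
Proof. by move=> x; exact: (Ck_continuous (wC 0)). Qed.
Let cpw i : forall x, D x -> {for x, continuous (partial i w)}.
Proof. by move=> x; exact: (Ck_continuous (Ck_partial i (wC 1))). Qed.
Let cppw i j : forall x, D x -> {for x, continuous (partial i (partial j w))}.
Proof. by move=> x; exact: (Ck_continuous (Ck_partial i (Ck_partial j (wC 2)))). Qed.

Let integrableD f : (forall x, D x -> {for x, continuous f}) ->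
  (forall x, ~ K x -> f x = 0) -> mu.-integrable D (EFin \o f).
Proof.
move=> cf f0; apply: (integrableS measurableT) => //; first exact: open_measurable_row.
exact: integrable_supported cf f0.
Qed.

(** [gY i j] is the derivative along [d i] of u c_ij D_j w, and [gZ i j] the derivative along [d j]
    of w c_ij D_i u; both have integral zero. *)
Let gY i j x := (partial (d i) u x * c i j x + u x * dc i j i x) * partial (d j) w x
  + u x * c i j x * partial (d i) (partial (d j) w) x.
Let gZ i j x := (partial (d j) w x * c i j x + w x * dc i j j x) * partial (d i) u x
  + w x * c i j x * partial (d j) (partial (d i) u) x.

Let contD f g x : {for x, continuous f} -> {for x, continuous g} ->
  {for x, continuous (fun y => f y + g y)}.
Proof. exact: continuousD. Qed.
Let contM f g x : {for x, continuous f} -> {for x, continuous g} ->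
  {for x, continuous (fun y => f y * g y)}.
Proof. exact: continuousM. Qed.

Let cgY i j x : D x -> {for x, continuous (gY i j)}.
Proof.
move=> Dx; apply: contD; last by apply: contM; [apply: contM; [exact: cu|exact: cC]|exact: cppw].
apply: contM; last exact: cpw.
by apply: contD; apply: contM; [exact: cpu|exact: cC|exact: cu|exact: dcC].
Qed.

Let cgZ i j x : D x -> {for x, continuous (gZ i j)}.
Proof.
move=> Dx; apply: contD; last by apply: contM; [apply: contM; [exact: cw|exact: cC]|exact: cppu].
apply: contM; last exact: cpu.
by apply: contD; apply: contM; [exact: cpw|exact: cC|exact: cw|exact: dcC].
Qed.

Let gY0 i j x : ~ K x -> gY i j x = 0.
Proof. by move=> Kx; rewrite /gY pw0// ppw0// !mulr0 addr0. Qed.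
Let gZ0 i j x : ~ K x -> gZ i j x = 0.
Proof. by move=> Kx; rewrite /gZ pw0// w0// !mul0r !addr0 mul0r. Qed.

Let deriveMM f g h (df dg dh : R) i x : is_derive x (evec i) f df ->
  is_derive x (evec i) g dg -> is_derive x (evec i) h dh ->
  is_derive x (evec i) (fun y => f y * g y * h y)
    ((df * g x + f x * dg) * h x + f x * g x * dh).
Proof.
move=> Hf Hg Hh; apply: (is_derive_eq (is_deriveM (is_deriveM Hf Hg) Hh)).
rewrite /GRing.scale/=; rewrite [RHS]addrC; congr (_ + _).
by rewrite mulrC [g x * df]mulrC [f x * dg + _]addrC.
Qed.

Let intY i j : (\int[mu]_(x in D) (gY i j x)%:E = 0)%E.
Proof.
apply: (integral_divergence (i := d i)
  (h := fun x => u x * c i j x * partial (d j) w x) oD cK KD) => [x Dx|x Dx|x Kx|x Kx].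
- apply: deriveMM; [exact: (Ck_is_derive _ uC)|exact: cD|].
  exact: (Ck_is_derive _ (Ck_partial _ (wC 2))).
- exact: cgY.
- by rewrite pw0// mulr0.
- exact: gY0.
Qed.

Let intZ i j : (\int[mu]_(x in D) (gZ i j x)%:E = 0)%E.
Proof.
apply: (integral_divergence (i := d j)
  (h := fun x => w x * c i j x * partial (d i) u x) oD cK KD) => [x Dx|x Dx|x Kx|x Kx].
- apply: deriveMM; [exact: (Ck_is_derive _ (wC 1))|exact: cD|].
  exact: (Ck_is_derive _ (Ck_partial _ uC)).
- exact: cgZ.
- by rewrite w0// !mul0r.
- exact: gZ0.
Qed.

Let a x := u x * \sum_i \sum_j c i j x * partial (d i) (partial (d j) w) x.
Let b x := w x * \sum_i \sum_j c i j x * partial (d j) (partial (d i) u) x.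

Let contsum (J : finType) (F : J -> 'rV[R]_N -> R) x :
  (forall j, {for x, continuous (F j)}) -> {for x, continuous (fun y => \sum_j F j y)}.
Proof.
move=> cF; have -> : (fun y => \sum_j F j y) = \sum_j F j.
  by apply/funext => y; rewrite fct_sumE.
by elim/big_ind: _ => [|f g|//]; [exact: cst_continuous|exact: continuousD].
Qed.

Let ab x : D x -> a x - b x = \sum_i \sum_j (gY i j x - gZ i j x).
Proof.
move=> Dx; rewrite /a /b !mulr_sumr -sumrB.
have E1 : \sum_i \sum_j u x * dc i j i x * partial (d j) w x = 0.
  rewrite exchange_big/= big1// => j _; rewrite -mulr_suml -mulr_sumr div1//.
  by rewrite mulr0 mul0r.
have E2 : \sum_i \sum_j w x * dc i j j x * partial (d i) u x = 0.
  by rewrite big1// => i _; rewrite -mulr_suml -mulr_sumr div2// mulr0 mul0r.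
have -> : \sum_i \sum_j (gY i j x - gZ i j x) =
    \sum_i \sum_j (u x * (c i j x * partial (d i) (partial (d j) w) x) -
                   w x * (c i j x * partial (d j) (partial (d i) u) x)) +
    (\sum_i \sum_j u x * dc i j i x * partial (d j) w x -
     \sum_i \sum_j w x * dc i j j x * partial (d i) u x).
  rewrite -sumrB -big_split; apply: eq_bigr => i _.
  rewrite -sumrB -big_split; apply: eq_bigr => j _.
  exact: green_identity.
rewrite E1 E2 subrr addr0; apply: eq_bigr => i _.
by rewrite !mulr_sumr -sumrB.
Qed.

Let a0 x : ~ K x -> a x = 0.
Proof.
move=> Kx; have E : \sum_i \sum_j c i j x * partial (d i) (partial (d j) w) x = 0.
  apply: big1 => i _; apply: big1 => j _; exact: (etrans (congr1 _ (ppw0 _ _ Kx)) (mulr0 _)).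
exact: (etrans (congr1 _ E) (mulr0 _)).
Qed.

Let b0 x : ~ K x -> b x = 0.
Proof. move=> Kx; exact: (etrans (congr1 ( *%R^~ _) (w0 Kx)) (mul0r _)). Qed.

Let ca x : D x -> {for x, continuous a}.
Proof.
move=> Dx; apply: contM; first exact: cu.
by apply: contsum => i; apply: contsum => j; apply: contM; [exact: cC|exact: cppw].
Qed.

Let cb x : D x -> {for x, continuous b}.
Proof.
move=> Dx; apply: contM; first exact: cw.
by apply: contsum => i; apply: contsum => j; apply: contM; [exact: cC|exact: cppu].
Qed.

Let mD : measurable D. Proof. exact: open_measurable_row. Qed.
Let ia : mu.-integrable D (EFin \o a). Proof. exact: integrableD ca a0. Qed.
Let ib : mu.-integrable D (EFin \o b). Proof. exact: integrableD cb b0. Qed.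
Let iYZ i j : mu.-integrable D (fun x => (gY i j x)%:E - (gZ i j x)%:E)%E.
Proof.
apply: integrableB; first exact: mD.
- exact: integrableD (@cgY i j) (@gY0 i j).
- exact: integrableD (@cgZ i j) (@gZ0 i j).
Qed.

Let intYZ i j : (\int[mu]_(x in D) ((gY i j x)%:E - (gZ i j x)%:E) = 0)%E.
Proof.
rewrite integralB_EFin.
- exact: (etrans (f_equal2 (fun x y => x - y)%E (intY i j) (intZ i j)) (sube0 _)).
- exact: mD.
- exact: integrableD (@cgY i j) (@gY0 i j).
- exact: integrableD (@cgZ i j) (@gZ0 i j).
Qed.

Let ab0 : (\int[mu]_(x in D) ((a x)%:E - (b x)%:E) = 0)%E.
Proof.
transitivity (\int[mu]_(x in D) (\sum_i \sum_j ((gY i j x)%:E - (gZ i j x)%:E)))%E.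
  apply: eq_integral => x; rewrite inE => Dx; rewrite -EFinB ab; last exact: Dx.
  rewrite -sumEFin; apply: eq_bigr => i _; rewrite -sumEFin; exact: eq_bigr.
rewrite integral_sum; [|exact: mD|]; last first.
  move=> i; apply: (@integrable_sum _ _ _ _ _ mD) => j _; exact: iYZ.
apply: big1 => i _; rewrite integral_sum; [|exact: mD|exact: iYZ].
apply: big1 => j _; exact: intYZ.
Qed.

(** In gY - gZ the products of first derivatives of [u] and [w] cancel, and the terms containing
    derivatives of the coefficients disappear after summation by [div1] and [div2]; what remains is
    a - b. *)
Lemma integration_by_parts2 :
  (\int[mu]_(x in D) (a x)%:E = \int[mu]_(x in D) (b x)%:E)%E /\
  mu.-integrable D (EFin \o b).
Proof.
split; last exact: ib.
have fb := integrable_fin_num mD ib.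
have E : (\int[mu]_(x in D) (a x)%:E - \int[mu]_(x in D) (b x)%:E = 0)%E.
  exact: (etrans (esym (integralB_EFin mD ia ib)) ab0).
exact: (etrans (esym (subeK _ fb)) (etrans (congr1 (fun z => z + _)%E E) (add0e _))).
Qed.

End integration_by_parts.

(** * Smooth bump functions *)

Section flat_function.
Context {R : realType}.
Implicit Types (p : {poly R}) (t : R).

(** Polynomials p are allowed in order to get a class stable under differentiation: the derivative
    belongs to X^2 (p - p'), so smoothness follows by iteration. *)
Definition flat p t : R := if 0 < t then p.[t^-1] * expR (- t^-1) else 0.

Lemma expR_dominates_pow k : exists2 C : R, 0 < C & forall s : R, 0 < s -> s ^+ k <= C * expR s.
Proof.
exists (k.+1%:R ^+ k) => [|s s0]; first by rewrite exprn_gt0.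
have k0 : 0 < k.+1%:R :> R by [].
have -> : s = k.+1%:R * (s / k.+1%:R) by rewrite mulrC divfK ?gt_eqF.
set y := s / _; have y0 : 0 < y by rewrite divr_gt0.
rewrite exprMn ler_pM2l ?exprn_gt0// expRM_natl.
have y1 : y <= expR y by apply: le_trans (expR_ge1Dx y); rewrite lerDr.
apply: le_trans (_ : expR y ^+ k <= _); first by rewrite lerXn2r// ?nnegrE ?expR_ge0// ltW.
by rewrite ler_eXn2l ?expR_gt1.
Qed.

Lemma expR_dominates_poly p : exists2 C : R, 0 < C & forall s : R, 0 < s -> `|p.[s]| <= C * expR s.
Proof.
have [C CP] : {C : nat -> R & forall k, 0 < C k /\ forall s : R, 0 < s -> s ^+ k <= C k * expR s}.
  apply: (@choice _ _ (fun k C => 0 < C /\ forall s : R, 0 < s -> s ^+ k <= C * expR s)).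
  by move=> k; have [C C0 HC] := expR_dominates_pow k; exists C.
exists (1 + \sum_(k < size p) `|p`_k| * C k) => [|s s0].
  by rewrite ltr_wpDr// sumr_ge0// => k _; rewrite mulr_ge0// ltW//; case: (CP k).
rewrite mulrDl mul1r; apply: le_trans (_ : _ <= \sum_(k < size p) `|p`_k| * C k * expR s) _.
  rewrite horner_coef; apply: le_trans (ler_norm_sum _ _ _) _; apply: ler_sum => k _.
  rewrite normrM -mulrA ler_wpM2l// ger0_norm; last by rewrite exprn_ge0 ?ltW.
  by case: (CP k) => _; apply.
by rewrite -mulr_suml lerDr expR_ge0.
Qed.

(** The exponential dominates X^2 p at 1/t, and the factor X^2 becomes the t^2 of the bound. This
    gives derivative 0 at the origin, where the rules of differentiation do not apply. *)
Lemma flat_quadratic p : exists2 C : R, 0 < C & forall t, `|flat p t| <= C * t ^+ 2.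
Proof.
have [C C0 HC] := expR_dominates_poly ('X^2 * p); exists C => // t.
rewrite /flat; case: ifPn => [t0|_]; last by rewrite normr0 mulr_ge0 ?sqr_ge0 ?ltW.
have := HC _ (_ : 0 < t^-1); rewrite invr_gt0 => /(_ t0).
rewrite hornerM hornerXn normrM (ger0_norm (sqr_ge0 _)) => H.
rewrite normrM (ger0_norm (expR_ge0 _)) expRN ler_pdivrMr ?expR_gt0//.
rewrite -(ler_pM2l (_ : 0 < t^-1 ^+ 2)); last by rewrite exprn_gt0 ?invr_gt0.
apply: le_trans H _; rewrite le_eqVlt; apply/orP; left; apply/eqP.
by rewrite exprVn; field; rewrite gt_eqF.
Qed.

Lemma quadratic_is_derive0 (f : R -> R) C : (forall t, `|f t| <= C * t ^+ 2) ->
  is_derive (0 : R) 1 f 0.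
Proof.
move=> fC; have f0 : f 0 = 0.
  by apply/eqP; rewrite -normr_le0 (le_trans (fC 0))// expr0n mulr0.
have C0 : 0 <= C by have := fC 1; rewrite expr1n mulr1; exact: le_trans.
have H : h^-1 *: (f (h *: (1 : R) + 0) - f 0) @[h --> (0 : R)^'] --> (0 : R).
  apply/cvgrPdist_le => e e0; near=> h.
  have h0 : h != 0 by near: h; exact: nbhs_dnbhs_neq.
  rewrite sub0r normrN f0 subr0 addr0 [h *: 1]mulr1 normrZ normfV.
  rewrite ler_pdivrMl ?normr_gt0//; apply: le_trans (fC h) _.
  rewrite -real_normK ?num_real// expr2 mulrA mulrC ler_wpM2l//.
  rewrite mulrC; apply: le_trans (_ : `|h| * (C + 1) <= _).
    by rewrite ler_wpM2l// lerDl.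
  rewrite -ler_pdivlMr ?ltr_wpDl//; near: h; apply: nbhs_dnbhs.
  have : \forall h \near (0 : R), `|0 - h| <= e / (C + 1).
    by apply: (@cvgr_dist_le _ _ _ (nbhs (0 : R)) _ id (0 : R)) => //; rewrite divr_gt0 ?ltr_wpDl.
  by apply: filterS => x; rewrite sub0r normrN.
split; first by apply/cvg_ex; exists 0.
by rewrite /derive; exact/cvg_lim.
Unshelve. all: by end_near. Qed.

Lemma near_is_derive (f g : R -> R) t df : {near t, f =1 g} ->
  is_derive t 1 f df -> is_derive t 1 g df.
Proof. exact: near_eq_is_derive. Qed.

Lemma flat_is_derive p t : is_derive t 1 (flat p) (flat ('X^2 * (p - p^`())) t).
Proof.
have [t0|t0|->] := ltgtP t 0.
- rewrite {2}/flat ltNge (ltW t0)/=; apply: (@near_is_derive (cst 0)).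
  near=> s; have s0 : s < 0 by near: s; exact: lt_nbhsl.
  by rewrite /flat ltNge (ltW s0).
- rewrite {2}/flat t0; apply: (@near_is_derive (fun s => p.[s^-1] * expR (- s^-1))).
    near=> s; have s0 : 0 < s by near: s; exact: lt_nbhsr.
    by rewrite /flat s0.
  have tn : t != 0 by rewrite gt_eqF.
  have dV : is_derive t 1 (fun s : R => s^-1) (- t ^- 2).
    by apply: (is_derive_eq (is_deriveV tn (is_derive_id t 1))); rewrite /GRing.scale/= mulr1.
  have dp : is_derive t 1 (fun s : R => p.[s^-1]) (- t ^- 2 * p^`().[t^-1]).
    by apply: (is_derive_eq (is_derive1_comp (is_derive_poly _ _) dV)); rewrite mulrC.
  have dE : is_derive t 1 (fun s : R => expR (- s^-1)) (t ^- 2 * expR (- t^-1)).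
    apply: (is_derive_eq (is_derive1_comp (is_derive_expR _) (is_deriveN dV))).
    by rewrite opprK mulrC.
  apply: (is_derive_eq (is_deriveM dp dE)).
  by rewrite /GRing.scale/= hornerM hornerXn hornerD hornerN -exprVn; ring.
- rewrite {2}/flat ltxx; have [C _ HC] := flat_quadratic p.
  exact: quadratic_is_derive0 HC.
Unshelve. all: by end_near. Qed.

Lemma flat_ge0 t : 0 <= flat 1 t.
Proof. by rewrite /flat; case: ifP => // _; rewrite hornerE mul1r expR_ge0. Qed.

Lemma flat_gt0 t : (0 < flat 1 t) = (0 < t).
Proof. by rewrite /flat; case: ifP => // _; rewrite hornerE mul1r expR_gt0. Qed.

End flat_function.

Section box_bump.
Context {R : realType} {N : nat}.
Local Notation mu := (@lebesgue_row R N).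
Implicit Types (D : set 'rV[R]_N) (q x : 'rV[R]_N) (r : R).

Definition cube q r : set 'rV[R]_N :=
  [set x | forall i, `[q ord0 i - r, q ord0 i + r]%classic (x ord0 i)].

Lemma cube_compact {q r} : compact (cube q r).
Proof.
apply: (@rV_compact _ _ (fun i => `[q ord0 i - r, q ord0 i + r]%classic)) => i.
exact: segment_compact.
Qed.

Lemma cube_closed q r : closed (cube q r).
Proof. by apply: compact_closed_row; exact: cube_compact. Qed.

Lemma cube_nbhs (q : 'rV[R]_N) (P : set 'rV[R]_N) :
  nbhs q P -> exists2 r : R, 0 < r & cube q r `<=` P.
Proof.
move=> /nbhs_ballP[e /= e0 He]; exists (e / 2); first by rewrite divr_gt0.
move=> x xB; apply: He; split=> [//|i j]; rewrite ord1 /ball/= ltr_norml.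
by have /= := xB j; rewrite in_itv/= => /andP[? ?]; apply/andP; split; lra.
Qed.

Definition cube_bump q r x : R := \prod_i (flat 1 (x ord0 i + (r - q ord0 i)) *
  flat 1 (r + q ord0 i - x ord0 i)).

Lemma cube_bump_ge0 q r x : 0 <= cube_bump q r x.
Proof. by apply: prodr_ge0 => i _; rewrite mulr_ge0 ?flat_ge0. Qed.

Lemma cube_bump_center q r : 0 < r -> 0 < cube_bump q r q.
Proof.
move=> r0; apply: prodr_gt0 => i _; rewrite mulr_gt0// flat_gt0.
  by rewrite addrCA subrr addr0.
by rewrite addrK.
Qed.

Lemma cube_bump_off q r x : ~ cube q r x -> cube_bump q r x = 0.
Proof.
move=> nx; have [i ] := (existsNP _).2 nx; rewrite /= in_itv/= => /negP;
  rewrite negb_and -!ltNge => H.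
rewrite /cube_bump (bigD1 i)//= /flat; case/orP: H => H.
  by rewrite ltNge (_ : _ <= 0) ?mul0r//; lra.
by rewrite [in X in _ * X * _]ltNge (_ : r + _ - _ <= 0) ?mulr0 ?mul0r//; lra.
Qed.

Let T (p : {poly R}) := 'X^2 * (p - p^`()).

Lemma Ck_cube_bump k D q r : open D -> Ck k D (cube_bump q r).
Proof.
move=> oD; apply: Ck_prod => // i; apply: CkM => //.
  apply: (@Ck_coord _ _ k D (fun j t => flat (iter j T 1) (t + (r - q ord0 i))) 0 i oD).
  move=> j t; have d1 : is_derive t 1 (fun s : R => s + (r - q ord0 i)) 1.
    by apply: (is_derive_eq (is_deriveD (is_derive_id t 1) (is_derive_cst _ t 1))); rewrite addr0.
  by apply: (is_derive_eq (is_derive1_comp (flat_is_derive _ _) d1)); rewrite mulr1.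
have -> : (fun x : 'rV[R]_N => flat 1 (r + q ord0 i - x ord0 i)) =
    (fun x => (-1) ^+ 0 * flat (iter 0 T 1) (r + q ord0 i - x ord0 i)).
  by apply/funext => x; rewrite mul1r.
apply: (@Ck_coord _ _ k D
  (fun j t => (-1) ^+ j * flat (iter j T 1) (r + q ord0 i - t)) 0 i oD).
move=> j t; have d1 : is_derive t 1 (fun s : R => r + q ord0 i - s) (-1).
  by apply: (is_derive_eq (is_deriveB (is_derive_cst _ t 1) (is_derive_id t 1))); rewrite sub0r.
apply: (is_derive_eq (is_deriveZ _ (is_derive1_comp (flat_is_derive _ _) d1))).
by rewrite /GRing.scale/= -/(T _) exprS mulrN1 mulN1r mulNr mulrN.
Qed.

Lemma cube_bump_test_function D q r : open D -> cube q r `<=` D -> test_function D (cube_bump q r).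
Proof.
move=> oD BD; have sub : closure [set x | cube_bump q r x != 0] `<=` cube q r.
  rewrite [X in _ `<=` X]((closure_id _).1 (@cube_closed q r)); apply: closure_subset.
  by move=> x /= bx; apply: contrapT => /cube_bump_off bx0; rewrite bx0 eqxx in bx.
split=> [k||]; first exact: Ck_cube_bump.
  by apply: (subclosed_compact _ (cube_compact (q:=q) (r:=r)) sub); exact: closed_closure.
exact: subset_trans sub BD.
Qed.

Lemma cube_gt0 q r : 0 < r -> (0 < mu (cube q r))%E.
Proof.
move=> r0; rewrite (@lebesgue_row_box R N (fun i => `[q ord0 i - r, q ord0 i + r]%classic)).
  apply: (big_ind (fun x : \bar R => 0 < x)%E) => // [x y|i _]; first exact: mule_gt0.
  rewrite lebesgue_measure_itv/= lte_fin ifT; last by lra.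
  by rewrite -EFinB lte_fin; lra.
by move=> i; exact: measurable_itv.
Qed.

(** If [h] were negative at [q], a bump supported where [h] is negative would give a negative
    integral. *)
Lemma test_nonneg D (h : 'rV[R]_N -> R) q : open D ->
  (forall x, D x -> {for x, continuous h}) -> D q ->
  (forall w, test_function D w -> (forall x, D x -> 0 <= w x) ->
    (0 <= \int[mu]_(x in D) (w x * h x)%:E)%E) -> 0 <= h q.
Proof.
move=> oD ch Dq H; rewrite leNgt; apply/negP => hq.
have nD : nbhs q D by apply: open_nbhs_nbhs.
have [r r0 rB] : exists2 r : R, 0 < r & cube q r `<=` D `&` [set x | h x < 0].
  by apply: cube_nbhs; apply: filterI => //; exact: (cvgr_lt (h q) (ch _ Dq)).
pose w := cube_bump q r; have wT : test_function D w.
  by apply: cube_bump_test_function => // x /rB[].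
have cw x : D x -> {for x, continuous w} by exact: (Ck_continuous (Ck_cube_bump 0 q r oD)).
pose F x := - (w x * h x).
have cF x : D x -> {for x, continuous F}.
  by move=> Dx; apply: continuousN; apply: continuousM; [exact: cw|exact: ch].
have Fq : 0 < F q by rewrite /F -mulrN mulr_gt0 ?oppr_gt0 ?cube_bump_center.
have F0 x : 0 <= F x.
  rewrite /F -mulrN; have [/rB[_ /= hx]|/cube_bump_off wx] := pselect (cube q r x).
    by rewrite mulr_ge0 ?cube_bump_ge0// oppr_ge0 ltW.
  by rewrite /w wx mul0r.
have Fq2 : F q / 2 < F q by lra.
(* A cube of positive measure on which the integrand is bounded below makes the integral strictly
   positive. *)
have [s s0 sB] : exists2 s : R, 0 < s & cube q s `<=` D `&` [set x | F q / 2 < F x].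
  by apply: cube_nbhs; apply: filterI => //; exact: (cvgr_gt (F q) (cF _ Dq)).
have mD : measurable D by exact: open_measurable_row.
have mC : measurable (cube q s) by apply: closed_measurable_row; exact: cube_closed.
have mF : measurable_fun D (EFin \o F).
  by apply/measurable_EFinP; exact: continuous_measurable_row.
have pos : (0 < \int[mu]_(x in D) (F x)%:E)%E.
  apply: (@lt_le_trans _ _ (\int[mu]_(x in cube q s) (F q / 2)%:E)%E).
    rewrite integral_cst// mule_gt0 ?cube_gt0// lte_fin; lra.
  apply: (@le_trans _ _ (\int[mu]_(x in cube q s) (F x)%:E)%E).
    apply: ge0_le_integral => //.
    - by move=> x _; rewrite lee_fin; lra.
    - by apply: measurable_funS mF => // x /sB[].
    - by move=> x /sB[_ /= /ltW]; rewrite lee_fin.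
  apply: ge0_subset_integral => //.
  - by move=> x _; rewrite lee_fin.
  - by move=> x /sB[].
have := H w wT (fun x _ => cube_bump_ge0 q r x).
have -> : (\int[mu]_(x in D) (w x * h x)%:E = - \int[mu]_(x in D) (F x)%:E)%E.
  rewrite -integral_ge0N//; last by move=> x _; rewrite lee_fin.
  by apply: eq_integral => x _; rewrite -EFinN opprK.
by rewrite leeNr oppe0 leNgt pos.
Qed.

End box_bump.

(** * The quaternionic Hessian and the operator Delta *)

Lemma sum_pair (V : nmodType) (I J : finType) (G : I * J -> V) :
  \sum_p G p = \sum_i \sum_j G (i, j).
Proof. by rewrite pair_bigA; apply: eq_bigr => -[]. Qed.

Lemma sum_symmetric (R : realType) (V : lmodType R[i]) (I : finType)
    (H : I -> I -> R) (X : I -> I -> V) : (forall i j, H i j = H j i) ->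
  \sum_i \sum_j (H i j)%:C%C *: X j i = \sum_i \sum_j (H i j)%:C%C *: X i j.
Proof.
move=> Hsym; rewrite exchange_big; apply: eq_bigr => i _; apply: eq_bigr => j _.
by rewrite Hsym.
Qed.

Section herm_form_sum.
Context {R : realType} {n : nat}.
Local Notation C := (R[i]).
Local Notation Q := (quat R).
Context {A : algType C} (f : bool -> 'I_n -> Q -> A).
Hypothesis fD : forall b l x y, f b l (x + y) = f b l x + f b l y.
Hypothesis f0M : forall l x z,
  f false l (x * z) = qalpha z *: f false l x + qbeta z *: f true l x.
Hypothesis f1M : forall l x z,
  f true l (x * z) = - (qbeta z)^*%C *: f false l x + (qalpha z)^*%C *: f true l x.
Hypothesis f_anti : forall b l x b' k y, f b l x * f b' k y = - (f b' k y * f b l x).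

(** At the real Hessian of a function this is the quaternionic one; a general [H] serves to
    prescribe the Hessian of a quadratic function. *)
Definition quat_of_real_form (H : 'I_n * 'I_4 -> 'I_n * 'I_4 -> R) : 'M[Q]_n :=
  \matrix_(l, k) \sum_a \sum_b (qunit a * qconj (qunit b)) * qreal (H (l, a) (k, b)).

Definition coframe b (i : 'I_n * 'I_4) : A := f b i.1 (qunit i.2).

Lemma fpair_units l a k b : fpair f l (qunit a * qconj (qunit b)) k 1 =
  coframe false (l, a) * coframe true (k, b) + coframe false (k, b) * coframe true (l, a).
Proof.
rewrite (fpair_adj f0M f1M) qconjK mul1r /fpair /coframe /=.
by rewrite [f true l _ * _]f_anti opprK.
Qed.

(** By [fpair_units] each pair of indices contributes symmetrically, so a symmetric [H] yields the
    right side twice; this is the reason for the 2^-1 in [herm_form]. *)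
Lemma herm_form_sum (H : 'I_n * 'I_4 -> 'I_n * 'I_4 -> R) :
  (forall i j, H i j = H j i) ->
  herm_form f (quat_of_real_form H) =
  \sum_i \sum_j (H i j)%:C%C *: (coframe false i * coframe true j).
Proof.
move=> Hsym; rewrite /herm_form.
have -> : \sum_l \sum_k fpair f l (quat_of_real_form H l k) k 1 =
    \sum_i \sum_j (H i j)%:C%C *: (coframe false i * coframe true j +
      coframe false j * coframe true i).
  rewrite sum_pair; apply: eq_bigr => l _.
  under [RHS]eq_bigr do rewrite sum_pair.
  rewrite exchange_big; apply: eq_bigr => k _.
  rewrite mxE (fpair_suml fD); apply: eq_bigr => a _.
  rewrite (fpair_suml fD); apply: eq_bigr => b _.
  by rewrite (fpair_real f0M f1M) fpair_units.
under eq_bigr do (under eq_bigr do rewrite scalerDr; rewrite big_split).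
rewrite big_split/= [X in _ + X](sum_symmetric (fun i j => coframe false i * coframe true j) Hsym).
by rewrite -mulr2n half_double.
Qed.

Lemma qadj_quat_of_real_form (H : 'I_n * 'I_4 -> 'I_n * 'I_4 -> R) :
  (forall i j, H i j = H j i) -> hyperhermitian (quat_of_real_form H).
Proof.
move=> Hsym; apply/matrixP => l k; rewrite !mxE qconj_sum exchange_big.
apply: eq_bigr => b _; rewrite qconj_sum; apply: eq_bigr => a _.
by rewrite !qconjM qconjK qconj_real Hsym qrealC.
Qed.

End herm_form_sum.

(** * The quaternionic Hessian in real coordinates *)

Section qhessian.
Context {R : realType} {n : nat}.
Local Notation Q := (quat R).
Local Notation point := 'rV[R]_(4 * n).
Implicit Types (v g : point -> R) (q : point).

Lemma quat_scaleE (r : R) (z : Q) : r *: z = z * qreal r.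
Proof.
case: z => [[[a b] c] d]; rewrite -[LHS]/(r * a, r * b, r * c, r * d) qmulE /qreal.
by congr (_, _, _, _); ring.
Qed.

Lemma is_derive_quat (z : Q) g q (w : point) dg : is_derive q w g dg ->
  is_derive q w (fun y => z * qreal (g y)) (z * qreal dg).
Proof.
move=> [Hg <-]; have -> : (fun y => z * qreal (g y)) = (fun y => g y *: z).
  by apply/funext => y; rewrite quat_scaleE.
have H : h^-1 *: (g (h *: w + q) *: z - g q *: z) @[h --> (0 : R)^'] -->
    ('D_w g q *: z : Q).
  under eq_fun do rewrite -scalerBl scalerA.
  by apply: cvgZr_tmp; exact: Hg.
rewrite -quat_scaleE; split; first by apply/cvg_ex; eexists; exact: H.
by rewrite /derive; exact/cvg_lim.
Qed.

Definition ridx (i : 'I_n * 'I_4) : 'I_(4 * n) := xidx i.1 i.2.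

Lemma ridx_inj : injective ridx.
Proof.
move=> [l a] [k b] /(congr1 val) /= lkab; have [la kb] := (ltn_ord a, ltn_ord b).
by congr (_, _); apply: val_inj => /=; lia.
Qed.

Definition real_hessian v q (i j : 'I_n * 'I_4) : R :=
  partial (ridx i) (partial (ridx j) v) q.

Lemma real_hessianC (D : set point) v q i j : open D -> Ck 2 D v -> D q ->
  real_hessian v q i j = real_hessian v q j i.
Proof. by move=> oD vC Dq; exact: (partial_comm _ _ oD vC Dq). Qed.

Lemma qhessianE (D : set point) v q : open D -> Ck 2 D v -> D q ->
  qhessian v q = quat_of_real_form (real_hessian v q).
Proof.
move=> oD vC Dq; apply/matrixP => l k; rewrite !mxE /dqbar; apply: eq_bigr => a _.
have in1 y : D y -> dq k (fun x => qreal (v x)) y =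
    \sum_b qconj (qunit b) * qreal (partial (xidx k b) v y).
  move=> Dy; apply: eq_bigr => b _; congr (_ * _).
  have E : (fun x => 1 * qreal (v x)) = (fun x => qreal (v x)).
    by apply/funext => x; exact: mul1r.
  have [_] := is_derive_quat 1 (Ck_is_derive (xidx k b) vC Dy).
  by rewrite E mul1r.
have -> : 'D_(evec (xidx l a)) (dq k (fun x => qreal (v x))) q =
    \sum_b qconj (qunit b) * qreal (real_hessian v q (l, a) (k, b)).
  have := @near_eq_derive _ _ _ _
    (fun y => \sum_b qconj (qunit b) * qreal (partial (xidx k b) v y)) q (evec (xidx l a)) => ->.
    have H b : is_derive q (evec (xidx l a))
        (fun y => qconj (qunit b) * qreal (partial (xidx k b) v y))
        (qconj (qunit b) * qreal (real_hessian v q (l, a) (k, b))).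
      by apply: is_derive_quat; exact: Ck_is_derive (Ck_partial _ vC) Dq.
    have E : (fun y => \sum_b qconj (qunit b) * qreal (partial (xidx k b) v y)) =
        \sum_b (fun y => qconj (qunit b) * qreal (partial (xidx k b) v y)).
      by apply/funext => y; rewrite fct_sumE.
    by rewrite E; have [_] := is_derive_sum H.
  by apply: filterS (open_nbhs_nbhs (conj oD Dq)) => y; exact: in1.
by rewrite mulr_sumr; apply: eq_bigr => b _; rewrite mulrA.
Qed.

Lemma qhessian_hyperhermitian (D : set point) v q : open D -> Ck 2 D v -> D q ->
  hyperhermitian (qhessian v q).
Proof.
move=> oD vC Dq; rewrite (qhessianE oD vC Dq); apply: qadj_quat_of_real_form => i j.
exact: real_hessianC oD vC Dq.
Qed.

End qhessian.

Lemma sum_I4 (V : nmodType) (G : 'I_4 -> V) : \sum_a G a = G 0 + G 1 + G 2 + G 3.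
Proof.
rewrite !big_ord_recl big_ord0 addr0 !addrA.
by congr (_ + _ + _ + _); congr G; apply: val_inj.
Qed.

Lemma complex_split (R : realType) (z : R[i]) :
  z = (complex.Re z +i* complex.Im z)%C.
Proof. by case: z. Qed.

Section complex_parts.
Context {R : realType}.
Implicit Types x y : R[i].

Lemma ReD x y : complex.Re (x + y) = complex.Re x + complex.Re y.
Proof. by case: x y => ? ? [? ?]. Qed.

Lemma ImD x y : complex.Im (x + y) = complex.Im x + complex.Im y.
Proof. by case: x y => ? ? [? ?]. Qed.

Lemma ReM x y : complex.Re (x * y) =
  complex.Re x * complex.Re y - complex.Im x * complex.Im y.
Proof. by case: x y => ? ? [? ?]. Qed.

Lemma ImM x y : complex.Im (x * y) =
  complex.Re x * complex.Im y + complex.Im x * complex.Re y.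
Proof. by case: x y => ? ? [? ?]. Qed.

End complex_parts.

(** * Derivatives and continuity of complex and form valued functions *)

Section complex_derivative.
Context {R : realType} {N : nat}.
Local Notation C := (R[i]).
Local Notation point := 'rV[R]_N.
Implicit Types (f g : point -> C) (i : 'I_N) (q : point).

Definition is_cderive i q f (df : C) :=
  is_derive q (evec i) (fun y => complex.Re (f y)) (complex.Re df) /\
  is_derive q (evec i) (fun y => complex.Im (f y)) (complex.Im df).

Lemma is_cderive_cst i q (c : C) : is_cderive i q (fun=> c) 0.
Proof. by split; exact: is_derive_cst. Qed.

Lemma is_cderiveD i q f g df dg : is_cderive i q f df -> is_cderive i q g dg ->
  is_cderive i q (fun y => f y + g y) (df + dg).
Proof.
move=> [fr fi] [gr gi]; split.
  have -> : (fun y => complex.Re (f y + g y)) =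
      (fun y => complex.Re (f y)) + (fun y => complex.Re (g y)).
    by apply/funext => y; exact: ReD.
  by apply: (is_derive_eq (is_deriveD fr gr)); rewrite ReD.
have -> : (fun y => complex.Im (f y + g y)) =
    (fun y => complex.Im (f y)) + (fun y => complex.Im (g y)).
  by apply/funext => y; exact: ImD.
by apply: (is_derive_eq (is_deriveD fi gi)); rewrite ImD.
Qed.

Lemma is_cderiveM i q f g df dg : is_cderive i q f df -> is_cderive i q g dg ->
  is_cderive i q (fun y => f y * g y) (df * g q + f q * dg).
Proof.
move=> [fr fi] [gr gi]; split.
  have -> : (fun y => complex.Re (f y * g y)) =
      (fun y => complex.Re (f y)) * (fun y => complex.Re (g y)) -
      (fun y => complex.Im (f y)) * (fun y => complex.Im (g y)).
    by apply/funext => y; exact: ReM.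
  apply: (is_derive_eq (is_deriveB (is_deriveM fr gr) (is_deriveM fi gi))).
  by rewrite /GRing.scale/= ReD !ReM; ring.
have -> : (fun y => complex.Im (f y * g y)) =
    (fun y => complex.Re (f y)) * (fun y => complex.Im (g y)) +
    (fun y => complex.Im (f y)) * (fun y => complex.Re (g y)).
  by apply/funext => y; exact: ImM.
apply: (is_derive_eq (is_deriveD (is_deriveM fr gi) (is_deriveM fi gr))).
by rewrite /GRing.scale/= ImD !ImM; ring.
Qed.

Lemma is_cderiveZ i q (c : C) f df : is_cderive i q f df ->
  is_cderive i q (fun y => c * f y) (c * df).
Proof.
move=> Hf; have := is_cderiveM (is_cderive_cst i q c) Hf.
by rewrite mul0r add0r.
Qed.

Lemma is_cderive_sum i q (I : Type) (r : seq I) (P : pred I) (F : I -> point -> C)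
    (dF : I -> C) : (forall j, is_cderive i q (F j) (dF j)) ->
  is_cderive i q (fun y => \sum_(j <- r | P j) F j y) (\sum_(j <- r | P j) dF j).
Proof.
move=> HF; elim: r => [|j r IHr].
  under eq_fun do rewrite big_nil.
  by rewrite big_nil; exact: is_cderive_cst.
under eq_fun do rewrite big_cons.
by rewrite big_cons; case: (P j); [exact: is_cderiveD|].
Qed.

Lemma is_cderive_real i q (g : point -> R) (dg : R) : is_derive q (evec i) g dg ->
  is_cderive i q (fun y => (g y)%:C%C) dg%:C%C.
Proof. by move=> Hg; split => //=; exact: is_derive_cst. Qed.

Definition ccontinuous q f :=
  {for q, continuous (fun y => complex.Re (f y))} /\
  {for q, continuous (fun y => complex.Im (f y))}.

Lemma ccontinuous_cst q (c : C) : ccontinuous q (fun=> c).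
Proof. by split; exact: cst_continuous. Qed.

Lemma ccontinuousD q f g : ccontinuous q f -> ccontinuous q g ->
  ccontinuous q (fun y => f y + g y).
Proof.
move=> [fr fi] [gr gi]; split.
  have -> : (fun y => complex.Re (f y + g y)) =
      (fun y => complex.Re (f y)) + (fun y => complex.Re (g y)).
    by apply/funext => y; exact: ReD.
  exact: continuousD fr gr.
have -> : (fun y => complex.Im (f y + g y)) =
    (fun y => complex.Im (f y)) + (fun y => complex.Im (g y)).
  by apply/funext => y; exact: ImD.
exact: continuousD fi gi.
Qed.

Lemma ccontinuousM q f g : ccontinuous q f -> ccontinuous q g ->
  ccontinuous q (fun y => f y * g y).
Proof.
move=> [fr fi] [gr gi]; split.
  have -> : (fun y => complex.Re (f y * g y)) =
      (fun y => complex.Re (f y) * complex.Re (g y) - complex.Im (f y) * complex.Im (g y)).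
    by apply/funext => y; exact: ReM.
  exact: continuousB (continuousM fr gr) (continuousM fi gi).
have -> : (fun y => complex.Im (f y * g y)) =
    (fun y => complex.Re (f y) * complex.Im (g y) + complex.Im (f y) * complex.Re (g y)).
  by apply/funext => y; exact: ImM.
exact: continuousD (continuousM fr gi) (continuousM fi gr).
Qed.

Lemma ccontinuous_sum q (I : Type) (r : seq I) (P : pred I) (F : I -> point -> C) :
  (forall j, ccontinuous q (F j)) ->
  ccontinuous q (fun y => \sum_(j <- r | P j) F j y).
Proof.
move=> HF; elim: r => [|j r IHr].
  by under eq_fun do rewrite big_nil; exact: ccontinuous_cst.
under eq_fun do rewrite big_cons.
by case: (P j); [exact: ccontinuousD|].
Qed.

Lemma ccontinuous_real q (g : point -> R) : {for q, continuous g} ->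
  ccontinuous q (fun y => (g y)%:C%C).
Proof. by move=> Hg; split => //=; exact: cst_continuous. Qed.

End complex_derivative.

Section form_derivative.
Context {R : realType} {n : nat} {N : nat}.
Local Notation C := (R[i]).
Local Notation form := (form R n).
Local Notation point := 'rV[R]_N.
Implicit Types (F G : point -> form) (i : 'I_N) (q : point).

Definition is_fderive i q F (dF : form) :=
  forall J, is_cderive i q (fun y => F y J) (dF J).

Definition fcontinuous q F := forall J, ccontinuous q (fun y => F y J).

Lemma is_fderive_cst i q (G : form) : is_fderive i q (fun=> G) 0.
Proof. by move=> J; rewrite ffunE; exact: is_cderive_cst. Qed.

Lemma is_fderiveM i q F G dF dG : is_fderive i q F dF -> is_fderive i q G dG ->
  is_fderive i q (fun y => F y * G y) (dF * G q + F q * dG).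
Proof.
move=> HF HG K; have -> : (fun y => (F y * G y) K) = (fun y => \sum_(J in powerset K)
    (-1) ^+ inversions J (K :\: J)%SET * F y J * G y (K :\: J)%SET).
  by apply/funext => y; rewrite -wedgeE ffunE.
have -> : (dF * G q + F q * dG) K = \sum_(J in powerset K)
    ((-1) ^+ inversions J (K :\: J)%SET * dF J * G q (K :\: J)%SET +
     (-1) ^+ inversions J (K :\: J)%SET * F q J * dG (K :\: J)%SET).
  by rewrite ffunE -!wedgeE [wedge _ _ K]ffunE [X in _ + X]ffunE -big_split.
apply: is_cderive_sum => J.
apply: is_cderiveM (HG _).
exact: is_cderiveZ.
Qed.

Lemma is_fderive_sum i q (I : Type) (r : seq I) (F : I -> point -> form)
    (dF : I -> form) : (forall j, is_fderive i q (F j) (dF j)) ->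
  is_fderive i q (fun y => \sum_(j <- r) F j y) (\sum_(j <- r) dF j).
Proof.
move=> HF J; under eq_fun do rewrite sum_ffunE.
by rewrite sum_ffunE; apply: is_cderive_sum => j; exact: HF.
Qed.

Lemma is_fderive_real i q (g : point -> R) (dg : R) (G : form) :
  is_derive q (evec i) g dg -> is_fderive i q (fun y => (g y)%:C%C *: G) (dg%:C%C *: G).
Proof.
move=> Hg J; under eq_fun do rewrite formZE mulrC.
by rewrite formZE mulrC; apply: is_cderiveZ; exact: is_cderive_real.
Qed.

Lemma fcontinuous_cst q (G : form) : fcontinuous q (fun=> G).
Proof. by move=> J; exact: ccontinuous_cst. Qed.

Lemma fcontinuousD q F G : fcontinuous q F -> fcontinuous q G ->
  fcontinuous q (fun y => F y + G y).
Proof.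
by move=> HF HG J; under eq_fun do rewrite ffunE; exact: ccontinuousD.
Qed.

Lemma fcontinuousM q F G : fcontinuous q F -> fcontinuous q G ->
  fcontinuous q (fun y => F y * G y).
Proof.
move=> HF HG K; have -> : (fun y => (F y * G y) K) = (fun y => \sum_(J in powerset K)
    (-1) ^+ inversions J (K :\: J)%SET * F y J * G y (K :\: J)%SET).
  by apply/funext => y; rewrite -wedgeE ffunE.
apply: ccontinuous_sum => J; apply: ccontinuousM => //.
by apply: ccontinuousM => //; exact: ccontinuous_cst.
Qed.

Lemma fcontinuous_sum q (I : Type) (r : seq I) (F : I -> point -> form) :
  (forall j, fcontinuous q (F j)) -> fcontinuous q (fun y => \sum_(j <- r) F j y).
Proof.
move=> HF J; under eq_fun do rewrite sum_ffunE.
by apply: ccontinuous_sum => j; exact: HF.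
Qed.

Lemma fcontinuous_real q (g : point -> R) (G : form) :
  {for q, continuous g} -> fcontinuous q (fun y => (g y)%:C%C *: G).
Proof.
move=> Hg J; under eq_fun do rewrite formZE.
by apply: ccontinuousM; [exact: ccontinuous_real|exact: ccontinuous_cst].
Qed.

Lemma is_cderive_top i q F dF : is_fderive i q F dF ->
  is_cderive i q (fun y => top_coef (F y)) (top_coef dF).
Proof.
move=> HF; rewrite /top_coef mulrC; under eq_fun do rewrite mulrC.
exact: is_cderiveZ.
Qed.

Lemma ccontinuous_top q F : fcontinuous q F -> ccontinuous q (fun y => top_coef (F y)).
Proof. by move=> HF; apply: ccontinuousM; [exact: HF|exact: ccontinuous_cst]. Qed.

End form_derivative.

(** * The operators [dform] and [Delta] in the real coframe *)

Section dform.
Context {R : realType} {n : nat}.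
Local Notation C := (R[i]).
Local Notation form := (form R n).
Local Notation point := 'rV[R]_(4 * n).
Implicit Types (v g : point -> R) (q : point) (F : point -> form).

Lemma lin4_split (V : lmodType C) (z0 z1 z2 z3 : C) (x y : V) :
  (z0 + 'i%C * z1) *: x + (z2 - 'i%C * z3) *: y =
  z0 *: (1 *: x + 0 *: y) + z1 *: ('i%C *: x + 0 *: y) + z2 *: (0 *: x + 1 *: y) +
  z3 *: (0 *: x + (- 'i%C) *: y).
Proof.
rewrite !scale0r !addr0 !add0r !scale1r !scalerA !scalerDl -!addrA mulrN.
by rewrite [_ * z1]mulrC [_ * z3]mulrC.
Qed.

Lemma lin4_split' (V : lmodType C) (z0 z1 z2 z3 : C) (x y : V) :
  (- z2 - 'i%C * z3) *: x + (z0 - 'i%C * z1) *: y =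
  z0 *: (0 *: x + 1 *: y) + z1 *: (0 *: x + (- 'i%C) *: y) + z2 *: (- 1 *: x + 0 *: y) +
  z3 *: (- 'i%C *: x + 0 *: y).
Proof.
rewrite !scale0r !addr0 !add0r !scaleN1r !scale1r !scalerA !scalerDl !scaleNr !mulrN.
rewrite !scaleNr scalerN [_ * z1]mulrC [_ * z3]mulrC addrC.
by rewrite -!addrA.
Qed.

Lemma qalpha_unit (a : 'I_4) : qalpha (qunit a) = tnth [tuple 1; 'i%C; 0; 0] a :> C.
Proof. by case: a => -[|[|[|[|//]]]]. Qed.

Lemma qbeta_unit (a : 'I_4) : qbeta (qunit a) = tnth [tuple 0; 0; 1; - 'i%C] a :> C.
Proof. by case: a => -[|[|[|[|//]]]] ?; apply: eqC; rewrite /= ?oppr0. Qed.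

Lemma conj_qalpha_unit (a : 'I_4) :
  (qalpha (qunit a))^*%C = tnth [tuple 1; - 'i%C; 0; 0] a :> C.
Proof. by case: a => -[|[|[|[|//]]]] ?; apply: eqC; rewrite /= ?oppr0. Qed.

Lemma conj_qbeta_unit (a : 'I_4) :
  - (qbeta (qunit a))^*%C = tnth [tuple 0; 0; - 1; - 'i%C] a :> C.
Proof. by case: a => -[|[|[|[|//]]]] ?; apply: eqC; rewrite /= ?opprK ?oppr0. Qed.

Lemma split_lshift (l : 'I_n) : fintype.split (lshift n l) = inl l.
Proof. exact: (unsplitK (inl l)). Qed.

Lemma split_rshift (l : 'I_n) : fintype.split (rshift n l) = inr l.
Proof. exact: (unsplitK (inr l)). Qed.

(** The coefficients in the operators [nabla] are the [qalpha] and [qbeta] of the four units, up to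
    conjugation and sign for index 1; the definitions of [qform0] and [qform1] are made for this. *)
Lemma sum_nabla (b : bool) (f : point -> C) q :
  \sum_(A < n + n) nabla A (if b then 1 else 0) f q *: omega A =
  \sum_i dxc i.1 i.2 f q *: coframe (@qform R n) b i.
Proof.
rewrite big_split_ord/= -big_split sum_pair/=; apply: eq_bigr => l _ /=.
rewrite sum_I4 /nabla split_lshift split_rshift /coframe.
case: b => /=; last first.
  by rewrite lin4_split /qform0 !qalpha_unit !qbeta_unit.
by rewrite lin4_split' /qform1 !conj_qalpha_unit !conj_qbeta_unit.
Qed.

Definition dxf (i : 'I_n * 'I_4) F q : form := [ffun J => dxc i.1 i.2 (fun y => F y J) q].

Lemma dformE (b : bool) F q :
  dform (if b then 1 else 0) F q = \sum_i coframe (@qform R n) b i * dxf i F q.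
Proof.
rewrite /dform; transitivity (\sum_(J : {set 'I_(n + n)}) \sum_i
    dxc i.1 i.2 (fun y => F y J) q *: wedge (coframe (@qform R n) b i) (bform J)).
  apply: eq_bigr => J _; transitivity (wedge (\sum_(A < n + n)
      nabla A (if b then 1 else 0) (fun y => F y J) q *: omega A) (bform J)).
    by rewrite wedge_suml; apply: eq_bigr => A _; rewrite wedgeZl.
  by rewrite sum_nabla wedge_suml; apply: eq_bigr => i _; rewrite wedgeZl.
rewrite exchange_big; apply: eq_bigr => i _.
rewrite (form_expand (dxf i F q)) -wedgeE wedge_sumr; apply: eq_bigr => J _.
by rewrite wedgeZr ffunE.
Qed.

Lemma dxf_is i F q dF : is_fderive (ridx i) q F dF -> dxf i F q = dF.
Proof.
move=> HF; apply/ffunP => J; rewrite ffunE /dxc [RHS]complex_split.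
by have [[_ re] [_ im]] := HF J; apply: eqC.
Qed.

Lemma dxf_ext (D : set point) i F G q : open D -> (forall y, D y -> F y = G y) -> D q ->
  dxf i F q = dxf i G q.
Proof.
move=> oD FG Dq; apply/ffunP => J; rewrite !ffunE /dxc.
by apply: eqC; apply: (partial_ext _ oD) => // y /FG ->.
Qed.

Lemma mulr_sumZ (A : algType C) (I : finType) (x : A) (z : I -> C) (X : I -> A) :
  x * (\sum_i z i *: X i) = \sum_i z i *: (x * X i).
Proof. by rewrite mulr_sumr; apply: eq_bigr => i _; rewrite scalerAr. Qed.

Lemma mulr_Z1 (A : algType C) (z : C) (x : A) : x * (z *: 1) = z *: x.
Proof. by rewrite -scalerAr mulr1. Qed.

Lemma Delta_sum (D : set point) v q : open D -> Ck 2 D v -> D q ->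
  Delta v q = \sum_i \sum_j (real_hessian v q i j)%:C%C *:
    (coframe (@qform R n) false i * coframe (@qform R n) true j).
Proof.
move=> oD vC Dq; rewrite /Delta (dformE false); apply: eq_bigr => i _.
rewrite -mulr_sumZ; congr (_ * _).
rewrite (@dxf_ext D i _ (fun y => \sum_j (partial (ridx j) v y)%:C%C *:
  coframe (@qform R n) true j)) => //; last first.
  move=> y Dy; rewrite (dformE true); apply: eq_bigr => j _.
  rewrite (@dxf_is j _ y ((partial (ridx j) v y)%:C%C *: 1)); first exact: mulr_Z1.
  by apply: is_fderive_real; exact: Ck_is_derive vC Dy.
apply: dxf_is; apply: is_fderive_sum => j; apply: is_fderive_real.
exact: Ck_is_derive (Ck_partial _ vC) Dq.
Qed.

Lemma Delta_herm_form (D : set point) v q : open D -> Ck 2 D v -> D q ->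
  Delta v q = herm_form (@qform R n) (qhessian v q).
Proof.
move=> oD vC Dq; rewrite (Delta_sum oD vC Dq) (qhessianE oD vC Dq).
have Hsym i j := real_hessianC i j oD vC Dq.
exact: esym (herm_form_sum (@qformD R n) (@qform0M R n) (@qform1M R n) (@qform_anti R n) Hsym).
Qed.

Lemma qform0_1 (l : 'I_n) : qform0 l 1 = omega (lshift n l) :> form.
Proof. by rewrite /qform0 (qalpha_real 1) (qbeta_real 1) scale0r addr0 scale1r. Qed.

Lemma qform1_1 (l : 'I_n) : qform1 l 1 = omega (rshift n l) :> form.
Proof.
by rewrite /qform1 (qalpha_real 1) (qbeta_real 1) conjc0 oppr0 scale0r add0r conjc1 scale1r.
Qed.

Lemma beta_beta_form : beta = beta_form (@qform R n).
Proof. by rewrite betaE; apply: eq_bigr => l _; rewrite /= qform0_1 qform1_1. Qed.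

HB.instance Definition _ := GRing.isLinear.Build C form C *%R (@top_coef R n)
  (fun a X Y => etrans (top_coefD _ _) (congr1 (+%R^~ _) (top_coefZ a X))).

Lemma top_coef_prod :
  top_coef (\prod_(l < n) (qform false l 1 * qform true l 1) : form) = 1.
Proof.
rewrite -(@top_coef_Omega2n R n) Omega2nE; congr top_coef.
by apply: eq_bigr => l _; rewrite /= qform0_1 qform1_1.
Qed.

End dform.

Section anticommuting_sums.
Context {R : realType} {A : algType R[i]} {I : finType}.
Implicit Types (c : I -> A) (W V B x : A).

Lemma sum_sym_anti (z : I -> I -> R) (X : I -> I -> A) :
  (forall i j, z i j = z j i) -> (forall i j, X i j = - X j i) ->
  \sum_i \sum_j (z i j)%:C%C *: X i j = 0.
Proof.
move=> zC XN; apply: anti_eq0.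
rewrite -[in LHS](sum_symmetric X zC) -sumrN; apply: eq_bigr => i _.
by rewrite -sumrN; apply: eq_bigr => j _; rewrite XN scalerN.
Qed.

Lemma leibniz_closed c (dW dV : I -> A) W V : (forall i, W * c i = c i * W) ->
  \sum_i c i * dW i = 0 -> \sum_i c i * dV i = 0 ->
  \sum_i c i * (dW i * V + W * dV i) = 0.
Proof.
move=> Wc W0 V0.
transitivity ((\sum_i c i * dW i) * V + W * \sum_i c i * dV i).
  rewrite mulr_suml mulr_sumr -big_split; apply: eq_bigr => i _.
  by rewrite mulrDr !mulrA Wc.
by rewrite W0 V0 mul0r mulr0 addr0.
Qed.

(** With third derivatives for [T] this says that d_0 of [Delta v] vanishes: coefficients symmetric
    in k and i meet the antisymmetric products of [c0 k] and [c0 i]. *)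
Lemma third_sum0 c0 c1 (T : I -> I -> I -> R) : (forall i j, c0 i * c0 j = - (c0 j * c0 i)) ->
  (forall k i j, T k i j = T i k j) ->
  \sum_k c0 k * (\sum_i \sum_j (T k i j)%:C%C *: (c0 i * c1 j)) = 0.
Proof.
move=> c00 Tki; transitivity (\sum_j \sum_k \sum_i (T k i j)%:C%C *: (c0 k * (c0 i * c1 j))).
  rewrite [RHS]exchange_big; apply: eq_bigr => k _; rewrite [RHS]exchange_big mulr_sumr.
  by apply: eq_bigr => i _; rewrite mulr_sumZ.
apply: big1 => j _; apply: (sum_sym_anti (z := fun k i => T k i j)) => //.
by move=> k i; rewrite !mulrA c00 mulNr.
Qed.

(** The same for d_1, pairing k with j once [c0 i] has been moved out of the way. *)
Lemma third_sum1 c0 c1 (T : I -> I -> I -> R) : (forall i j, c1 i * c1 j = - (c1 j * c1 i)) ->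
  (forall i j, c0 i * c1 j = - (c1 j * c0 i)) ->
  (forall k i j, T k i j = T j i k) ->
  \sum_k c1 k * (\sum_i \sum_j (T k i j)%:C%C *: (c0 i * c1 j)) = 0.
Proof.
move=> c11 c01 Tkj; transitivity (\sum_i \sum_k \sum_j (T k i j)%:C%C *: (c1 k * (c0 i * c1 j))).
  rewrite [RHS]exchange_big; apply: eq_bigr => k _; rewrite mulr_sumr.
  by apply: eq_bigr => i _; rewrite mulr_sumZ.
apply: big1 => i _; apply: (sum_sym_anti (z := fun k j => T k i j)) => //.
by move=> k j; rewrite !c01 !mulrN !mulrA c11 mulNr.
Qed.

(** Converts closedness into the divergence condition needed for the integration by parts: [c i]
    moves to the left past the even factors. *)
Lemma closed_div0 c (dW : I -> A) B x : (forall i, dW i * c i = c i * dW i) ->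
  (forall i, B * c i = c i * B) -> \sum_i c i * dW i = 0 ->
  \sum_i dW i * B * (c i * x) = 0.
Proof.
move=> dWc Bc W0; transitivity ((\sum_i c i * dW i) * (B * x)).
  rewrite mulr_suml; apply: eq_bigr => i _.
  by rewrite -dWc -!mulrA; congr (_ * _); rewrite !mulrA Bc.
by rewrite W0 mul0r.
Qed.

End anticommuting_sums.

(** * Products of the forms [Delta v] are closed *)

Section closed_forms.
Context {R : realType} {n : nat}.
Local Notation C := (R[i]).
Local Notation form := (form R n).
Local Notation point := 'rV[R]_(4 * n).
Local Notation I := ('I_n * 'I_4)%type.
Local Notation c0 := (coframe (@qform R n) false).
Local Notation c1 := (coframe (@qform R n) true).
Implicit Types (v u w : point -> R) (q : point) (W : point -> form) (dW : I -> point -> form).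
Variable D : set point.
Hypothesis oD : open D.

(** [dW i] is the derivative of [W] along the real coordinate [ridx i]; the two
    sums are then [d_0 W] and [d_1 W]. *)
Definition closed_even W dW q :=
  [/\ fcontinuous q W, central1 (W q), \sum_i c0 i * dW i q = 0,
      \sum_j c1 j * dW j q = 0 &
      forall i, [/\ is_fderive (ridx i) q W (dW i q), fcontinuous q (dW i) &
                   central1 (dW i q)]].

Lemma deg1_coframe b (i : I) : deg1 (coframe (@qform R n) b i).
Proof. exact: deg1_qform. Qed.

Lemma closed_even1 q : closed_even (fun=> 1) (fun _ _ => 0) q.
Proof.
split.
- exact: fcontinuous_cst.
- exact: central1_1.
- by apply: big1 => i _; exact: mulr0.
- by apply: big1 => i _; exact: mulr0.
- move=> i; split; [exact: is_fderive_cst|exact: fcontinuous_cst|].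
  by move=> H _; exact: (etrans (mul0r _) (esym (mulr0 _))).
Qed.

Lemma closed_evenM W dW V dV q : closed_even W dW q -> closed_even V dV q ->
  closed_even (fun y => W y * V y) (fun i y => dW i y * V y + W y * dV i y) q.
Proof.
move=> [cW eW W0 W1 HW] [cV eV V0 V1 HV]; split.
- exact: fcontinuousM.
- exact: central1M.
- exact: (@leibniz_closed R form I c0 (dW^~ q) (dV^~ q) (W q) (V q)
    (fun i => eW _ (deg1_coframe false i)) W0 V0).
- exact: (@leibniz_closed R form I c1 (dW^~ q) (dV^~ q) (W q) (V q)
    (fun i => eW _ (deg1_coframe true i)) W1 V1).
- move=> i; have [fW cdW edW] := HW i; have [fV cdV edV] := HV i; split.
  + exact: is_fderiveM.
  + by apply: fcontinuousD; exact: fcontinuousM.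
  + by apply: central1D; exact: central1M.
Qed.

(** Equal to [Delta v] on an open set where [v] is of class C^2; in this shape the coordinate
    derivatives are explicit. *)
Definition Delta_of v (y : point) : form :=
  \sum_i \sum_j (real_hessian v y i j)%:C%C *: (c0 i * c1 j).

Definition dDelta_of v (k : I) (y : point) : form :=
  \sum_i \sum_j (partial (ridx k) (partial (ridx i) (partial (ridx j) v)) y)%:C%C *: (c0 i * c1 j).

Lemma closed_even_Delta v q : Ck 4 D v -> D q -> closed_even (Delta_of v) (dDelta_of v) q.
Proof.
move=> vC Dq; have p1C j : Ck 3 D (partial (ridx j) v) by exact: Ck_partial.
have p2C i j : Ck 2 D (partial (ridx i) (partial (ridx j) v)) by exact: Ck_partial.
have p3C k i j : Ck 1 D (partial (ridx k) (partial (ridx i) (partial (ridx j) v))).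
  exact: Ck_partial.
have e11 i j : central1 (c0 i * c1 j) by apply: central1_11; exact: deg1_coframe.
have anti b i b' j : coframe (@qform R n) b i * coframe (@qform R n) b' j =
    - (coframe (@qform R n) b' j * coframe (@qform R n) b i) by exact: qform_anti.
pose T k i j := partial (ridx k) (partial (ridx i) (partial (ridx j) v)) q.
have T1 k i j : T k i j = T i k j.
  by apply: (partial_comm _ _ oD _ Dq); exact: (CkW (k := 3)).
have T2 k i j : T k i j = T k j i.
  apply: (partial_ext _ oD _ Dq) => y Dy; apply: (partial_comm _ _ oD _ Dy).
  exact: (CkW (k := 4)).
split.
- apply: fcontinuous_sum => i; apply: fcontinuous_sum => j; apply: fcontinuous_real.
  exact: Ck_continuous (p2C i j) Dq.
- by apply: central1_sum => i; apply: central1_sum => j; exact: central1Z.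
- exact: (@third_sum0 _ _ _ c0 c1 T (anti false ^~ false) T1).
- apply: (@third_sum1 _ _ _ c0 c1 T (anti true ^~ true)).
    by move=> i j; exact: anti.
  by move=> k i j; rewrite T2 T1 T2.
- move=> k; split.
  + apply: is_fderive_sum => i; apply: is_fderive_sum => j; apply: is_fderive_real.
    exact: Ck_is_derive (p2C i j) Dq.
  + apply: fcontinuous_sum => i; apply: fcontinuous_sum => j; apply: fcontinuous_real.
    exact: Ck_continuous (p3C k i j) Dq.
  + by apply: central1_sum => i; apply: central1_sum => j; exact: central1Z.
Qed.

Lemma closed_even_prod (J : Type) (r : seq J) (v : J -> point -> R) :
  (forall j, Ck 4 D (v j)) -> exists dW, forall q, D q ->
  closed_even (fun y => \prod_(j <- r) Delta_of (v j) y) dW q.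
Proof.
move=> vC; elim: r => [|j r [dW IH]].
  exists (fun _ _ => 0) => q Dq; under [X in closed_even X]eq_fun do rewrite big_nil.
  exact: closed_even1.
eexists => q Dq; under [X in closed_even X]eq_fun do rewrite big_cons.
apply: closed_evenM; last exact: IH.
exact: closed_even_Delta.
Qed.

End closed_forms.

(** * Moving [Delta] from the test function to [u] *)

Section current_ibp.
Context {R : realType} {n : nat}.
Local Notation C := (R[i]).
Local Notation form := (form R n).
Local Notation point := 'rV[R]_(4 * n).
Local Notation I := ('I_n * 'I_4)%type.
Local Notation c0 := (coframe (@qform R n) false).
Local Notation c1 := (coframe (@qform R n) true).
Local Notation mu := (@lebesgue_row R (4 * n)).
Implicit Types (v u w : point -> R) (q : point) (W : point -> form) (dW : I -> point -> form).

(** Allows the real and the imaginary part of a current to be treated at once. *)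
Definition real_part_like (part : C -> R) :=
  [/\ forall x y, part (x + y) = part x + part y,
      forall (r : R) x, part (r%:C%C * x) = r * part x,
      forall (i : 'I_(4 * n)) q (f : point -> C) df, is_cderive i q f df ->
        is_derive q (evec i) (part \o f) (part df) &
      forall q (f : point -> C), ccontinuous q f -> {for q, continuous (part \o f)}].

Lemma Re_part_like : real_part_like (@complex.Re R).
Proof.
split=> [x y|r x|i q f df []//|q f []//]; first exact: ReD.
by rewrite ReM mul0r subr0.
Qed.

Lemma Im_part_like : real_part_like (@complex.Im R).
Proof.
split=> [x y|r x|i q f df []//|q f []//]; first exact: ImD.
by rewrite ImM mul0r addr0.
Qed.

Variables (part : C -> R) (pl : real_part_like part).
Let phi (F : form) := part (top_coef F).

Let phiD F G : phi (F + G) = phi F + phi G.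
Proof. by case: pl => pD _ _ _; rewrite /phi top_coefD pD. Qed.

Let phiZ (r : R) F : phi (r%:C%C *: F) = r * phi F.
Proof. by case: pl => _ pZ _ _; rewrite /phi top_coefZ pZ. Qed.

Let phi0 : phi 0 = 0.
Proof. by have := phiZ 0 0; rewrite mul0r scale0r. Qed.

Let phi_sum (J : Type) (r : seq J) (F : J -> form) :
  phi (\sum_(j <- r) F j) = \sum_(j <- r) phi (F j).
Proof. exact: (big_morph phi phiD phi0). Qed.

Let mul_sum2 (A : algType C) (x y : A) (z : I -> I -> R) (X : I -> I -> A) :
  x * (y * \sum_i \sum_j (z i j)%:C%C *: X i j) =
  \sum_i \sum_j (z i j)%:C%C *: (x * (y * X i j)).
Proof.
rewrite !mulr_sumr; apply: eq_bigr => i _; rewrite mulr_sumZ mulr_sumZ.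
exact: eq_bigr.
Qed.

Variables (D : set point) (oD : open D) (W : point -> form) (dW : I -> point -> form).
Hypothesis HW : forall q, D q -> closed_even W dW q.
Variables (B : form) (eB : central1 B).

(** The coefficient of the second derivative of the test function along i and j in the current. Only
    [W] depends on the point, whence the form of [dc]. *)
Let c (i j : I) q := phi (W q * (B * (c0 i * c1 j))).
Let dc (i j k : I) q := phi (dW k q * (B * (c0 i * c1 j))).

Let cC i j q : D q -> {for q, continuous (c i j)}.
Proof.
case: pl => _ _ _ pC /HW[cW _ _ _ _]; apply: pC; apply: ccontinuous_top.
by apply: fcontinuousM cW _; exact: fcontinuous_cst.
Qed.

Let dcC i j k q : D q -> {for q, continuous (dc i j k)}.
Proof.
case: pl => _ _ _ pC /HW[_ _ _ _ /(_ k)[_ cdW _]]; apply: pC; apply: ccontinuous_top.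
by apply: fcontinuousM cdW _; exact: fcontinuous_cst.
Qed.

Let cD i j k q : D q -> is_derive q (evec (ridx k)) (c i j) (dc i j k q).
Proof.
case: pl => _ _ pd _ /HW[_ _ _ _ /(_ k)[dWk _ _]]; apply: pd; apply: is_cderive_top.
have := is_fderiveM dWk (is_fderive_cst (ridx k) q (B * (c0 i * c1 j))).
by rewrite mulr0 addr0.
Qed.

Let div1 j q : D q -> \sum_i dc i j i q = 0.
Proof.
move=> /HW[_ _ W0 _ HWi]; rewrite -phi_sum -phi0; congr phi.
have dWc i : dW i q * c0 i = c0 i * dW i q.
  by have [_ _] := HWi i; apply; exact: deg1_coframe.
have Bc i : B * c0 i = c0 i * B by apply: eB; exact: deg1_coframe.
rewrite -[RHS](@closed_div0 R form I c0 (dW^~ q) B (c1 j) dWc Bc W0).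
by apply: eq_bigr => i _; exact: mulrA.
Qed.

(** As for [div1], once [c1 j] is moved in front of [c0 i]; the sign goes into the constant
    factor. *)
Let div2 i q : D q -> \sum_j dc i j j q = 0.
Proof.
move=> /HW[_ _ _ W1 HWi]; rewrite -phi_sum -phi0; congr phi.
have dWc j : dW j q * c1 j = c1 j * dW j q.
  by have [_ _] := HWi j; apply; exact: deg1_coframe.
have Bc j : B * c1 j = c1 j * B by apply: eB; exact: deg1_coframe.
have := @closed_div0 R form I c1 (dW^~ q) B (- c0 i) dWc Bc W1.
move=> E; rewrite -[RHS]E; apply: eq_bigr => j _.
have E1 : c0 i * c1 j = c1 j * - c0 i.
  exact: etrans (@qform_anti R n false _ _ true _ _) (esym (mulrN _ _)).
exact: (etrans (congr1 (fun X => dW j q * (B * X)) E1) (mulrA _ _ _)).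
Qed.

Let phi_Delta q (z : I -> I -> R) : phi (W q * (B * \sum_i \sum_j (z i j)%:C%C *: (c0 i * c1 j))) =
  \sum_i \sum_j c i j q * z i j.
Proof.
rewrite (mul_sum2 (A := form)) phi_sum; apply: eq_bigr => i _; rewrite phi_sum.
by apply: eq_bigr => j _; rewrite phiZ mulrC.
Qed.

Lemma current_ibp u w : Ck 2 D u -> test_function D w ->
  (\int[mu]_(q in D) (u q * phi (W q * (B * Delta w q)))%:E =
   \int[mu]_(q in D) (w q * phi (W q * (B * Delta u q)))%:E)%E.
Proof.
move=> uC wT; have wC : Ck 2 D w by case: wT => /(_ 2).
have [E _] := integration_by_parts2 oD cC cD dcC div1 div2 uC wT.
transitivity (\int[mu]_(q in D)
    (u q * \sum_i \sum_j c i j q * partial (ridx i) (partial (ridx j) w) q)%:E)%E.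
  apply: eq_integral => q; rewrite inE => Dq; congr (_ * _)%:E.
  by rewrite (Delta_sum oD wC Dq) phi_Delta.
rewrite E; apply: eq_integral => q; rewrite inE => Dq; congr (_ * _)%:E.
rewrite (Delta_sum oD uC Dq) phi_Delta; apply: eq_bigr => i _; apply: eq_bigr => j _.
(* Green's identity leaves the two derivatives of [u] in the opposite order; the symmetry of the
   real Hessian restores it. *)
exact: (congr1 (fun r => c i j q * r) (real_hessianC j i oD uC Dq)).
Qed.

End current_ibp.

(** * Closure of the cone and the main theorem *)

(** At the first point c with p(c) <= 0, the mean value theorem on [0, c] would give p(c) >= p(0) >
    0. *)
Lemma poly_stays_pos (R : realType) (p : {poly R}) : 0 < p.[0] ->
  (forall x, 0 <= x -> (forall y, 0 <= y <= x -> 0 < p.[y]) -> 0 <= p^`().[x]) ->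
  forall x, 0 <= x -> 0 < p.[x].
Proof.
move=> p0 pd x x0; rewrite ltNge; apply/negP => px.
pose S := `[0, x]%classic `&` [set y | p.[y] <= 0].
have cp : continuous (horner p) by exact: continuous_horner.
have cS : compact S.
  apply: (subclosed_compact _ (segment_compact (a := 0) (b := x))); last by move=> y [].
  apply: closedI; first exact: interval_closed.
  by apply: (@preimage_closed _ _ (horner p) [set z | z <= 0]) => [y _|];
    [exact: cp|exact: closed_le].
have S0 : S !=set0 by exists x; split => //=; rewrite in_itv/= x0 lexx.
have ci : {within S, continuous (fun y : R => y)}.
  by apply: continuous_subspaceT => y; exact: cvg_id.
have [c cS' cmin] := compact_EVT_min S0 cS ci.
move: cS'; rewrite inE => -[/=]; rewrite in_itv/= => /andP[c0 cx] pc.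
have c_gt0 : 0 < c.
  by rewrite lt_neqAle c0 andbT; apply: contraTneq pc => <-; rewrite -ltNge.
have pos y : 0 <= y < c -> 0 < p.[y].
  move=> /andP[y0 yc]; rewrite ltNge; apply/negP => py.
  have : S y by split => //=; rewrite in_itv/= y0 (le_trans (ltW yc)).
  by rewrite -inE => /cmin; rewrite leNgt yc.
have [|z] := @MVT R (horner p) (horner p^`()) 0 c c_gt0.
- by apply: continuous_subspaceT => z; exact: cp.
rewrite in_itv/= => /andP[z0 zc] E.
have := pd z (ltW z0); rewrite leNgt => /(_ _)/negP[].
  by move=> y /andP[y0 yz]; apply: pos; rewrite y0 (le_lt_trans yz).
have : p.[c] - p.[0] < 0 by lra.
by rewrite E subr0 pmulr_llt0.
Qed.

Section closure_Gamma.
Context {R : realType} {n : nat}.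
Local Notation C := (R[i]).
Local Notation Q := (quat R).
Implicit Types (M N : 'M[Q]_n).

Definition qcomp (a : 'I_4) (x : Q) : R := tnth [tuple x.1.1.1; x.1.1.2; x.1.2; x.2] a.

Lemma quat_expand (x : Q) : x = \sum_a qunit a * qreal (qcomp a x).
Proof.
case: x => [[[a b] c] d].
rewrite sum_I4 -!quat_scaleE -[RHS]/(a * 1 + b * 0 + c * 0 + d * 0,
  a * 0 + b * 1 + c * 0 + d * 0, a * 0 + b * 0 + c * 1 + d * 0,
  a * 0 + b * 0 + c * 0 + d * 1).
by rewrite !(mulr0, mulr1, addr0, add0r).
Qed.

Lemma qcomp_continuous a : continuous (@qcomp a).
Proof.
move=> x; rewrite /continuous_at; case: a => -[|[|[|[|//]]]] ?; rewrite /qcomp /tnth /=.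
- by apply: (cvg_comp _ _ (cvg_comp _ _ cvg_fst cvg_fst) cvg_fst).
- by apply: (cvg_comp _ _ (cvg_comp _ _ cvg_fst cvg_fst) cvg_snd).
- by apply: (cvg_comp _ _ cvg_fst cvg_snd).
- exact: cvg_snd.
Qed.

Lemma qentry_continuous i j : continuous (fun M => M i j).
Proof.
move=> /= M s /= /(nbhs_ballP (M i j)) [e e0 es].
by apply/nbhs_ballP; exists e => //= N [_ MN]; exact/es/MN.
Qed.

Lemma qcomp_entry_continuous a i j : continuous (fun M => qcomp a (M i j)).
Proof.
move=> M; apply: (cvg_comp (fun N => N i j) (qcomp a) _ (@qcomp_continuous a (M i j))).
exact: qentry_continuous.
Qed.

Lemma Gamma_bar_perturb m M :
  (forall e : R, 0 < e -> Gamma m ((qreal e)%:M + M)) -> Gamma_bar m M.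
Proof.
move=> GM B /nbhs_ballP[e /= e0 HB]; exists ((qreal (e / 2))%:M + M); split.
  by apply: GM; rewrite divr_gt0.
have near t (r : R) : `|t| < e -> ball r e (t + r).
  by move=> te; rewrite /ball/= opprD addrCA subrr addr0 normrN.
apply: HB; split=> // i j; rewrite !mxE.
have e2 : `|e / 2| < e by rewrite ger0_norm; lra.
have n0 : `|0 : R| < e by rewrite normr0.
case: (i == j); rewrite ?mulr1n ?mulr0n; case: (M i j) => [[[a b] c] d].
  by split; [split; [split|]|]; exact: near.
by split; [split; [split|]|]; exact: near.
Qed.

End closure_Gamma.

Section real_part_poly.
Context {R : realType}.
Implicit Types (P : {poly R[i]}) (x : R).

(** The real part of [P] on the real line, so that the mean value argument for real polynomials
    applies to a complex pencil. *)
Definition re_poly P : {poly R} := \poly_(i < size P) complex.Re P`_i.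

Lemma coef_re_poly P i : (re_poly P)`_i = complex.Re P`_i.
Proof. by rewrite coef_poly; case: ltnP => // Pi; rewrite nth_default. Qed.

Lemma re_horner P x : complex.Re P.[x%:C%C] = (re_poly P).[x].
Proof.
rewrite horner_poly horner_coef.
have -> : complex.Re (\sum_(i < size P) P`_i * x%:C%C ^+ i) =
    \sum_(i < size P) complex.Re (P`_i * x%:C%C ^+ i).
  by apply: big_morph => // u v; exact: ReD.
apply: eq_bigr => i _; rewrite (_ : x%:C%C ^+ i = (x ^+ i)%:C%C); last first.
  by rewrite rmorphXn.
by rewrite ReM mulr0 subr0.
Qed.

Lemma deriv_re_poly P : (re_poly P)^`() = re_poly P^`().
Proof.
apply/polyP => i; rewrite coef_deriv !coef_re_poly coef_deriv.
move: (P`_i.+1) => z; elim: i.+1 => [|j IHj]; first by rewrite !mulr0n.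
by rewrite !mulrS ReD IHj.
Qed.

End real_part_poly.

Lemma continuous_sum (R : realType) (T : topologicalType) (I : finType)
    (F : I -> T -> R) : (forall i, continuous (F i)) -> continuous (fun x => \sum_i F i x).
Proof.
move=> cF; have -> : (fun x => \sum_i F i x) = \sum_i F i.
  by apply/funext => x; rewrite fct_sumE.
elim/big_ind: _ => [x|f g cf cg x|i _]; first exact: cst_continuous.
  exact: continuousD (cf x) (cg x).
exact: cF.
Qed.

Section closure_garding.
Context {R : realType} {n : nat}.
Local Notation C := (R[i]).
Local Notation Q := (quat R).
Context {A : algType C} (f : bool -> 'I_n -> Q -> A).
Hypothesis fD : forall b l x y, f b l (x + y) = f b l x + f b l y.
Hypothesis f0M : forall l x z,
  f false l (x * z) = qalpha z *: f false l x + qbeta z *: f true l x.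
Hypothesis f1M : forall l x z,
  f true l (x * z) = - (qbeta z)^*%C *: f false l x + (qalpha z)^*%C *: f true l x.
Hypothesis f_anti : forall b l x b' k y, f b l x * f b' k y = - (f b' k y * f b l x).
Variable tau : {scalar A}.
Hypothesis tau1 : tau (\prod_l (f false l 1 * f true l 1)) = 1.
Implicit Types (M N U : 'M[Q]_n).
Local Notation herm_form := (herm_form f).
Local Notation beta_form := (beta_form f).

(** Linear in the real components of the entries, hence the continuity in [M] used below. *)
Lemma herm_form_entries M : herm_form M = \sum_l \sum_k \sum_a
  (qcomp a (M l k))%:C%C *: (2^-1 *: fpair f l (qunit a) k 1).
Proof.
rewrite /herm_form scaler_sumr; apply: eq_bigr => l _; rewrite scaler_sumr.
apply: eq_bigr => k _; rewrite {1}(quat_expand (M l k)) (fpair_suml fD) scaler_sumr.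
apply: eq_bigr => a _; rewrite (fpair_real f0M f1M).
by rewrite !scalerA mulrC.
Qed.

Let coefK (x y : A) l k a : C := tau (x * (2^-1 *: fpair f l (qunit a) k 1) * y).

Let tau_entries x y M : tau (x * herm_form M * y) =
  \sum_l \sum_k \sum_a (qcomp a (M l k))%:C%C * coefK x y l k a.
Proof.
rewrite herm_form_entries mulr_sumr mulr_suml linear_sum; apply: eq_bigr => l _.
rewrite mulr_sumr mulr_suml linear_sum; apply: eq_bigr => k _.
rewrite mulr_sumr mulr_suml linear_sum; apply: eq_bigr => a _.
by rewrite -scalerAr -scalerAl linearZ.
Qed.

Let entries_continuous (r : 'I_n -> 'I_n -> 'I_4 -> R) :
  continuous (fun M => \sum_l \sum_k \sum_a qcomp a (M l k) * r l k a).
Proof.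
apply: continuous_sum => l; apply: continuous_sum => k; apply: continuous_sum => a M.
have H : qcomp a (N l k) @[N --> M] --> qcomp a (M l k) by exact: qcomp_entry_continuous.
exact: cvgMr_tmp H.
Qed.

Lemma tau_herm_continuous x y :
  continuous (fun M => complex.Re (tau (x * herm_form M * y))) /\
  continuous (fun M => complex.Im (tau (x * herm_form M * y))).
Proof.
have ReS (I : Type) (s : seq I) (F : I -> C) :
    complex.Re (\sum_(i <- s) F i) = \sum_(i <- s) complex.Re (F i).
  by apply: big_morph => // u v; exact: ReD.
have ImS (I : Type) (s : seq I) (F : I -> C) :
    complex.Im (\sum_(i <- s) F i) = \sum_(i <- s) complex.Im (F i).
  by apply: big_morph => // u v; exact: ImD.
split.
  have -> : (fun M => complex.Re (tau (x * herm_form M * y))) =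
      (fun M => \sum_l \sum_k \sum_a qcomp a (M l k) * complex.Re (coefK x y l k a)).
    apply/funext => M; rewrite tau_entries ReS; apply: eq_bigr => l _.
    rewrite ReS; apply: eq_bigr => k _; rewrite ReS; apply: eq_bigr => a _.
    by rewrite ReM mul0r subr0.
  exact: entries_continuous.
have -> : (fun M => complex.Im (tau (x * herm_form M * y))) =
    (fun M => \sum_l \sum_k \sum_a qcomp a (M l k) * complex.Im (coefK x y l k a)).
  apply/funext => M; rewrite tau_entries ImS; apply: eq_bigr => l _.
  rewrite ImS; apply: eq_bigr => k _; rewrite ImS; apply: eq_bigr => a _.
  by rewrite ImM mul0r addr0.
exact: entries_continuous.
Qed.

Lemma closed_tau_nonneg x y : closed [set M | 0 <= tau (x * herm_form M * y)].
Proof.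
have [cRe cIm] := tau_herm_continuous x y.
have -> : [set M | 0 <= tau (x * herm_form M * y)] =
    (fun M => complex.Re (tau (x * herm_form M * y))) @^-1` [set t | 0 <= t] `&`
    (fun M => complex.Im (tau (x * herm_form M * y))) @^-1` [set t | t = 0].
  apply/seteqP; split => M /=; rewrite lecE /=.
    by move=> /andP[/eqP].
  by move=> [-> ->]; rewrite eqxx.
apply: closedI; apply: preimage_closed.
- by move=> M _; exact: cRe.
- exact: closed_ge.
- by move=> M _; exact: cIm.
- exact: closed_eq.
Qed.

(** Replaces the matrices of the open cone by limits one factor at a time: the
    expression is continuous in each factor. *)
Theorem garding_closure m (s1 s2 : seq 'M[Q]_n) : (m <= n)%N ->
  (size s1 + size s2 = m)%N -> (forall M, M \in s1 -> Gamma_bar m M) ->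
  (forall M, M \in s2 -> Gamma m M) ->
  0 <= tau ((\prod_(M <- s1 ++ s2) herm_form M) * beta_form ^+ (n - m)).
Proof.
move=> mn; elim/last_ind: s1 s2 => [|s1 M IHs] s2 sz s1G s2G.
  have := @garding_Gamma _ _ _ _ fD f0M f1M f_anti tau tau1 s2.
  by rewrite add0n in sz; rewrite sz => /(_ mn s2G)/ltW.
rewrite cat_rcons big_cat big_cons /= mulrA -[_ * _ * beta_form ^+ _]mulrA.
set x := \prod_(N <- s1) _; set y := _ * beta_form ^+ _.
(* For a matrix of the open cone in this slot, the factor joins [s2] and the induction hypothesis
   applies. *)
have sub : Gamma m `<=` [set N | 0 <= tau (x * herm_form N * y)].
  move=> N GN /=; have := IHs (N :: s2).
  rewrite big_cat big_cons /= -/x -!mulrA; apply.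
  - by rewrite -sz size_rcons addSnnS.
  - by move=> L Ls; apply: s1G; rewrite mem_rcons in_cons Ls orbT.
  - by move=> L; rewrite in_cons => /predU1P[->//|]; exact: s2G.
have : Gamma_bar m M by apply: s1G; rewrite mem_rcons in_cons eqxx.
by move=> /(closure_subset sub); rewrite -(closure_id _).1//; exact: closed_tau_nonneg.
Qed.

Section ray.
Variables (m : nat) (M : 'M[Q]_n).
Hypotheses (mn : (m < n)%N) (MH : hyperhermitian M).
Let k := m.+1.
Let w := beta_form ^+ (n - k).
(** The roles are exchanged with respect to the cone: the base point is the identity and the
    direction is [M], so that the variable runs along the ray I + x M. *)
Let P := pencil_poly tau k w beta_form (herm_form M).

Let beta_comm : GRing.comm beta_form (herm_form M).
Proof.
rewrite -(herm_form1 fD f0M f1M f_anti).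
apply: (herm_form_comm fD f0M f1M f_anti) => //; exact: (hyperhermitian_scalar 1).
Qed.

Let shiftH (t y : R) : hyperhermitian ((qreal t)%:M + qreal y *: M).
Proof.
by apply: hyperhermitianD; [exact: hyperhermitian_scalar|exact: hyperhermitianZ].
Qed.

Let form_shift (t y : R) : 0 < t -> herm_form ((qreal t)%:M + qreal y *: M) =
  t%:C%C *: (beta_form + (y / t)%:C%C *: herm_form M).
Proof.
move=> t0; rewrite (herm_form_shift fD f0M f1M f_anti) (herm_formZ f0M f1M) addrC.
by rewrite scalerDr scalerA -rmorphM/= mulrCA mulfV ?mulr1// gt_eqF.
Qed.

Let tauP (t y : R) : 0 < t -> tau (herm_form ((qreal t)%:M + qreal y *: M) ^+ k * w) =
  (t ^+ k)%:C%C * P.[(y / t)%:C%C].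
Proof.
move=> t0; rewrite form_shift// horner_pencil; last exact: beta_comm.
by rewrite exprZn -scalerAl linearZ/= rmorphXn.
Qed.

(** Homogeneity: t I + y M is t times the point of the ray with parameter y / t. *)
Let HmP (t y : R) : 0 < t -> 0 < (re_poly P).[y / t] ->
  0 < Hm k ((qreal t)%:M + qreal y *: M).
Proof.
move=> t0 py; have := tau_Hm fD f0M f1M f_anti tau1 mn (shiftH t y).
rewrite (tauP _ t0) => /(congr1 (@complex.Re R)) /=.
have -> (z : C) j : complex.Re (z *+ j) = complex.Re z *+ j.
  by elim: j => // j IHj; rewrite !mulrS ReD IHj.
rewrite ReM mul0r subr0 /= re_horner => E.
have : 0 < n`!%:R * Hm k ((qreal t)%:M + qreal y *: M).
  by rewrite -E pmulrn_lgt0 ?bin_gt0// mulr_gt0 ?exprn_gt0.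
by rewrite pmulr_rgt0// ltr0n fact_gt0.
Qed.

(** The hypothesis says that the polynomial [x |-> Hm k (1 + x M)], up to a positive
    constant, is nondecreasing as long as it is positive. *)
Lemma Gamma_bar_ray :
  (forall x : R, 0 <= x -> Gamma k ((qreal 1)%:M + qreal x *: M) ->
    0 <= complex.Re (tau (herm_form ((qreal 1)%:M + qreal x *: M) ^+ m *
      (herm_form M * w)))) ->
  Gamma_bar k M.
Proof.
move=> H; have pos x : 0 <= x -> 0 < (re_poly P).[x].
  apply: poly_stays_pos.
    have [_ b0 _] := hyperbolic_Hm fD f0M f1M f_anti tau1 mn.
    rewrite -re_horner horner_pencil; last exact: beta_comm.
    by rewrite scale0r addr0; move: b0; rewrite ltcE => /andP[].
  move=> {}x x0 px; rewrite deriv_re_poly -re_horner /P deriv_pencil.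
  rewrite hornerZ horner_pencil; last exact: beta_comm.
  have := H x x0; rewrite (@form_shift 1 x ltr01) divr1 scale1r => Hx.
  have nat_ge (z : C) : 0 <= complex.Re z -> 0 <= complex.Re (k%:R * z).
    move=> z0; rewrite (_ : k%:R = (k%:R : R)%:C%C); last by rewrite rmorph_nat.
    by rewrite ReM mul0r subr0 mulr_ge0.
  (* For I + x M to be in [Gamma k], the matrix (1 + s) I + x M must have positive [Hm]; its
     parameter on the ray is x / (1 + s) <= x, where positivity is already known. *)
  apply: nat_ge; apply: Hx; split=> [|s s0]; first exact: shiftH.
  rewrite addrA -raddfD/= -qrealD; apply: HmP; first lra.
  apply: px; rewrite divr_ge0//=; last lra.
  by rewrite ler_pdivrMr; [rewrite ler_peMr//; lra|lra].
apply: Gamma_bar_perturb => e e0; split.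
  by rewrite -[M]scale1r; exact: (shiftH e 1).
move=> s s0; rewrite addrA -raddfD/= -qrealD -[M]scale1r; apply: HmP; first lra.
by apply: pos; rewrite divr_ge0//; lra.
Qed.

End ray.

End closure_garding.

(** * Quadratic functions with prescribed Hessian *)

Section quadratic.
Context {R : realType} {n : nat}.
Local Notation Q := (quat R).
Local Notation point := 'rV[R]_(4 * n).
Local Notation I := ('I_n * 'I_4)%type.
Implicit Types (q x : point) (D : set point).

Lemma is_derive_fsum (J : Type) (r : seq J) (F : J -> point -> R) (dF : J -> R) q (v : point) :
  (forall j, is_derive q v (F j) (dF j)) ->
  is_derive q v (fun y => \sum_(j <- r) F j y) (\sum_(j <- r) dF j).
Proof.
move=> HF; elim: r => [|j r IHr].
  by under eq_fun do rewrite big_nil; rewrite big_nil; exact: is_derive_cst.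
under eq_fun do rewrite big_cons.
by rewrite big_cons; exact: is_deriveD.
Qed.

Variable K : I -> I -> R.
Hypothesis KC : forall i j, K i j = K j i.

Definition quadratic (x : point) : R :=
  2^-1 * \sum_i \sum_j K i j * (x ord0 (ridx i) * x ord0 (ridx j)).

Let linear_part (b : I) x := \sum_j K b j * x ord0 (ridx j).

Let is_derive_ridx (i b : I) x :
  is_derive x (evec (ridx b)) (fun y => y ord0 (ridx i)) ((i == b)%:R : R).
Proof.
have := @is_derive_coord R _ id 1 (ridx i) (ridx b) x (is_derive_id _ _).
by rewrite (inj_eq (@ridx_inj n)).
Qed.

Let sum_delta (G : I -> R) (b : I) : \sum_j G j * (j == b)%:R = G b.
Proof.
rewrite (bigD1 b)//= eqxx mulr1 big1 ?addr0// => j /negbTE ->.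
by rewrite mulr0.
Qed.

Let is_deriveZ_real (c : R) (g : point -> R) (b : I) x dg :
  is_derive x (evec (ridx b)) g dg -> is_derive x (evec (ridx b)) (fun y => c * g y) (c * dg).
Proof. by move=> Hg; exact: (is_deriveZ c Hg). Qed.

Let partial_quadratic (b : I) : partial (ridx b) quadratic = linear_part b.
Proof.
apply/funext => x.
have H i j : is_derive x (evec (ridx b))
    (fun y => K i j * (y ord0 (ridx i) * y ord0 (ridx j)))
    (K i j * ((i == b)%:R * x ord0 (ridx j) + x ord0 (ridx i) * (j == b)%:R)).
  apply: is_deriveZ_real.
  apply: (is_derive_eq (is_deriveM (is_derive_ridx i b x) (is_derive_ridx j b x))).
  by rewrite /GRing.scale/= addrC mulrC; congr (_ + _); rewrite mulrC.
have [_] : is_derive x (evec (ridx b)) quadratic _ := is_deriveZ_real 2^-1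
  (is_derive_fsum (index_enum _) (fun i => is_derive_fsum (index_enum _) (H i))).
rewrite -/(partial _ _ _) => ->.
have -> : \sum_i \sum_j K i j * ((i == b)%:R * x ord0 (ridx j) + x ord0 (ridx i) * (j == b)%:R) =
    linear_part b x + linear_part b x.
  transitivity (\sum_i \sum_j K i j * x ord0 (ridx j) * (i == b)%:R +
      \sum_i \sum_j K i j * x ord0 (ridx i) * (j == b)%:R).
    rewrite -big_split; apply: eq_bigr => i _; rewrite -big_split; apply: eq_bigr => j _.
    by rewrite mulrDr mulrA mulrAC mulrA.
  congr (_ + _); last by apply: eq_bigr => i _; rewrite sum_delta KC.
  by rewrite exchange_big; apply: eq_bigr => j _; rewrite sum_delta.
by move: (linear_part b x) => t; lra.
Qed.

Lemma real_hessian_quadratic q i j : real_hessian quadratic q i j = K i j.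
Proof.
rewrite /real_hessian partial_quadratic.
have [_] : is_derive q (evec (ridx i)) (linear_part j) _ :=
  is_derive_fsum (index_enum _) (fun l => is_deriveZ_real (K j l) (is_derive_ridx l i q)).
by rewrite -/(partial _ _ _) => ->; rewrite sum_delta KC.
Qed.

Lemma Ck_quadratic k D : open D -> Ck k D quadratic.
Proof.
move=> oD; have Cx i : Ck k D (fun x : point => x ord0 (ridx i)).
  pose phi (j : nat) (t : R) : R := match j with 0 => t | 1 => 1 | _ => 0 end.
  apply: (@Ck_coord _ _ k D phi 0 _ oD) => -[|[|j]] t; first exact: is_derive_id.
    exact: (is_derive_cst (1 : R)).
  exact: (is_derive_cst (0 : R)).
apply: CkM => //; first exact: Ck_cst.
apply: Ck_sum => // i; apply: Ck_sum => // j.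
by apply: CkM => //; [exact: Ck_cst|exact: CkM].
Qed.

Lemma qhessian_quadratic q : qhessian quadratic q = quat_of_real_form K.
Proof.
rewrite (qhessianE openT (Ck_quadratic 2 openT) (Logic.I : setT q)).
by congr quat_of_real_form; apply/funext => i; apply/funext => j; exact: real_hessian_quadratic.
Qed.

End quadratic.

(** The four products of a unit with its conjugate add up to 4, so the real form whose quaternionic
    matrix is the identity carries a quarter. *)
Lemma quat_of_shifted_form (R : realType) (n : nat)
    (H : 'I_n * 'I_4 -> 'I_n * 'I_4 -> R) (x : R) :
  quat_of_real_form (fun i j => (i == j)%:R / 4 + x * H i j) =
  (qreal 1)%:M + qreal x *: quat_of_real_form H.
Proof.
apply/matrixP => l k; rewrite !mxE mulr_sumr.
have -> : (qreal 1 *+ (l == k) : quat R) = \sum_(a < 4) \sum_(b < 4)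
    (qunit a * qconj (qunit b)) * qreal (((l, a) == (k, b))%:R / 4).
  have [->|lk] := eqVneq l k; last first.
    rewrite mulr0n; apply/esym; apply: big1 => a _; apply: big1 => b _.
    by rewrite xpair_eqE (negbTE lk) mul0r; exact: mulr0.
  rewrite mulr1n; transitivity (\sum_(a < 4) qreal (4^-1 : R)).
    by rewrite -qreal_sum sumr_const card_ord -[_ *+ 4]mulr_natr mulVf// pnatr_eq0.
  apply: eq_bigr => a _; rewrite (bigD1 a)//= eqxx mul1r big1 => [|b ba].
    rewrite addr0 qmul_conj -qrealM.
    rewrite (_ : qnorm2 (qunit a) = 1) ?mul1r//.
    by rewrite /qnorm2; case: a => -[|[|[|[|//]]]] ?;
      rewrite /qunit /tnth/= !expr0n expr1n/= ?(addr0, add0r).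
  by rewrite xpair_eqE eqxx eq_sym (negbTE ba) mul0r; exact: mulr0.
rewrite -big_split; apply: eq_bigr => a _; rewrite mulr_sumr -big_split; apply: eq_bigr => b _.
rewrite qrealD mulrDr qrealM; congr (_ + _).
by rewrite [RHS]mulrA [qreal x * (_ * qconj _)]qrealC !mulrA.
Qed.

(** * The density of the current and its sign *)

Section currents.
Context {R : realType} {n : nat}.
Local Notation C := (R[i]).
Local Notation form := (form R n).
Local Notation point := 'rV[R]_(4 * n).
Local Notation mu := (@lebesgue_row R (4 * n)).
Local Notation hform := (herm_form (@qform R n)).
Local Notation bform := (beta_form (@qform R n)).
Implicit Types (u w : point -> R) (q : point) (D : set point).

Definition current_density (k r : nat) (v : 'I_k -> point -> R) u q : form :=
  (\prod_(j < k) hform (qhessian (v j) q)) * (bform ^+ r * hform (qhessian u q)).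

Lemma central1_bform r : central1 (bform ^+ r).
Proof.
apply: central1X; rewrite -beta_beta_form betaE; apply: central1_sum => l.
by apply: central1_11; exact: deg1_omega.
Qed.

(** The factors [Delta (v j)] give a closed even form and the power of [beta] is constant and even,
    which is the situation of [current_ibp]; on the right [w] is no longer differentiated. *)
Lemma form_integral_ibp (part : C -> R) k r D (v : 'I_k -> point -> R) u w :
  @real_part_like R n part -> open D -> (forall j, Ck 4 D (v j)) -> Ck 2 D u ->
  test_function D w ->
  form_integral D (fun q => (u q)%:E) (fun q =>
    wedge (\big[wedge/form1]_(j < k) Delta (v j) q) (wedge (wpow beta r) (Delta w q))) part =
  (\int[mu]_(q in D) (w q * part (top_coef (current_density r v u q)))%:E)%E.
Proof.
move=> pl oD vC uC wT.
have [dW HW] := closed_even_prod oD (index_enum 'I_k) vC.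
have vC2 j : Ck 2 D (v j) by exact: CkW (vC j).
have WE q : D q -> \big[wedge/form1]_(j < k) Delta (v j) q = \prod_(j < k) Delta_of (v j) q.
  by move=> Dq; apply: eq_bigr => j _; exact: Delta_sum oD (vC2 j) Dq.
have := current_ibp pl oD HW (@central1_bform r) uC wT => ibp.
rewrite /form_integral; transitivity (\int[mu]_(q in D) (u q * part (top_coef
    ((\prod_(j < k) Delta_of (v j) q) * (bform ^+ r * Delta w q))))%:E)%E.
  apply: eq_integral => q; rewrite inE => Dq.
  by rewrite (WE q Dq) wpowE beta_beta_form EFinM.
rewrite ibp; apply: eq_integral => q; rewrite inE => Dq.
congr (_ * part (top_coef _))%:E.
have WH : \prod_(j < k) Delta_of (v j) q = \prod_(j < k) hform (qhessian (v j) q).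
  rewrite -(WE q Dq); apply: eq_bigr => j _; exact: Delta_herm_form oD (vC2 j) Dq.
by rewrite WH (Delta_herm_form oD uC Dq).
Qed.

End currents.

Section positivity.
Context {R : realType} {n : nat}.
Local Notation form := (form R n).
Local Notation point := 'rV[R]_(4 * n).
Local Notation hform := (herm_form (@qform R n)).
Local Notation bform := (beta_form (@qform R n)).
Local Notation fD := (@qformD R n).
Local Notation f0M := (@qform0M R n).
Local Notation f1M := (@qform1M R n).
Local Notation f_anti := (@qform_anti R n).
Implicit Types (M : 'M[quat R]_n).

Lemma bform_hform_comm r M : hyperhermitian M -> bform ^+ r * hform M = hform M * bform ^+ r.
Proof.
move=> MH; apply/esym/commrX; rewrite /GRing.comm -(herm_form1 fD f0M f1M f_anti).
exact: (herm_form_comm fD f0M f1M f_anti MH (hyperhermitian_scalar 1)).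
Qed.

(** [garding_closure] with k + 1 factors, all of them limits, the Hessian of [u] being the last
    one. *)
Lemma current_density_ge0 k (v : 'I_k -> point -> R) u q : (k < n)%N ->
  (forall j, Gamma_bar k.+1 (qhessian (v j) q)) ->
  hyperhermitian (qhessian u q) -> Gamma_bar k.+1 (qhessian u q) ->
  0 <= top_coef (current_density (n - k.+1) v u q).
Proof.
move=> kn vG uH uG.
pose s := rcons [seq qhessian (v j) q | j <- index_enum 'I_k] (qhessian u q).
have sz : (size s + 0 = k.+1)%N.
  by rewrite addn0 size_rcons size_map -[index_enum _]enumT size_enum_ord.
have sG M : M \in s -> Gamma_bar k.+1 M.
  by rewrite mem_rcons in_cons => /predU1P[->//|/mapP[j _ ->]]; exact: vG.
have nil0 M : M \in [::] -> Gamma k.+1 M by [].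
have := @garding_closure R n form (@qform R n) fD f0M f1M f_anti (@top_coef R n)
  (@top_coef_prod R n) k.+1 s [::] kn sz sG nil0.
rewrite cats0 big_rcons big_map /= => /le_trans; apply.
rewrite le_eqVlt; apply/orP; left; apply/eqP; congr top_coef.
rewrite /current_density bform_hform_comm//; exact/esym/mulrA.
Qed.

Lemma current_density_continuous k r (v : 'I_k -> point -> R) u (D : set point) q :
  open D -> (forall j, Ck 4 D (v j)) -> Ck 2 D u -> D q ->
  {for q, continuous (fun y => complex.Re (top_coef (current_density r v u y)))}.
Proof.
move=> oD vC uC Dq.
have vC2 j : Ck 2 D (v j) by exact: CkW (vC j).
pose F y := (\prod_(j < k) Delta_of (v j) y) * (bform ^+ r * Delta_of u y).
have FE y : D y -> F y = current_density r v u y.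
  move=> Dy; have DE g : Ck 2 D g -> Delta_of g y = hform (qhessian g y).
    by move=> gC; exact: etrans (esym (Delta_sum oD gC Dy)) (Delta_herm_form oD gC Dy).
  exact: (f_equal2 (fun a b => a * (bform ^+ r * b))
    (eq_bigr _ (fun j _ => DE _ (vC2 j))) (DE u uC)).
have [dW HW] := closed_even_prod oD (index_enum 'I_k) vC.
have [cW _ _ _ _] := HW q Dq.
have cF : fcontinuous q F.
  apply: fcontinuousM cW _; apply: fcontinuousM; first exact: fcontinuous_cst.
  apply: fcontinuous_sum => i; apply: fcontinuous_sum => j; apply: fcontinuous_real.
  exact: Ck_continuous (Ck_partial _ (Ck_partial _ uC)) Dq.
have [cRe _] := ccontinuous_top cF.
apply: near_eq_continuous cRe.
by apply: filterS (open_nbhs_nbhs (conj oD Dq)) => y /FE ->.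
Qed.

End positivity.

Theorem proposition4p2 (R : realType) (n m : nat) (Omega : set 'rV[R]_(4 * n))
    (u : 'rV[R]_(4 * n) -> R)
    (Omega_domain : is_domain Omega) (m_range : (1 <= m <= n)%N)
    (u_C2 : Ck 2 Omega u) :
  qm_subharmonic m Omega (fun q => (u q)%:E) <->
  (forall q, Omega q -> Gamma_bar m (qhessian u q)).
Proof.
have [oO _ _] := Omega_domain.
have uH q : Omega q -> hyperhermitian (qhessian u q) by exact: qhessian_hyperhermitian oO u_C2.
(* From here on m = k + 1, so the currents contain k functions [v j]. *)
case: m m_range => // k kn.
split=> [[_ _ _ cur] q0 Oq0|uG].
  apply: (@Gamma_bar_ray R n (form R n) (@qform R n) (@qformD R n) (@qform0M R n)
    (@qform1M R n) (@qform_anti R n) (@top_coef R n) (@top_coef_prod R n) k _ kn (uH _ Oq0)).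
  move=> x x0 Gx.
  (* All the [v j] are one quadratic function whose quaternionic Hessian is I + x A at every point,
     with A the Hessian of [u] at [q0]; it is admissible by [Gx]. *)
  pose K i j := (i == j)%:R / 4 + x * real_hessian u q0 i j.
  have KC i j : K i j = K j i.
    by rewrite /K eq_sym (real_hessianC i j oO u_C2 Oq0).
  pose v (j : 'I_k) := quadratic K.
  have vH q : qhessian (quadratic K) q = (qreal 1)%:M + qreal x *: qhessian u q0.
    by rewrite qhessian_quadratic// quat_of_shifted_form (qhessianE oO u_C2 Oq0).
  have vC j : Ck 4 Omega (v j) by exact: Ck_quadratic.
  have vmsh j : Ck_qmsh 4 k.+1 Omega (v j).
    by split=> // q _; rewrite /v vH; exact: subset_closure.
  (* Nonnegative integrals against all test functions give the sign of the continuous density at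
     [q0], where it has k factors I + x A and one factor A. *)
  have h0 : 0 <= complex.Re (top_coef (current_density (n - k.+1) v u q0)).
    apply: (test_nonneg (h := fun q => complex.Re (top_coef (current_density (n - k.+1) v u q)))
      oO _ Oq0) => [q Oq|w wT w0]; first exact: current_density_continuous vC u_C2 Oq.
    rewrite -(form_integral_ibp _ Re_part_like oO vC u_C2 wT).
    by have [] := cur v w vmsh wT w0.
  move: h0; rewrite /current_density bform_hform_comm; last exact: uH.
  rewrite (eq_bigr (fun=> herm_form (@qform R n) ((qreal 1)%:M + qreal x *: qhessian u q0))).
    by rewrite prodr_const card_ord.
  by move=> j _; rewrite /v vH.
split.
- by move=> q _; exact: ltry.
- move=> q a Oq; rewrite lte_fin => ua.
  exact: (cvgr_lt (u q) (Ck_continuous u_C2 Oq)).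
- by move=> K cK KO; apply: (integrable_compact_row oO cK KO) => x Ox; exact: Ck_continuous u_C2 Ox.
move=> v w vmsh wT w0.
have vC j : Ck 4 Omega (v j) by case: (vmsh j).
(* Nonnegative in [R[i]] includes real, so this settles both the imaginary and the real integral. *)
have pos q : Omega q -> 0 <= top_coef (current_density (n - k.+1) v u q).
  by move=> Oq; apply: current_density_ge0 => //; [move=> j; case: (vmsh j) => _;
    exact|exact: uH|exact: uG].
split.
  rewrite (form_integral_ibp _ Im_part_like oO vC u_C2 wT) integral0_eq// => q Oq.
  by have := pos q Oq; rewrite lecE => /andP[/eqP -> _]; rewrite mulr0.
rewrite (form_integral_ibp _ Re_part_like oO vC u_C2 wT).
apply: integral_ge0 => q Oq; have := pos q Oq; rewrite lecE => /andP[_ p].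
by rewrite lee_fin mulr_ge0// w0.
Qed.
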